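(* Let $D\subsetneq\mathbb{C}$ be a simply connected region and let $f$ be a conformal mapping in $D$. Then $$\lambda_D(z)\le \frac{|f'(z)|}{\delta_{f(D)}(f(z))}\le 4\,\lambda_D(z)$$ for all $z\in D$. The inequalities are sharp, i.e. the constants $1$ (on the left) and $4$ (on the right) are best possible.
   Context: A region is an open connected set. A conformal mapping in a region $D$ is an analytic univalent (injective) function $f:D\to\mathbb{C}$. For a region $G\subsetneq\mathbb{C}$ and $w\in G$, $\delta_G(w)=\operatorname{dist}(w,\partial G)$ is the Euclidean distance from $w$ to the boundary $\partial G$ of $G$. A region $D\subset\mathbb{C}$ is hyperbolic if $\mathbb{C}\setminus D$ contains at least two points; a simply connected region $D\subsetneq\mathbb{C}$ is hyperbolic. For a hyperbolic region $D$, the hyperbolic density $\lambda_D$ (curvature $-4$) is defined by $\lambda_D(\pi(\zeta))\,|\pi'(\zeta)|=\frac{1}{1-|\zeta|^2}$ for $\zeta\in\mathbb{D}=\{|\zeta|<1\}$, where $\pi:\mathbb{D}\to D$ is a locally univalent analytic universal covering map of $\mathbb{D}$ onto $D$ (a conformal bijection when $D$ is simply connected); this is independent of the choice of $\pi$. *)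

(* Defs.v *)
(* Stdlib reals, with Coquelicot's complex numbers. *)
From Stdlib Require Import Reals ClassicalEpsilon.
From Coquelicot Require Import Coquelicot.
Open Scope R_scope.

Definition connected (D : C -> Prop) : Prop :=
  forall U V : C -> Prop,
    open (T := C_UniformSpace) U -> open (T := C_UniformSpace) V ->
    (forall z, D z -> U z \/ V z) ->
    (exists z, D z /\ U z) -> (exists z, D z /\ V z) ->
    exists z, D z /\ U z /\ V z.

Definition region (D : C -> Prop) : Prop :=
  open (T := C_UniformSpace) D /\ connected D.

Definition unit_interval (t : R) : Prop := 0 <= t <= 1.

Definition unit_square (p : R * R) : Prop :=
  unit_interval (fst p) /\ unit_interval (snd p).

Definition closed_curve_in (D : C -> Prop) (gamma : R -> C) : Prop :=
  continuous_on (T := R_UniformSpace) (U := C_UniformSpace)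
    unit_interval gamma /\
  (forall t, unit_interval t -> D (gamma t)) /\
  gamma 0 = gamma 1.

(* The homotopy H (s, t) has deformation parameter s and curve parameter t,
   and keeps the base point fixed. *)
Definition null_homotopic_in (D : C -> Prop) (gamma : R -> C) : Prop :=
  exists H : R * R -> C,
    continuous_on (T := prod_UniformSpace R_UniformSpace R_UniformSpace)
      (U := C_UniformSpace) unit_square H /\
    (forall p, unit_square p -> D (H p)) /\
    (forall t, unit_interval t -> H (0, t) = gamma t) /\
    (forall t, unit_interval t -> H (1, t) = gamma 0) /\
    (forall s, unit_interval s -> H (s, 0) = gamma 0 /\ H (s, 1) = gamma 0).

Definition simply_connected_region (D : C -> Prop) : Prop :=
  region D /\
  forall gamma : R -> C, closed_curve_in D gamma -> null_homotopic_in D gamma.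

Definition injective_on (D : C -> Prop) (f : C -> C) : Prop :=
  forall z w, D z -> D w -> f z = f w -> z = w.

Definition image (f : C -> C) (D : C -> Prop) (w : C) : Prop :=
  exists z, D z /\ f z = w.

(* Used only for open D. *)
Definition analytic_on (D : C -> Prop) (f : C -> C) : Prop :=
  forall z, D z -> ex_derive (K := C_AbsRing) (V := C_NormedModule) f z.

Definition conformal_on (D : C -> Prop) (f : C -> C) : Prop :=
  analytic_on D f /\ injective_on D f.

Definition boundary (G : C -> Prop) (b : C) : Prop :=
  ~ locally (T := C_UniformSpace) b (fun z => ~ G z) /\
  ~ locally (T := C_UniformSpace) b G.

(* The infimum is a real number as soon as the boundary of G is nonempty, that
   is, as soon as G is neither empty nor the whole plane; [real] sends the
   infimum +oo of the empty set to 0. *)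
Definition dist_boundary (G : C -> Prop) (w : C) : R :=
  real (Glb_Rbar (fun d => exists b, boundary G b /\ d = Cmod (w - b)%C)).

Definition unit_disk (z : C) : Prop := Cmod z < 1.

Definition homeomorphism_onto (U V : C -> Prop) (f : C -> C) : Prop :=
  continuous_on (T := C_UniformSpace) (U := C_UniformSpace) U f /\
  (forall z, U z -> V (f z)) /\
  exists g : C -> C,
    continuous_on (T := C_UniformSpace) (U := C_UniformSpace) V g /\
    (forall w, V w -> U (g w)) /\
    (forall z, U z -> g (f z) = z) /\
    (forall w, V w -> f (g w) = w).

Definition evenly_covered (pi : C -> C) (E V : C -> Prop) : Prop :=
  exists (I : Type) (U : I -> C -> Prop),
    (forall i, open (T := C_UniformSpace) (U i)) /\
    (forall i j z, U i z -> U j z -> i = j) /\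
    (forall z, (E z /\ V (pi z)) <-> exists i, U i z) /\
    (forall i, homeomorphism_onto (U i) V pi).

Definition covering_map (pi : C -> C) (E D : C -> Prop) : Prop :=
  (forall z, E z -> D (pi z)) /\
  (forall w, D w -> exists z, E z /\ pi z = w) /\
  (forall w, D w -> exists V : C -> Prop,
     open (T := C_UniformSpace) V /\ V w /\ (forall v, V v -> D v) /\
     evenly_covered pi E V).

Definition locally_univalent_on (D : C -> Prop) (f : C -> C) : Prop :=
  forall z, D z -> exists U : C -> Prop,
    open (T := C_UniformSpace) U /\ U z /\ (forall w, U w -> D w) /\
    injective_on U f.

(* A covering map from the disk is universal because the disk is simply
   connected. *)
Definition universal_covering (pi : C -> C) (D : C -> Prop) : Prop :=
  analytic_on unit_disk pi /\ locally_univalent_on unit_disk pi /\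
  covering_map pi unit_disk D.

(* Curvature -4 normalization. *)
Definition is_hyperbolic_density (D : C -> Prop) (lam : C -> R) : Prop :=
  exists pi : C -> C, universal_covering pi D /\
    forall zeta, unit_disk zeta ->
      lam (pi zeta) * Cmod (C_derive pi zeta) = 1 / (1 - (Cmod zeta) ^ 2).

(* Meaningful for hyperbolic D, and then only at the points of D; for such D a
   function satisfying [is_hyperbolic_density] exists by uniformization, and
   its values on D do not depend on the covering. *)
Definition hyperbolic_density (D : C -> Prop) : C -> R :=
  epsilon (inhabits (fun _ : C => 0)) (is_hyperbolic_density D).

(* Main.v *)
Require Import Defs.
From Stdlib Require Import Reals Lra Psatz Lia Classical ClassicalEpsilon.
From Stdlib Require Import FunctionalExtensionality PropExtensionality.
From HB Require Import structures.
From mathcomp Require all_boot all_fingroup all_algebra boolp.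
From Corelib Require Import ssreflect ssrbool ssrfun.
From Coquelicot Require Import Coquelicot.
Open Scope R_scope.

(** Let [G] be a Riemann map of the unit disk onto [D] with [G 0 = z]. The hyperbolic
    density of [D] at [z] is [1 / |G'(0)|], and [F], the composition of [f] with [G],
    is a conformal map of the disk with the same image as [f] and with
    [|F'(0)| = |f'(z)| / lambda_D(z)]. The two inequalities therefore say that the
    distance [delta] from [F(0)] to the boundary of the image of [F] satisfies
    [|F'(0)| / 4 <= delta <= |F'(0)|] ([koebe_distance]). The upper bound is Schwarz's
    lemma for the inverse of [F] on a disc contained in the image; the lower bound is
    Koebe's quarter theorem. On the disk, the identity and the Koebe function attain
    the bounds.

    For Koebe's theorem ([koebe_quarter]) suppose that [F] omits [w]. The square root [h] of [(F - w) / (F(0) - w)] with [h(0) = 1] never takes two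
    opposite values, so [B = (h - 1) / (h + 1)] satisfies [B(0) = 0] and
    [B(z) B(u) <> 1] for all [z] and [u]; what is needed is [|B'(0)| <= 1]
    ([bieberbach_eilenberg]). On a circle of radius [r < 1] the Taylor coefficients of
    [1 / (1 - B(z) B(u))], scaled by powers of [r], are bounded by some [M]. By the
    geometric series their matrix is [A^T A], with [A] triangular and with diagonal
    entries [(r B'(0))^k]. Hence [|r B'(0)|^(N (N - 1)) <= N! M^N] for every [N], which
    forces [|r B'(0)| <= 1].

    The Riemann map ([riemann_mapping]) comes from conformal maps [phi_n] of [D] into
    the disk, with [phi_n(z) = 0], whose derivatives at [z] approach the supremum. The
    square root trick shows that their images contain discs of radius tending to one.
    The comparisons of [phi_n] with the inverse of [phi_m] are then nearly extremal in
    Schwarz's lemma, hence close to the identity, so that the inverses of the [phi_n]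
    converge to a conformal map onto [D]. Simple connectivity is used through
    [analytic_sqrt]: a nonvanishing analytic function has a square root, continued
    along paths and single-valued because loops are null-homotopic.

    The density is given by some covering [pi] of [D] by the disk. The Schwarz-Pick
    inequality for [pi] followed by the inverse of [G] gives
    [lambda_D(z) |G'(0)| >= 1] ([density_ge]). The opposite inequality is Ahlfors's
    comparison of the hyperbolic metric of the disk with the pull-back by [G] of the
    metric of [D] ([density_radius_le]).

    All of this rests on Cauchy's formula for functions that are merely differentiable
    at each point, which is deduced from Goursat's theorem by contracting a circle to
    the point at which the function is evaluated. *)

(** * Continuity of complex-valued maps *)

Definition cont {T : UniformSpace} (f : T -> C) (x : T) : Prop :=
  @continuous T C_UniformSpace f x.

Lemma locally_C_iff (z : C) (P : C -> Prop) :
  locally (T := C_UniformSpace) z P <->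
  exists d, 0 < d /\ forall w, Cmod (w - z) < d -> P w.
Proof.
split=> [[e He] | [d [Hd H]]].
- exists e; split; first exact: cond_pos.
  move=> w Hw; apply: He; exact: C_NormedModule_mixin_compat1.
- have Hd2 : 0 < d / 2 by lra.
  exists (mkposreal _ Hd2) => w Hw; apply: H.
  have := C_NormedModule_mixin_compat2 z w _ Hw => /= K.
  apply: Rlt_le_trans K _.
  have : sqrt 2 <= 2.
    rewrite -{2}(sqrt_Rsqr 2); last lra.
    apply: sqrt_le_1_alt; rewrite /Rsqr; lra.
  nra.
Qed.

Lemma Cmult_cancel_l (a x y : C) : a <> 0 -> (a * x = a * y)%C -> x = y.
Proof.
move=> Ha E; have -> : x = (/ a * (a * x))%C by field.
by rewrite E; field.
Qed.

Lemma Cmod_sub_self (z : C) : Cmod (z - z) = 0.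
Proof. by rewrite /Cminus Cplus_opp_r Cmod_0. Qed.

Lemma Cmod_sub_sym (z w : C) : Cmod (z - w) = Cmod (w - z).
Proof. by rewrite -Cmod_opp; congr Cmod; ring. Qed.

Lemma Cmod_tri_sub (z w : C) : Cmod z <= Cmod w + Cmod (z - w).
Proof.
have := Cmod_triangle w (z - w).
by replace (w + (z - w))%C with z by ring.
Qed.

Lemma Cminus_0_eq (x y : C) : (x - y)%C = 0 -> x = y.
Proof. by move=> /(proj2 (Ceq_minus _ _)). Qed.

Lemma Cmod_minus_le (z w : C) : Cmod (z - w) <= Cmod z + Cmod w.
Proof. by have := Cmod_triangle z (- w); rewrite Cmod_opp. Qed.

Lemma cont_eps {T : UniformSpace} (f : T -> C) (x : T) :
  cont f x <->
  forall e, 0 < e -> locally x (fun y => Cmod (f y - f x) < e).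
Proof.
split=> [H e He | H P].
- by apply: (H (fun w => Cmod (w - f x) < e)); apply/locally_C_iff; exists e.
- move/locally_C_iff=> [d [Hd HP]].
  rewrite /filtermap; apply: filter_imp (H d Hd) => y Hy; exact: HP.
Qed.

Lemma cont_C_eps (f : C -> C) (z : C) :
  cont (T := C_UniformSpace) f z <->
  forall e, 0 < e ->
    exists d, 0 < d /\ forall w, Cmod (w - z) < d -> Cmod (f w - f z) < e.
Proof.
split=> [/cont_eps H e He | H].
- by move/locally_C_iff: (H e He).
- by apply/cont_eps => e He; apply/locally_C_iff; apply: H.
Qed.

Lemma cont_parts {T : UniformSpace} (f : T -> C) (x : T) :
  cont f x <->
  continuous (fun y => Re (f y)) x /\ continuous (fun y => Im (f y)) x.
Proof.
split=> [H | [H1 H2]].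
- split.
  + apply: (continuous_comp f (fst : C -> R) x H).
    by case: (f x) => a b; apply: continuous_fst.
  + apply: (continuous_comp f (snd : C -> R) x H).
    by case: (f x) => a b; apply: continuous_snd.
- apply: (continuous_ext (U := C_UniformSpace) (fun y => (Re (f y), Im (f y)))).
    by move=> y; rewrite /Re /Im; case: (f y).
  apply: (continuous_comp_2 (W := R_UniformSpace) (X := C_UniformSpace)
            _ _ (fun a b => (a, b)) x H1 H2).
  apply: (continuous_ext (fun p : R * R => p)); first by case.
  exact: continuous_id.
Qed.

Section ContinuityRules.
Context {T : UniformSpace}.
Implicit Types (f g : T -> C) (x : T).

Lemma cont_const (c : C) x : cont (fun _ => c) x.
Proof. exact: continuous_const. Qed.

Lemma cont_ext f g x : (forall y, f y = g y) -> cont f x -> cont g x.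
Proof. move=> H; exact: continuous_ext. Qed.

Lemma cont_ext_loc f g x :
  locally x (fun y => f y = g y) -> cont f x -> cont g x.
Proof.
move=> H; apply: continuous_ext_loc; apply: filter_imp H => y; done.
Qed.

Lemma cont_RtoC (r : T -> R) x :
  continuous r x -> cont (fun y => RtoC (r y)) x.
Proof. by move=> H; apply/cont_parts; split=> //=; apply: continuous_const. Qed.

Lemma cont_plus f g x : cont f x -> cont g x -> cont (fun y => f y + g y)%C x.
Proof.
move=> /cont_parts [f1 f2] /cont_parts [g1 g2]; apply/cont_parts; split.
- exact: (continuous_plus _ _ _ f1 g1).
- exact: (continuous_plus _ _ _ f2 g2).
Qed.

Lemma cont_opp f x : cont f x -> cont (fun y => - f y)%C x.
Proof.
move=> /cont_parts [f1 f2]; apply/cont_parts; split.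
- exact: (continuous_opp _ _ f1).
- exact: (continuous_opp _ _ f2).
Qed.

Lemma cont_minus f g x : cont f x -> cont g x -> cont (fun y => f y - g y)%C x.
Proof. by move=> hf hg; apply: cont_plus => //; apply: cont_opp. Qed.

Lemma cont_mult f g x : cont f x -> cont g x -> cont (fun y => f y * g y)%C x.
Proof.
move=> /cont_parts [f1 f2] /cont_parts [g1 g2]; apply/cont_parts; split.
- apply: (continuous_minus (fun y => Re (f y) * Re (g y))
                           (fun y => Im (f y) * Im (g y))).
  + exact: (continuous_mult _ _ _ f1 g1).
  + exact: (continuous_mult _ _ _ f2 g2).
- apply: (continuous_plus (fun y => Re (f y) * Im (g y))
                          (fun y => Im (f y) * Re (g y))).
  + exact: (continuous_mult _ _ _ f1 g2).
  + exact: (continuous_mult _ _ _ f2 g1).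
Qed.

Lemma cont_conj f x : cont f x -> cont (fun y => Cconj (f y)) x.
Proof.
move=> /cont_parts [f1 f2]; apply/cont_parts; split=> //=.
exact: (continuous_opp _ _ f2).
Qed.

Lemma cont_Cmod f x : cont f x -> continuous (fun y => Cmod (f y)) x.
Proof.
move=> /cont_parts [f1 f2].
apply: (continuous_comp (fun y => Re (f y) ^ 2 + Im (f y) ^ 2) sqrt).
- apply: (continuous_plus (fun y => Re (f y) ^ 2) (fun y => Im (f y) ^ 2)).
  + apply: (continuous_ext (fun y => Re (f y) * Re (f y))) => [y|]; first by simpl; ring.
    exact: (continuous_mult _ _ _ f1 f1).
  + apply: (continuous_ext (fun y => Im (f y) * Im (f y))) => [y|]; first by simpl; ring.
    exact: (continuous_mult _ _ _ f2 f2).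
- exact: continuous_sqrt.
Qed.

Lemma cont_inv f x : cont f x -> f x <> 0 -> cont (fun y => / f y)%C x.
Proof.
move=> Hf Hx; have Hm := cont_Cmod f x Hf.
have Hc := cont_conj f x Hf.
have Hp : 0 < Cmod (f x) by apply/Cmod_gt_0.
have Hi : continuous (fun y => / (Cmod (f y) * Cmod (f y))) x.
  apply: (continuous_comp (fun y => Cmod (f y) * Cmod (f y)) Rinv).
  - exact: (continuous_mult _ _ _ Hm Hm).
  - by apply: continuous_Rinv; apply: Rgt_not_eq; nra.
apply: cont_ext_loc (cont_mult _ _ _ (cont_RtoC _ _ Hi) Hc).
have H0 : locally x (fun y => 0 < Cmod (f y)).
  by apply: (Hm (fun r => 0 < r)); apply: (open_gt 0).
apply: filter_imp H0 => y Hy.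
have Hn : f y <> 0 by apply/Cmod_gt_0.
apply: (Cmult_cancel_l (f y)) => //.
rewrite Cinv_r // (Cmult_comm (RtoC _)) Cmult_assoc -Cmod2_conj -RtoC_mult.
congr RtoC; field; exact: Rgt_not_eq.
Qed.

Lemma cont_div f g x :
  cont f x -> cont g x -> g x <> 0 -> cont (fun y => f y / g y)%C x.
Proof. by move=> *; apply: cont_mult => //; apply: cont_inv. Qed.

Lemma cont_pow f x n : cont f x -> cont (fun y => f y ^ n)%C x.
Proof.
move=> H; elim: n => [|n IH]; first exact: cont_const.
by apply: cont_mult.
Qed.

End ContinuityRules.

Lemma cont_comp {T : UniformSpace} (f : C -> C) (g : T -> C) x :
  cont g x -> cont (T := C_UniformSpace) f (g x) -> cont (fun y => f (g y)) x.
Proof. by move=> H1 H2; apply: (continuous_comp g f). Qed.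

Lemma cont_id (z : C) : cont (T := C_UniformSpace) (fun w => w) z.
Proof. exact: continuous_id. Qed.

(** * Complex derivatives *)

(** Caratheodory's form of the derivative reduces all differentiation rules to
    the corresponding rules for continuity. *)
Definition has_deriv (f : C -> C) (z l : C) : Prop :=
  exists q : C -> C, cont (T := C_UniformSpace) q z /\ q z = l /\
    forall w, (f w - f z = q w * (w - z))%C.

Lemma has_deriv_eps (f : C -> C) (z l : C) :
  has_deriv f z l <->
  forall e, 0 < e -> exists d, 0 < d /\ forall w, Cmod (w - z) < d ->
    Cmod (f w - f z - l * (w - z)) <= e * Cmod (w - z).
Proof.
split=> [[q [Hq [<- H]]] e He | H].
- have [d [Hd Hdw]] := proj1 (cont_C_eps _ _) Hq e He.
  exists d; split=> // w Hw; rewrite H.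
  replace (q w * (w - z) - q z * (w - z))%C with ((q w - q z) * (w - z))%C by ring.
  rewrite Cmod_mult; apply: Rmult_le_compat_r; first exact: Cmod_ge_0.
  exact/Rlt_le/Hdw.
- pose q w := if excluded_middle_informative (w = z) then l
              else ((f w - f z) / (w - z))%C.
  have qz : q z = l by rewrite /q; case: excluded_middle_informative.
  exists q; split; last split=> //.
  + apply/cont_C_eps => e He.
    have He2 : 0 < e / 2 by lra.
    have [d [Hd Hdw]] := H _ He2; exists d; split=> // w Hw.
    rewrite qz /q; case: excluded_middle_informative => [E | Hn].
      by rewrite Cmod_sub_self.
    have Hn' : (w - z)%C <> 0 by apply: Cminus_eq_contra.
    have Hp : 0 < Cmod (w - z) by apply/Cmod_gt_0.
    have -> : ((f w - f z) / (w - z) - l = (f w - f z - l * (w - z)) / (w - z))%C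
      by field.
    rewrite Cmod_div //; apply: (Rle_lt_trans _ (e / 2)); last lra.
    by apply/Rle_div_l => //; apply: Hdw.
  + move=> w; rewrite /q; case: excluded_middle_informative => [E | Hn].
      by simpl; rewrite E; ring.
    simpl; field; exact: Cminus_eq_contra.
Qed.

Lemma has_deriv_is_derive (f : C -> C) (z l : C) :
  has_deriv f z l <-> is_derive (K := C_AbsRing) (V := C_NormedModule) f z l.
Proof.
rewrite has_deriv_eps; split=> H.
- split; first exact: is_linear_scal_l.
  move=> x Hx; rewrite -(is_filter_lim_locally_unique _ _ Hx) => e.
  have [d [Hd Hdw]] := H e (cond_pos e).
  exists (mkposreal d Hd) => w Hw.
  change (Cmod (f w - f z - (w - z) * l) <= e * Cmod (w - z)).
  by rewrite Cmult_comm; apply: Hdw.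
- move=> e He; case: H => _ H.
  have /= := H z (fun P K => K) (mkposreal e He).
  case=> d Hd; exists d; split; first exact: cond_pos.
  move=> w Hw; have := Hd w Hw.
  change (Cmod (f w - f z - (w - z) * l) <= e * Cmod (w - z) ->
          Cmod (f w - f z - l * (w - z)) <= e * Cmod (w - z)).
  by rewrite Cmult_comm.
Qed.

Lemma has_deriv_ex (f : C -> C) (z : C) :
  ex_derive (K := C_AbsRing) (V := C_NormedModule) f z <->
  exists l, has_deriv f z l.
Proof.
by split=> -[l Hl]; exists l; apply/has_deriv_is_derive.
Qed.

Lemma C_derive_has (f : C -> C) (z l : C) : has_deriv f z l -> C_derive f z = l.
Proof. by move=> /has_deriv_is_derive; apply: is_C_derive_unique. Qed.

Lemma has_C_derive (f : C -> C) (z : C) :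
  ex_derive (K := C_AbsRing) (V := C_NormedModule) f z ->
  has_deriv f z (C_derive f z).
Proof.
by move=> /has_deriv_ex [l Hl]; rewrite (C_derive_has f z l).
Qed.

Lemma has_deriv_uniq (f : C -> C) (z l m : C) :
  has_deriv f z l -> has_deriv f z m -> l = m.
Proof. by move=> /C_derive_has <- /C_derive_has <-. Qed.

Lemma has_deriv_cont (f : C -> C) (z l : C) :
  has_deriv f z l -> cont (T := C_UniformSpace) f z.
Proof.
move=> [q [Hq [_ H]]].
apply: (cont_ext (fun w => f z + q w * (w - z))%C).
  by move=> w; rewrite -H; ring.
apply: cont_plus; first exact: cont_const.
apply: cont_mult => //; apply: cont_minus; [exact: cont_id | exact: cont_const].
Qed.

Lemma has_deriv_ext_loc (f g : C -> C) (z l : C) :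
  (exists d, 0 < d /\ forall w, Cmod (w - z) < d -> f w = g w) ->
  has_deriv f z l -> has_deriv g z l.
Proof.
move=> [d [Hd E]] /has_deriv_eps H; apply/has_deriv_eps => e He.
have [d' [Hd' K]] := H e He.
have zz : f z = g z.
  by apply: E; rewrite Cmod_sub_self.
exists (Rmin d d'); split; first exact: Rmin_pos.
move=> w Hw; rewrite -zz -E; last exact: Rlt_le_trans Hw (Rmin_l _ _).
apply: K; exact: Rlt_le_trans Hw (Rmin_r _ _).
Qed.

Lemma has_deriv_const (c z : C) : has_deriv (fun _ => c) z 0.
Proof.
exists (fun _ => RtoC 0); split; first exact: cont_const.
by split=> // w; ring.
Qed.

Lemma has_deriv_id (z : C) : has_deriv (fun w => w) z 1.
Proof.
exists (fun _ => RtoC 1); split; first exact: cont_const.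
by split=> // w; ring.
Qed.

Lemma has_deriv_plus (f g : C -> C) (z l m : C) :
  has_deriv f z l -> has_deriv g z m -> has_deriv (fun w => f w + g w)%C z (l + m).
Proof.
move=> [q [Hq [<- H]]] [p [Hp [<- K]]]; exists (fun w => q w + p w)%C.
split; first exact: cont_plus; split=> // w.
replace (f w + g w - (f z + g z))%C with ((f w - f z) + (g w - g z))%C by ring.
rewrite H K; ring.
Qed.

Lemma has_deriv_mult (f g : C -> C) (z l m : C) :
  has_deriv f z l -> has_deriv g z m ->
  has_deriv (fun w => f w * g w)%C z (l * g z + f z * m).
Proof.
move=> Hf Hg; have cg := has_deriv_cont _ _ _ Hg.
case: Hf Hg => [q [Hq [<- H]]] [p [Hp [<- K]]].
exists (fun w => q w * g w + f z * p w)%C; split.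
  apply: cont_plus; apply: cont_mult => //; exact: cont_const.
split=> // w.
replace (f w * g w - f z * g z)%C
  with ((f w - f z) * g w + f z * (g w - g z))%C by ring.
rewrite H K; ring.
Qed.

Lemma has_deriv_opp (f : C -> C) (z l : C) :
  has_deriv f z l -> has_deriv (fun w => - f w)%C z (- l).
Proof.
move=> [q [Hq [<- H]]]; exists (fun w => - q w)%C.
split; first exact: cont_opp; split=> // w.
replace (- f w - - f z)%C with (- (f w - f z))%C by ring.
rewrite H; ring.
Qed.

Lemma has_deriv_minus (f g : C -> C) (z l m : C) :
  has_deriv f z l -> has_deriv g z m -> has_deriv (fun w => f w - g w)%C z (l - m).
Proof. by move=> Hf Hg; apply: has_deriv_plus => //; apply: has_deriv_opp. Qed.

Lemma has_deriv_inv (f : C -> C) (z l : C) :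
  has_deriv f z l -> f z <> 0 ->
  has_deriv (fun w => / f w)%C z (- l / (f z * f z)).
Proof.
move=> Hf Hz; have cf := has_deriv_cont _ _ _ Hf.
have [d [Hd Hn]] : exists d, 0 < d /\ forall w, Cmod (w - z) < d -> f w <> 0.
  have Hp : 0 < Cmod (f z) by apply/Cmod_gt_0.
  have [d [Hd Hdw]] := proj1 (cont_C_eps _ _) cf _ Hp.
  exists d; split=> // w Hw E; have := Hdw w Hw.
  rewrite E; replace (0 - f z)%C with (- f z)%C by ring.
  rewrite Cmod_opp; lra.
case: Hf => [q [Hq [<- H]]].
apply/has_deriv_eps.
pose p w := (- q w / (f w * f z))%C.
have Hp : cont (T := C_UniformSpace) p z.
  apply: cont_div; first exact: cont_opp.
  - by apply: cont_mult => //; apply: cont_const.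
  - exact: Cmult_neq_0.
move=> e He; have [d' [Hd' K]] := proj1 (cont_C_eps _ _) Hp e He.
exists (Rmin d d'); split; first exact: Rmin_pos.
move=> w Hw.
have Hw1 := Rlt_le_trans _ _ _ Hw (Rmin_l _ _).
have Hw2 := Rlt_le_trans _ _ _ Hw (Rmin_r _ _).
have fw := Hn w Hw1.
have E : (/ f w - / f z - (- q z / (f z * f z)) * (w - z)
          = (p w - p z) * (w - z))%C.
  rewrite /p.
  have -> : (/ f w - / f z)%C = (- (f w - f z) / (f w * f z))%C by field.
  rewrite H; field; done.
rewrite E Cmod_mult; apply: Rmult_le_compat_r; first exact: Cmod_ge_0.
exact/Rlt_le/K.
Qed.

Lemma has_deriv_div (f g : C -> C) (z l m : C) :
  has_deriv f z l -> has_deriv g z m -> g z <> 0 ->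
  has_deriv (fun w => f w / g w)%C z ((l * g z - f z * m) / (g z * g z)).
Proof.
move=> Hf Hg Hz; have := has_deriv_mult _ _ _ _ _ Hf (has_deriv_inv _ _ _ Hg Hz).
congr has_deriv; field; done.
Qed.

Lemma has_deriv_comp (f g : C -> C) (z l m : C) :
  has_deriv f (g z) l -> has_deriv g z m ->
  has_deriv (fun w => f (g w)) z (l * m).
Proof.
move=> Hf Hg; have cg := has_deriv_cont _ _ _ Hg.
case: Hf Hg => [q [Hq [<- H]]] [p [Hp [<- K]]].
exists (fun w => q (g w) * p w)%C; split.
  by apply: cont_mult => //; apply: cont_comp.
by split=> // w; rewrite H K; ring.
Qed.

Lemma has_deriv_pow (f : C -> C) (z l : C) n :
  has_deriv f z l -> exists m, has_deriv (fun w => f w ^ n)%C z m.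
Proof.
move=> H; elim: n => [|n [m IH]]; first by eexists; apply: has_deriv_const.
by eexists; apply: has_deriv_mult H IH.
Qed.

Definition disc (a : C) (r : R) (z : C) : Prop := Cmod (z - a) < r.

Lemma disc_center a r : 0 < r -> disc a r a.
Proof. by rewrite /disc Cmod_sub_self. Qed.

Lemma open_C_disc (D : C -> Prop) (z : C) :
  open (T := C_UniformSpace) D -> D z ->
  exists r, 0 < r /\ forall w, disc z r w -> D w.
Proof. by move=> H /H /locally_C_iff. Qed.

Lemma disc_open a r : open (T := C_UniformSpace) (disc a r).
Proof.
move=> z Hz; apply/locally_C_iff; exists (r - Cmod (z - a)).
rewrite /disc in Hz *; split; first lra.
move=> w Hw; have := Cmod_triangle (w - z) (z - a).
replace (w - z + (z - a))%C with (w - a)%C by ring; lra.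
Qed.

Lemma analytic_deriv (D : C -> Prop) f z :
  analytic_on D f -> D z -> has_deriv f z (C_derive f z).
Proof. by move=> H Dz; apply/has_C_derive/H. Qed.

Lemma analytic_cont (D : C -> Prop) f z :
  analytic_on D f -> D z -> cont (T := C_UniformSpace) f z.
Proof. by move=> H Dz; apply: has_deriv_cont (analytic_deriv D f z H Dz). Qed.

Lemma analytic_intro (D : C -> Prop) f :
  (forall z, D z -> exists l, has_deriv f z l) -> analytic_on D f.
Proof. by move=> H z Dz; apply/has_deriv_ex/H. Qed.

Lemma analytic_sub (D E : C -> Prop) f :
  (forall z, E z -> D z) -> analytic_on D f -> analytic_on E f.
Proof. by move=> H K z /H; apply: K. Qed.

(** * Integrals of complex-valued functions of a real variable *)

Definition CInt (f : R -> C) (a b : R) : C :=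
  RInt (V := C_R_CompleteNormedModule) f a b.

Definition cont_seg (f : R -> C) (a b : R) : Prop :=
  forall t, a <= t <= b -> cont (T := R_UniformSpace) f t.

Lemma CInt_correct f a b : a <= b -> cont_seg f a b ->
  is_RInt (V := C_R_NormedModule) f a b (CInt f a b).
Proof.
move=> ab H; apply: (RInt_correct (V := C_R_CompleteNormedModule)).
apply: (ex_RInt_continuous (V := C_R_CompleteNormedModule)) => t.
by rewrite Rmin_left // Rmax_right //; apply: H.
Qed.

Lemma CInt_unique f a b (l : C) :
  is_RInt (V := C_R_NormedModule) f a b l -> CInt f a b = l.
Proof. exact: (is_RInt_unique (V := C_R_CompleteNormedModule)). Qed.

Lemma CInt_ext f g a b : a <= b ->
  (forall t, a <= t <= b -> f t = g t) -> CInt f a b = CInt g a b.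
Proof.
move=> ab H; apply: (RInt_ext (V := C_R_CompleteNormedModule)) => t.
rewrite Rmin_left // Rmax_right // => K; apply: H; lra.
Qed.

Lemma CInt_plus f g a b : a <= b -> cont_seg f a b -> cont_seg g a b ->
  CInt (fun t => f t + g t)%C a b = (CInt f a b + CInt g a b)%C.
Proof.
move=> ab Hf Hg; apply: CInt_unique.
exact: (is_RInt_plus (V := C_R_NormedModule) _ _ _ _ _ _
          (CInt_correct f a b ab Hf) (CInt_correct g a b ab Hg)).
Qed.

Lemma CInt_scal (c : C) f a b : a <= b -> cont_seg f a b ->
  CInt (fun t => c * f t)%C a b = (c * CInt f a b)%C.
Proof.
move=> ab Hf; apply: CInt_unique.
have H := CInt_correct f a b ab Hf.
have H1 := is_RInt_fct_extend_fst (U := R_NormedModule) (V := R_NormedModule) _ _ _ _ H.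
have H2 := is_RInt_fct_extend_snd (U := R_NormedModule) (V := R_NormedModule) _ _ _ _ H.
apply: (is_RInt_fct_extend_pair (U := R_NormedModule) (V := R_NormedModule)).
- exact: (is_RInt_minus (V := R_NormedModule) _ _ _ _ _ _
           (is_RInt_scal _ _ _ (fst c) _ H1) (is_RInt_scal _ _ _ (snd c) _ H2)).
- exact: (is_RInt_plus (V := R_NormedModule) _ _ _ _ _ _
           (is_RInt_scal _ _ _ (fst c) _ H2) (is_RInt_scal _ _ _ (snd c) _ H1)).
Qed.

Lemma CInt_minus f g a b : a <= b -> cont_seg f a b -> cont_seg g a b ->
  CInt (fun t => f t - g t)%C a b = (CInt f a b - CInt g a b)%C.
Proof.
move=> ab Hf Hg; apply: CInt_unique.
exact: (is_RInt_minus (V := C_R_NormedModule) _ _ _ _ _ _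
          (CInt_correct f a b ab Hf) (CInt_correct g a b ab Hg)).
Qed.

Lemma CInt_Chasles f a b c : a <= b -> b <= c -> cont_seg f a c ->
  CInt f a c = (CInt f a b + CInt f b c)%C.
Proof.
move=> ab bc H; apply: CInt_unique.
apply: (is_RInt_Chasles (V := C_R_NormedModule) _ _ b);
  apply: CInt_correct => // t Ht; apply: H; lra.
Qed.

Lemma CInt_bound f a b M : a <= b -> cont_seg f a b ->
  (forall t, a <= t <= b -> Cmod (f t) <= M) -> Cmod (CInt f a b) <= (b - a) * M.
Proof.
move=> ab Hf HM.
rewrite Cmod_norm.
apply: (norm_RInt_le_const (V := C_R_NormedModule) f a b (CInt f a b) M ab).
  by move=> t Ht; rewrite -Cmod_norm; apply: HM.
exact: CInt_correct.
Qed.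

(** Stated componentwise, so that the fundamental theorem of calculus and the
    differentiation rules for real functions apply directly. *)
Definition rderiv (g : R -> C) (t : R) (l : C) : Prop :=
  is_derive (fun u => Re (g u)) t (Re l) /\ is_derive (fun u => Im (g u)) t (Im l).

Lemma rderiv_const (c : C) t : rderiv (fun _ => c) t 0.
Proof. by split; apply: is_derive_const. Qed.

Lemma rderiv_plus f g t l m :
  rderiv f t l -> rderiv g t m -> rderiv (fun u => f u + g u)%C t (l + m).
Proof.
move=> [f1 f2] [g1 g2]; split.
- exact: (is_derive_plus _ _ _ _ _ f1 g1).
- exact: (is_derive_plus _ _ _ _ _ f2 g2).
Qed.

Lemma rderiv_mult f g t l m :
  rderiv f t l -> rderiv g t m ->
  rderiv (fun u => f u * g u)%C t (l * g t + f t * m).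
Proof.
move=> [f1 f2] [g1 g2]; split.
- have := is_derive_minus _ _ _ _ _
    (is_derive_mult _ _ _ _ _ f1 g1 Rmult_comm) (is_derive_mult _ _ _ _ _ f2 g2 Rmult_comm).
  congr is_derive; rewrite /minus /plus /opp /mult /Re /Im /=; ring.
- have := is_derive_plus _ _ _ _ _
    (is_derive_mult _ _ _ _ _ f1 g2 Rmult_comm) (is_derive_mult _ _ _ _ _ f2 g1 Rmult_comm).
  congr is_derive; rewrite /plus /mult /Re /Im /=; ring.
Qed.

Lemma rderiv_cont g t l : rderiv g t l -> cont (T := R_UniformSpace) g t.
Proof.
move=> [g1 g2]; apply/cont_parts; split; apply: ex_derive_continuous;
  eexists; eassumption.
Qed.

Lemma CInt_FTC g g' a b : a <= b ->
  (forall t, a <= t <= b -> rderiv g t (g' t)) -> cont_seg g' a b ->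
  CInt g' a b = (g b - g a)%C.
Proof.
move=> ab Hg Hc; apply: CInt_unique.
apply: (is_RInt_fct_extend_pair (U := R_NormedModule) (V := R_NormedModule)).
- apply: (is_RInt_derive (fun u => Re (g u)) (fun u => Re (g' u))) => t;
    rewrite Rmin_left // Rmax_right // => Ht.
  + by case: (Hg t Ht).
  + by case/cont_parts: (Hc t Ht).
- apply: (is_RInt_derive (fun u => Im (g u)) (fun u => Im (g' u))) => t;
    rewrite Rmin_left // Rmax_right // => Ht.
  + by case: (Hg t Ht).
  + by case/cont_parts: (Hc t Ht).
Qed.

(** * Goursat's theorem over a parametrized rectangle *)

(** Otherwise repeated quartering would shrink a counterexample to a point [s0, t0],
    where the last hypothesis excludes it. That hypothesis only concerns rectangles
    containing the point: for the estimate in Goursat's theorem a tag near the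
    rectangle, as provided by compactness, would not be enough. *)
Lemma rectangle_bisection (p : R -> R -> R -> R -> Prop) (a c w h : R) :
  0 <= w -> 0 <= h ->
  (forall s t v k, a <= s -> s + v + v <= a + w -> c <= t -> t + k + k <= c + h ->
     0 <= v -> 0 <= k ->
     p s t v k -> p (s + v) t v k -> p s (t + k) v k -> p (s + v) (t + k) v k ->
     p s t (v + v) (k + k)) ->
  (forall s0 t0, a <= s0 <= a + w -> c <= t0 <= c + h ->
     exists d, 0 < d /\ forall s t v k,
       a <= s -> s + v <= a + w -> c <= t -> t + k <= c + h ->
       s <= s0 <= s + v -> t <= t0 <= t + k -> v < d -> k < d -> p s t v k) ->
  p a c w h.
Proof.
move=> Hw Hh quarter loc; apply: NNPP => bad0.
pose inside n (x : R * R) := a <= fst x /\ fst x + w / 2 ^ n <= a + w /\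
   c <= snd x /\ snd x + h / 2 ^ n <= c + h.
pose bad n (x : R * R) :=
  inside n x /\ ~ p (fst x) (snd x) (w / 2 ^ n) (h / 2 ^ n).
(* The corners of successive rectangles; sizes are halved at each step. *)
pose sub n (x y : R * R) :=
  fst x <= fst y /\ fst y + w / 2 ^ S n <= fst x + w / 2 ^ n /\
  snd x <= snd y /\ snd y + h / 2 ^ S n <= snd x + h / 2 ^ n.
have half r n : r / 2 ^ n = r / 2 ^ S n + r / 2 ^ S n.
  by rewrite /=; field; apply: pow_nonzero; lra.
have nneg r n : 0 <= r -> 0 <= r / 2 ^ n.
  move=> Hr; apply: Rmult_le_pos => //; apply/Rlt_le/Rinv_0_lt_compat/pow_lt; lra.
have step n x : bad n x -> exists y, bad (S n) y /\ sub n x y.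
  case: x => s t [[/= I1 [I2 [I3 I4]]] B].
  have v0 := nneg w (S n) Hw; have k0 := nneg h (S n) Hh.
  have Ew := half w n; have Eh := half h n.
  set v := w / 2 ^ S n in v0 Ew *; set k := h / 2 ^ S n in k0 Eh *.
  apply: NNPP => none.
  have good y : inside (S n) y -> sub n (s, t) y -> p (fst y) (snd y) v k.
    by move=> J S; apply: NNPP => K; apply: none; exists y.
  apply: B; rewrite Ew Eh; apply: quarter => //; try lra.
  - apply: (good (s, t)); rewrite /inside /sub /= -/v -/k; lra.
  - apply: (good (s + v, t)); rewrite /inside /sub /= -/v -/k; lra.
  - apply: (good (s, t + k)); rewrite /inside /sub /= -/v -/k; lra.
  - apply: (good (s + v, t + k)); rewrite /inside /sub /= -/v -/k; lra.
have bad_init : bad 0%nat (a, c).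
  rewrite /bad /inside /= !Rdiv_1_r; split=> //; lra.
pose next n (x : {x | bad n x}) : {y | bad (S n) y} :=
  let (y, Hy) := constructive_indefinite_description _ (step n _ (proj2_sig x)) in
  exist _ y (proj1 Hy).
pose sq := fix sq n : {x | bad n x} :=
  match n with O => exist _ (a, c) bad_init | S m => next m (sq m) end.
have sq_sub n : sub n (proj1_sig (sq n)) (proj1_sig (sq (S n))).
  rewrite /= /next; case: constructive_indefinite_description => y [H1 H2]; exact: H2.
have sq_bad n : bad n (proj1_sig (sq n)) by apply: proj2_sig.
pose ss n := fst (proj1_sig (sq n)); pose tt n := snd (proj1_sig (sq n)).
have limit (X : nat -> R) r lo :
    (forall n, X n <= X (S n)) ->
    (forall n, X (S n) + r / 2 ^ S n <= X n + r / 2 ^ n) ->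
    0 <= r -> X 0%nat = lo ->
    exists l, lo <= l <= lo + r /\ forall n, X n <= l <= X n + r / 2 ^ n.
  move=> X1 X2 r0 X0.
  have up n m : X n <= X (n + m)%nat.
    elim: m => [|m IH]; first by rewrite Nat.add_0_r; lra.
    by rewrite Nat.add_succ_r; apply: Rle_trans IH (X1 _).
  have dn n m : X (n + m)%nat + r / 2 ^ (n + m) <= X n + r / 2 ^ n.
    elim: m => [|m IH]; first by rewrite Nat.add_0_r; lra.
    by rewrite Nat.add_succ_r; apply: Rle_trans (X2 _) IH.
  have ub n m : X m <= X n + r / 2 ^ n.
    case: (Nat.le_gt_cases n m) => H.
    - have := dn n (m - n)%nat; replace (n + (m - n))%nat with m by lia.
      have := nneg r m r0; lra.
    - have := up m (n - m)%nat; replace (m + (n - m))%nat with n by lia.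
      have := nneg r n r0; lra.
  have [l [Hl1 Hl2]] : {l | is_lub (fun x => exists n, x = X n) l}.
    apply: completeness; last by exists (X 0%nat), 0%nat.
    by exists (X 0%nat + r / 2 ^ 0) => _ [n ->].
  have L n : X n <= l <= X n + r / 2 ^ n.
    split; first by apply: Hl1; exists n.
    by apply: Hl2 => _ [m ->].
  by exists l; split=> //; have := L 0%nat; rewrite X0 /= Rdiv_1_r.
have [s0 [Hs0 Ls]] : exists l, a <= l <= a + w /\
    forall n, ss n <= l <= ss n + w / 2 ^ n.
  by apply: limit => // n; case: (sq_sub n) => ? [? ?].
have [t0 [Ht0 Lt]] : exists l, c <= l <= c + h /\
    forall n, tt n <= l <= tt n + h / 2 ^ n.
  by apply: limit => // n; case: (sq_sub n) => _ [_ [? ?]].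
have [d [Hd Hloc]] := loc s0 t0 Hs0 Ht0.
have [n [Hn1 Hn2]] : exists n, w / 2 ^ n < d /\ h / 2 ^ n < d.
  have Hy : 0 < d / (w + h + 1).
    by apply: Rdiv_lt_0_compat; lra.
  have [n Hn] := pow_lt_1_zero (/ 2) ltac:(rewrite Rabs_pos_eq; lra) _ Hy.
  exists n; have := Hn n (le_n n).
  rewrite pow_inv Rabs_pos_eq; last by apply/Rlt_le/Rinv_0_lt_compat/pow_lt; lra.
  have Hi : 0 < / 2 ^ n by apply/Rinv_0_lt_compat/pow_lt; lra.
  move=> K; have {}K : (w + h + 1) * / 2 ^ n < d.
    apply: (Rmult_lt_reg_r (/ (w + h + 1))); first by apply: Rinv_0_lt_compat; lra.
    have -> : (w + h + 1) * / 2 ^ n * / (w + h + 1) = / 2 ^ n.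
      field; split; last lra; apply: pow_nonzero; lra.
    exact: K.
  rewrite /Rdiv; split; nra.
case: (sq_bad n) => [[I1 [I2 [I3 I4]]] B]; apply: B.
by apply: (Hloc (ss n) (tt n)).
Qed.

Section Goursat.

Variables (Phi P Q : R -> R -> C) (k : C -> C) (a c w h L : R).
Hypothesis Hw : 0 <= w.
Hypothesis Hh : 0 <= h.
Hypothesis dPhi_s : forall s t, rderiv (fun u => Phi u t) s (P s t).
Hypothesis dPhi_t : forall s t, rderiv (fun u => Phi s u) t (Q s t).
Hypothesis cont_P : forall s t, cont (T := R_UniformSpace) (fun u => P u t) s.
Hypothesis cont_Q : forall s t, cont (T := R_UniformSpace) (fun u => Q s u) t.
Hypothesis bound_P : forall s t, a <= s <= a + w -> c <= t <= c + h -> Cmod (P s t) <= L.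
Hypothesis bound_Q : forall s t, a <= s <= a + w -> c <= t <= c + h -> Cmod (Q s t) <= L.
Hypothesis deriv_k : forall s t, a <= s <= a + w -> c <= t <= c + h ->
  exists l, has_deriv k (Phi s t) l.

Definition side_s (g : C -> C) t s1 s2 := CInt (fun u => g (Phi u t) * P u t)%C s1 s2.
Definition side_t (g : C -> C) s t1 t2 := CInt (fun u => g (Phi s u) * Q s u)%C t1 t2.

(** The integral of the form [g(z) dz] over the image of the boundary of the
    parameter rectangle with lower left corner [(s, t)]. *)
Definition boundary_int (g : C -> C) s t v l : C :=
  (side_t g (s + v) t (t + l) - side_t g s t (t + l)
   - side_s g (t + l) s (s + v) + side_s g t s (s + v))%C.

Definition good_on (g : C -> C) : Prop :=
  forall s t, a <= s <= a + w -> c <= t <= c + h -> cont (T := C_UniformSpace) g (Phi s t).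

Lemma cont_side_s g t s1 s2 : good_on g -> a <= s1 -> s2 <= a + w -> c <= t <= c + h ->
  cont_seg (fun u => g (Phi u t) * P u t)%C s1 s2.
Proof.
move=> Hg H1 H2 Ht u Hu; apply: cont_mult; last exact: cont_P.
apply: cont_comp; first exact: rderiv_cont (dPhi_s u t).
apply: Hg => //; lra.
Qed.

Lemma cont_side_t g s t1 t2 : good_on g -> c <= t1 -> t2 <= c + h -> a <= s <= a + w ->
  cont_seg (fun u => g (Phi s u) * Q s u)%C t1 t2.
Proof.
move=> Hg H1 H2 Ht u Hu; apply: cont_mult; last exact: cont_Q.
apply: cont_comp; first exact: rderiv_cont (dPhi_t s u).
apply: Hg => //; lra.
Qed.

Lemma good_k : good_on k.
Proof. by move=> s t Hs Ht; have [l Hl] := deriv_k s t Hs Ht; apply: has_deriv_cont Hl. Qed.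

Lemma boundary_int_quarters g s t v l : good_on g ->
  a <= s -> s + v + v <= a + w -> c <= t -> t + l + l <= c + h -> 0 <= v -> 0 <= l ->
  (boundary_int g s t (v + v) (l + l) =
   boundary_int g s t v l + boundary_int g (s + v) t v l +
   boundary_int g s (t + l) v l + boundary_int g (s + v) (t + l) v l)%C.
Proof.
move=> Hg h1 h2 h3 h4 v0 l0; rewrite /boundary_int.
have Es u : c <= u <= c + h ->
    side_s g u s (s + v + v) = (side_s g u s (s + v) + side_s g u (s + v) (s + v + v))%C.
  by move=> Hu; apply: CInt_Chasles; [lra | lra | apply: cont_side_s => //; lra].
have Et u : a <= u <= a + w ->
    side_t g u t (t + l + l) = (side_t g u t (t + l) + side_t g u (t + l) (t + l + l))%C.
  by move=> Hu; apply: CInt_Chasles; [lra | lra | apply: cont_side_t => //; lra].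
rewrite -!Rplus_assoc !Es ?Et; try lra; ring.
Qed.

Lemma boundary_int_plus g1 g2 s t v l : good_on g1 -> good_on g2 ->
  a <= s -> s + v <= a + w -> c <= t -> t + l <= c + h -> 0 <= v -> 0 <= l ->
  (boundary_int (fun z => g1 z + g2 z) s t v l =
   boundary_int g1 s t v l + boundary_int g2 s t v l)%C.
Proof.
move=> H1 H2 h1 h2 h3 h4 v0 l0.
have Es u : c <= u <= c + h -> side_s (fun z => g1 z + g2 z)%C u s (s + v) =
    (side_s g1 u s (s + v) + side_s g2 u s (s + v))%C.
  move=> Hu; rewrite -CInt_plus; try lra; try by apply: cont_side_s => //; lra.
  by apply: CInt_ext => [|x _]; [lra | ring].
have Et u : a <= u <= a + w -> side_t (fun z => g1 z + g2 z)%C u t (t + l) =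
    (side_t g1 u t (t + l) + side_t g2 u t (t + l))%C.
  move=> Hu; rewrite -CInt_plus; try lra; try by apply: cont_side_t => //; lra.
  by apply: CInt_ext => [|x _]; [lra | ring].
rewrite /boundary_int !Es ?Et; try lra; ring.
Qed.

Lemma good_affine (k0 k1 : C) : good_on (fun z => k0 + k1 * z)%C.
Proof.
move=> s t _ _; apply: cont_plus; first exact: cont_const.
by apply: cont_mult; [apply: cont_const | apply: cont_id].
Qed.

(** An affine function has a primitive, so its integral around a closed curve
    vanishes. *)
Lemma boundary_int_affine (k0 k1 : C) s t v l :
  a <= s -> s + v <= a + w -> c <= t -> t + l <= c + h -> 0 <= v -> 0 <= l ->
  boundary_int (fun z => k0 + k1 * z)%C s t v l = 0.
Proof.
move=> h1 h2 h3 h4 v0 l0.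
pose F z := (k0 * z + k1 / 2 * (z * z))%C.
have dF (g : R -> C) x g' : rderiv g x g' ->
    rderiv (fun u => F (g u)) x ((k0 + k1 * g x) * g')%C.
  move=> Hg.
  have -> : ((k0 + k1 * g x) * g' =
     (0 * g x + k0 * g') + (0 * (g x * g x) + k1 / 2 * (g' * g x + g x * g')))%C by field.
  apply: rderiv_plus; apply: rderiv_mult => //; try exact: rderiv_const.
  exact: rderiv_mult.
have Es u : c <= u <= c + h ->
    side_s (fun z => k0 + k1 * z)%C u s (s + v) = (F (Phi (s + v) u) - F (Phi s u))%C.
  move=> Hu; apply: (CInt_FTC (fun x => F (Phi x u))); first lra.
  - by move=> x _; apply: dF (dPhi_s x u).
  - by apply: (cont_side_s (fun z => k0 + k1 * z)%C); try lra; apply: good_affine.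
have Et u : a <= u <= a + w ->
    side_t (fun z => k0 + k1 * z)%C u t (t + l) = (F (Phi u (t + l)) - F (Phi u t))%C.
  move=> Hu; apply: (CInt_FTC (fun x => F (Phi u x))); first lra.
  - by move=> x _; apply: dF (dPhi_t u x).
  - by apply: (cont_side_t (fun z => k0 + k1 * z)%C); try lra; apply: good_affine.
rewrite /boundary_int !Es ?Et; try lra; ring.
Qed.

Lemma boundary_int_bound g s t v l M : good_on g ->
  a <= s -> s + v <= a + w -> c <= t -> t + l <= c + h -> 0 <= v -> 0 <= l ->
  (forall x y, s <= x <= s + v -> t <= y <= t + l -> Cmod (g (Phi x y)) <= M) ->
  Cmod (boundary_int g s t v l) <= 2 * (v + l) * (M * L).
Proof.
move=> Hg h1 h2 h3 h4 v0 l0 HM.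
have Bs u : t <= u <= t + l -> Cmod (side_s g u s (s + v)) <= v * (M * L).
  move=> Hu; replace v with (s + v - s) at 2 by ring.
  apply: CInt_bound; [lra | apply: cont_side_s => //; lra | move=> x Hx].
  rewrite Cmod_mult; apply: Rmult_le_compat; try exact: Cmod_ge_0.
  - by apply: HM.
  - by apply: bound_P; lra.
have Bt u : s <= u <= s + v -> Cmod (side_t g u t (t + l)) <= l * (M * L).
  move=> Hu; replace l with (t + l - t) at 2 by ring.
  apply: CInt_bound; [lra | apply: cont_side_t => //; lra | move=> x Hx].
  rewrite Cmod_mult; apply: Rmult_le_compat; try exact: Cmod_ge_0.
  - by apply: HM.
  - by apply: bound_Q; lra.
have T1 := Cmod_triangle (side_t g (s + v) t (t + l) - side_t g s t (t + l)
   - side_s g (t + l) s (s + v)) (side_s g t s (s + v)).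
have T2 := Cmod_triangle (side_t g (s + v) t (t + l) - side_t g s t (t + l))
   (- side_s g (t + l) s (s + v)).
have T3 := Cmod_triangle (side_t g (s + v) t (t + l)) (- side_t g s t (t + l)).
rewrite !Cmod_opp in T2 T3; rewrite /boundary_int /Cminus in T1 T2 T3 *.
have := Bs t ltac:(lra); have := Bs (t + l) ltac:(lra).
have := Bt s ltac:(lra); have := Bt (s + v) ltac:(lra).
lra.
Qed.

Lemma Phi_lipschitz s1 t1 s2 t2 : a <= s1 <= s2 -> s2 <= a + w ->
  c <= t1 <= t2 -> t2 <= c + h ->
  forall s t s' t', s1 <= s <= s2 -> t1 <= t <= t2 -> s1 <= s' <= s2 -> t1 <= t' <= t2 ->
  Cmod (Phi s t - Phi s' t') <= L * ((s2 - s1) + (t2 - t1)).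
Proof.
move=> h1 h2 h3 h4.
have L0 : 0 <= L.
  by apply: Rle_trans (bound_P s1 t1 _ _); [apply: Cmod_ge_0 | lra | lra].
have Vs x y u : s1 <= x -> x <= y -> y <= s2 -> t1 <= u <= t2 ->
    Cmod (Phi y u - Phi x u) <= L * (s2 - s1).
  move=> Hx xy Hy Hu; rewrite -(CInt_FTC (fun s => Phi s u) (fun s => P s u)) //.
  apply: (Rle_trans _ ((y - x) * L)); last nra.
  apply: CInt_bound => // p Hp.
  apply: bound_P; lra.
have Vt x y u : t1 <= x -> x <= y -> y <= t2 -> s1 <= u <= s2 ->
    Cmod (Phi u y - Phi u x) <= L * (t2 - t1).
  move=> Hx xy Hy Hu; rewrite -(CInt_FTC (fun s => Phi u s) (fun s => Q u s)) //.
  apply: (Rle_trans _ ((y - x) * L)); last nra.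
  apply: CInt_bound => // p Hp.
  apply: bound_Q; lra.
move=> s t s' t' Hs Ht Hs' Ht'.
have E : (Phi s t - Phi s' t' = (Phi s t - Phi s' t) + (Phi s' t - Phi s' t'))%C by ring.
rewrite E; apply: Rle_trans (Cmod_triangle _ _) _; rewrite Rmult_plus_distr_l.
apply: Rplus_le_compat.
- case: (Rle_dec s s') => H; last by apply: Vs; lra.
  by rewrite Cmod_sub_sym; apply: Vs; lra.
- case: (Rle_dec t t') => H; last by apply: Vt; lra.
  by rewrite Cmod_sub_sym; apply: Vt; lra.
Qed.

(** On a small rectangle [k] differs from an affine function by much less than
    the diameter, which bounds the boundary integral by a small multiple of
    [v^2 + l^2]; this majorant is exactly additive under quartering. *)
Theorem goursat : boundary_int k a c w h = 0.
Proof.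
apply: Cmod_eq_0; apply: Rle_antisym; last exact: Cmod_ge_0.
apply: le_epsilon => e He; rewrite Rplus_0_l.
have L0 : 0 <= L.
  by apply: Rle_trans (bound_P a c _ _); [apply: Cmod_ge_0 | lra | lra].
pose K := 4 * (L * L) * (w ^ 2 + h ^ 2) + 1.
have K0 : 0 < K by rewrite /K; nra.
pose eta := e / K.
have eta0 : 0 < eta by apply: Rdiv_lt_0_compat.
suff S : Cmod (boundary_int k a c w h) <= eta * (4 * (L * L)) * (w ^ 2 + h ^ 2).
  apply: Rle_trans S _.
  have -> : e = eta * K by rewrite /eta; field; lra.
  rewrite Rmult_assoc; apply: Rmult_le_compat_l; rewrite /K; lra.
apply: (rectangle_bisection (fun s t v l => Cmod (boundary_int k s t v l) <=
          eta * (4 * (L * L)) * (v ^ 2 + l ^ 2))) => //.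
- move=> s t v l h1 h2 h3 h4 v0 l0 p1 p2 p3 p4.
  rewrite boundary_int_quarters //; last exact: good_k.
  have T1 := Cmod_triangle (boundary_int k s t v l + boundary_int k (s + v) t v l +
     boundary_int k s (t + l) v l) (boundary_int k (s + v) (t + l) v l).
  have T2 := Cmod_triangle (boundary_int k s t v l + boundary_int k (s + v) t v l)
     (boundary_int k s (t + l) v l).
  have T3 := Cmod_triangle (boundary_int k s t v l) (boundary_int k (s + v) t v l).
  lra.
- move=> s0 t0 Hs0 Ht0; have [k1 Hk] := deriv_k s0 t0 Hs0 Ht0.
  set z0 := Phi s0 t0 in Hk *.
  have [r [Hr Hkr]] := proj1 (has_deriv_eps _ _ _) Hk eta eta0.
  pose k0 := (k z0 - k1 * z0)%C.
  pose rest z := (k z - (k0 + k1 * z))%C.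
  have L1 : 0 < L + 1 by lra.
  exists (r / (2 * (L + 1))); split; first by apply: Rdiv_lt_0_compat; lra.
  move=> s t v l h1 h2 h3 h4 Hs Ht Hv Hl.
  have good_rest : good_on rest.
    move=> x y Hx Hy; apply: cont_minus; first exact: good_k.
    exact: good_affine.
  have E : boundary_int k s t v l = boundary_int rest s t v l.
    have -> : boundary_int k s t v l =
       boundary_int (fun z => (k0 + k1 * z) + rest z)%C s t v l.
      rewrite /boundary_int /side_s /side_t /rest.
      by congr (_ - _ - _ + _)%C; apply: CInt_ext; try lra; move=> x _; ring.
    rewrite boundary_int_plus //; try lra; last exact: good_affine.
    by rewrite boundary_int_affine; try lra; ring.
  rewrite E.
  have Hm : (v + l) * (2 * (L + 1)) < 2 * r.
    have : v * (2 * (L + 1)) < r by apply/Rlt_div_r; lra.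
    have : l * (2 * (L + 1)) < r by apply/Rlt_div_r; lra.
    lra.
  have B x y : s <= x <= s + v -> t <= y <= t + l ->
      Cmod (rest (Phi x y)) <= eta * (L * (v + l)).
    move=> Hx Hy.
    have Hd : Cmod (Phi x y - z0) <= L * (v + l).
      have := Phi_lipschitz s t (s + v) (t + l) ltac:(lra) ltac:(lra) ltac:(lra)
                ltac:(lra) x y s0 t0 Hx Hy Hs Ht.
      by replace (s + v - s + (t + l - t)) with (v + l) by ring.
    have -> : rest (Phi x y) = (k (Phi x y) - k z0 - k1 * (Phi x y - z0))%C.
      by rewrite /rest /k0; ring.
    apply: Rle_trans (Hkr _ _) _; first nra.
    by apply: Rmult_le_compat_l => //; lra.
  apply: Rle_trans (boundary_int_bound _ _ _ _ _ _ good_rest h1 h2 h3 h4 _ _ B) _;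
    try lra.
  have A0 : 0 <= 2 * (eta * (L * L)) * (v - l) ^ 2.
    apply: Rmult_le_pos; last exact: pow2_ge_0.
    nra.
  lra.
Qed.

End Goursat.

(** * Cauchy's formula *)

Definition expi (t : R) : C := (cos t, sin t).

Lemma expi_mod t : Cmod (expi t) = 1.
Proof.
rewrite /Cmod /expi /= !Rmult_1_r Rplus_comm.
by have := sin2_cos2 t; rewrite /Rsqr => ->; rewrite sqrt_1.
Qed.

Lemma expi_0 : expi 0 = 1.
Proof. by rewrite /expi cos_0 sin_0. Qed.

Lemma expi_2PI : expi (2 * PI) = 1.
Proof. by rewrite /expi cos_2PI sin_2PI. Qed.

Lemma rderiv_expi t : rderiv expi t (Ci * expi t).
Proof.
split; rewrite /expi /Re /Im /=; auto_derive => //; ring.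
Qed.

Lemma rderiv_RtoC t : rderiv RtoC t 1.
Proof.
split; rewrite /Re /Im /=; [exact: is_derive_id | exact: is_derive_const].
Qed.

Lemma cont_expi t : cont (T := R_UniformSpace) expi t.
Proof. exact: rderiv_cont (rderiv_expi t). Qed.

Definition circ (a : C) (r t : R) : C := (a + r * expi t)%C.

Lemma circ_dist a r t : 0 <= r -> Cmod (circ a r t - a) = r.
Proof.
move=> Hr; have -> : (circ a r t - a = r * expi t)%C by rewrite /circ; ring.
by rewrite Cmod_mult expi_mod Rmult_1_r Cmod_R Rabs_pos_eq.
Qed.

Lemma cont_circ a r t : cont (T := R_UniformSpace) (circ a r) t.
Proof.
apply: cont_plus; first exact: cont_const.
by apply: cont_mult; [apply: cont_const | apply: cont_expi].
Qed.

Lemma circ_far a r t z : 0 <= r -> r - Cmod (z - a) <= Cmod (circ a r t - z).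
Proof.
move=> Hr; have := Cmod_triangle (circ a r t - z) (z - a).
have -> : (circ a r t - z + (z - a) = circ a r t - a)%C by ring.
by rewrite circ_dist //; lra.
Qed.

Lemma circ_neq a r t z : disc a r z -> (circ a r t - z)%C <> 0.
Proof.
rewrite /disc => Hz; have r0 : 0 < r by have := Cmod_ge_0 (z - a); lra.
by apply/Cmod_gt_0; have := circ_far a r t z ltac:(lra); lra.
Qed.

Lemma two_PI_pos : 0 < 2 * PI.
Proof. have := PI_RGT_0; lra. Qed.

Section GoursatLoop.

Variables (Phi P Q : R -> R -> C) (k : C -> C) (L : R).
Hypothesis dPhi_s : forall s t, rderiv (fun u => Phi u t) s (P s t).
Hypothesis dPhi_t : forall s t, rderiv (fun u => Phi s u) t (Q s t).
Hypothesis cont_P : forall s t, cont (T := R_UniformSpace) (fun u => P u t) s.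
Hypothesis cont_Q : forall s t, cont (T := R_UniformSpace) (fun u => Q s u) t.

(** The sides of the parameter rectangle at which the curves close up map to the
    same path, so their contributions to Goursat's theorem cancel. *)
Lemma goursat_loop (s0 : R) : 0 <= s0 <= 1 ->
  (forall s t, s0 <= s <= 1 -> Cmod (P s t) <= L) ->
  (forall s t, s0 <= s <= 1 -> Cmod (Q s t) <= L) ->
  (forall s t, s0 <= s <= 1 -> exists l, has_deriv k (Phi s t) l) ->
  (forall s, Phi s (2 * PI) = Phi s 0) -> (forall s, P s (2 * PI) = P s 0) ->
  CInt (fun t => k (Phi 1 t) * Q 1 t)%C 0 (2 * PI) =
  CInt (fun t => k (Phi s0 t) * Q s0 t)%C 0 (2 * PI).
Proof.
move=> Hs bP bQ dk perPhi perP.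
have w0 : 0 <= 1 - s0 by lra.
have h0 := Rlt_le _ _ two_PI_pos.
have E1 : s0 + (1 - s0) = 1 by ring.
have := goursat Phi P Q k s0 0 (1 - s0) (2 * PI) L w0 h0 dPhi_s dPhi_t cont_P cont_Q.
rewrite E1 => G.
have {}G := G ltac:(by move=> *; apply: bP) ltac:(by move=> *; apply: bQ)
              ltac:(by move=> *; apply: dk).
move: G; rewrite /boundary_int /side_s /side_t E1 Rplus_0_l.
have -> : CInt (fun u => k (Phi u (2 * PI)) * P u (2 * PI))%C s0 1 =
          CInt (fun u => k (Phi u 0) * P u 0)%C s0 1.
  by apply: CInt_ext => [|x _]; [lra | rewrite /= perPhi perP].
set A := CInt _ _ _; set B := CInt _ _ _; set D := CInt _ _ _.
move=> G; have -> : A = (A - B - D + D + B)%C by ring.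
by rewrite G; ring.
Qed.

End GoursatLoop.

Definition cmean (f : R -> C) : C := (CInt f 0 (2 * PI) / RtoC (2 * PI))%C.

Lemma RtoC_2PI_neq : RtoC (2 * PI) <> 0.
Proof. by move/RtoC_inj; have := two_PI_pos; lra. Qed.

Definition cont_all (f : R -> C) := forall t, cont (T := R_UniformSpace) f t.

Lemma cmean_ext f g : (forall t, f t = g t) -> cmean f = cmean g.
Proof.
move=> H; rewrite /cmean (CInt_ext f g) //; exact/Rlt_le/two_PI_pos.
Qed.

Lemma cmean_plus f g : cont_all f -> cont_all g ->
  cmean (fun t => f t + g t)%C = (cmean f + cmean g)%C.
Proof.
move=> Hf Hg; rewrite /cmean CInt_plus; [|exact/Rlt_le/two_PI_pos|by move=> *..].
by field; apply: RtoC_2PI_neq.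
Qed.

Lemma cmean_minus f g : cont_all f -> cont_all g ->
  cmean (fun t => f t - g t)%C = (cmean f - cmean g)%C.
Proof.
move=> Hf Hg; rewrite /cmean CInt_minus; [|exact/Rlt_le/two_PI_pos|by move=> *..].
by field; apply: RtoC_2PI_neq.
Qed.

Lemma cmean_scal c f : cont_all f -> cmean (fun t => c * f t)%C = (c * cmean f)%C.
Proof.
move=> Hf; rewrite /cmean CInt_scal; [|exact/Rlt_le/two_PI_pos|by move=> *].
by field; apply: RtoC_2PI_neq.
Qed.

Lemma cmean_const c : cmean (fun _ => c) = c.
Proof.
rewrite /cmean /CInt RInt_const scal_R_Cmult Rminus_0_r.
by field; apply: RtoC_2PI_neq.
Qed.

Lemma cmean_bound f M : cont_all f ->
  (forall t, 0 <= t <= 2 * PI -> Cmod (f t) <= M) -> Cmod (cmean f) <= M.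
Proof.
move=> Hf HM; have P0 := two_PI_pos.
rewrite /cmean Cmod_div; last exact: RtoC_2PI_neq.
rewrite Cmod_R Rabs_pos_eq; last lra.
apply/Rle_div_l => //.
have B : Cmod (CInt f 0 (2 * PI)) <= (2 * PI - 0) * M.
  by apply: CInt_bound => [|t _|t Ht]; [lra | apply: Hf | apply: HM; lra].
lra.
Qed.

(** The winding number of a circle about a point inside is one, because the
    centre can be moved to that point. *)
Lemma cmean_kernel a r z : disc a r z ->
  cmean (fun t => (r * expi t) / (circ a r t - z))%C = 1.
Proof.
move=> Hz; have Hz' : Cmod (z - a) < r by [].
have r0 : 0 < r by have := Cmod_ge_0 (z - a); lra.
pose u := (z - a)%C.
pose Phi (s t : R) := (r * expi t + s * - u)%C.
pose Q (s t : R) := (r * (Ci * expi t))%C.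
have dPhi_s s t : rderiv (fun x => Phi x t) s (- u)%C.
  have -> : (- u = 0 + (1 * - u + s * 0))%C by ring.
  apply: rderiv_plus; first exact: rderiv_const.
  apply: rderiv_mult; [exact: rderiv_RtoC | exact: rderiv_const].
have dPhi_t s t : rderiv (fun x => Phi s x) t (Q s t).
  have -> : (Q s t = (0 * expi t + r * (Ci * expi t)) + 0)%C by rewrite /Q; ring.
  apply: rderiv_plus; last exact: rderiv_const.
  apply: rderiv_mult; [exact: rderiv_const | exact: rderiv_expi].
have cQ s t : cont (T := R_UniformSpace) (fun x => Q s x) t.
  apply: cont_mult; first exact: cont_const.
  by apply: cont_mult; [apply: cont_const | apply: cont_expi].
have Phi_neq s t : 0 <= s <= 1 -> Phi s t <> 0.
  move=> Hs E.
  have : (r * expi t = s * u)%C.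
    have -> : (r * expi t = Phi s t + s * u)%C by rewrite /Phi; ring.
    by rewrite E; ring.
  move/(f_equal Cmod); rewrite !Cmod_mult expi_mod !Cmod_R !Rabs_pos_eq; try lra.
  rewrite -/u in Hz'; have := Cmod_ge_0 u; nra.
have E : cmean (fun t => / Phi 1 t * Q 1 t)%C = cmean (fun t => / Phi 0 t * Q 0 t)%C.
  rewrite /cmean (goursat_loop Phi (fun _ _ => (- u)%C) Q Cinv r dPhi_s dPhi_t
    (fun _ _ => cont_const _ _) cQ 0) // => [|s t _|s t _|s t Hs|s].
  - lra.
  - by rewrite Cmod_opp /u; lra.
  - by rewrite /Q !Cmod_mult Cmod_Ci expi_mod Cmod_R Rabs_pos_eq; lra.
  - eexists; apply: has_deriv_inv (has_deriv_id _) _; exact: Phi_neq.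
  - by rewrite /Phi expi_0 expi_2PI.
have Ec : cmean (fun t => / Phi 0 t * Q 0 t)%C = Ci.
  rewrite -[RHS]cmean_const; apply: cmean_ext => t.
  have H := Phi_neq 0 t ltac:(lra).
  have EE : (Phi 0 t = r * expi t)%C by rewrite /Phi; ring.
  rewrite EE /Q in H *.
  have : expi t <> 0 by move=> E0; apply: H; rewrite E0; ring.
  have : RtoC r <> 0 by move/RtoC_inj; lra.
  by move=> *; field.
have cont_ker : cont_all (fun t => r * expi t / (circ a r t - z))%C.
  move=> t; apply: cont_div.
  - by apply: cont_mult; [apply: cont_const | apply: cont_expi].
  - by apply: cont_minus; [apply: cont_circ | apply: cont_const].
  - exact: circ_neq.
apply: (Cmult_cancel_l Ci); first exact: Ci_nz.
rewrite -cmean_scal // Cmult_1_r -[RHS]Ec -E; apply: cmean_ext => t.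
have H := Phi_neq 1 t ltac:(lra).
have EE : (Phi 1 t = circ a r t - z)%C by rewrite /Phi /circ /u; ring.
by rewrite EE /Q in H *; field.
Qed.

(** The dilations of the circle towards [z] deform it to the point [z]. *)
Theorem cauchy_formula f a r r' z :
  r < r' -> analytic_on (disc a r') f -> disc a r z ->
  f z = cmean (fun t => f (circ a r t) * (r * expi t / (circ a r t - z)))%C.
Proof.
move=> Hrr Hf Hz; have Hz' : Cmod (z - a) < r by [].
have r0 : 0 < r by have := Cmod_ge_0 (z - a); lra.
pose d := r - Cmod (z - a); have d0 : 0 < d by rewrite /d; lra.
pose Phi (s t : R) := (z + s * (circ a r t - z))%C.
pose P (s t : R) := (circ a r t - z)%C.
pose Q (s t : R) := (s * (r * (Ci * expi t)))%C.
have dcirc t : rderiv (circ a r) t (r * (Ci * expi t)).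
  have -> : (r * (Ci * expi t) = 0 + (0 * expi t + r * (Ci * expi t)))%C by ring.
  apply: rderiv_plus; first exact: rderiv_const.
  apply: rderiv_mult; [exact: rderiv_const | exact: rderiv_expi].
have dPhi_s s t : rderiv (fun x => Phi x t) s (P s t).
  have -> : (P s t = 0 + (1 * (circ a r t - z) + s * 0))%C by rewrite /P; ring.
  apply: rderiv_plus; first exact: rderiv_const.
  apply: rderiv_mult; [exact: rderiv_RtoC | exact: rderiv_const].
have dPhi_t s t : rderiv (fun x => Phi s x) t (Q s t).
  have -> : (Q s t = 0 + (0 * (circ a r t - z) + s * (r * (Ci * expi t) + 0)))%C.
    by rewrite /Q; ring.
  apply: rderiv_plus; first exact: rderiv_const.
  apply: rderiv_mult; first exact: rderiv_const.
  by apply: rderiv_plus; [apply: dcirc | apply: rderiv_const].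
have cQ s t : cont (T := R_UniformSpace) (fun x => Q s x) t.
  do 3 (apply: cont_mult; first exact: cont_const); exact: cont_expi.
have cP s t : cont (T := R_UniformSpace) (fun x => P x t) s by exact: cont_const.
have P_le s t : Cmod (P s t) <= 2 * r.
  have := Cmod_triangle (circ a r t - a) (a - z).
  have -> : (circ a r t - a + (a - z) = P s t)%C by rewrite /P; ring.
  by rewrite circ_dist ?(Cmod_sub_sym a); lra.
have Phi_in s t : 0 <= s <= 1 -> disc a r' (Phi s t).
  move=> Hs; rewrite /disc.
  have -> : (Phi s t - a = RtoC (1 - s) * (z - a) + s * (circ a r t - a))%C.
    by rewrite /Phi RtoC_minus; ring.
  apply: Rle_lt_trans (Cmod_triangle _ _) _.
  rewrite !Cmod_mult circ_dist ?Cmod_R ?Rabs_pos_eq; try lra.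
  have := Cmod_ge_0 (z - a); nra.
pose ker t := (r * expi t / (circ a r t - z))%C.
have c_ker : cont_all ker.
  move=> t; apply: cont_div.
  - by apply: cont_mult; [apply: cont_const | apply: cont_expi].
  - by apply: cont_minus; [apply: cont_circ | apply: cont_const].
  - exact: circ_neq.
have ker_le t : Cmod (ker t) <= r / d.
  rewrite /ker Cmod_div; last exact: circ_neq.
  rewrite Cmod_mult expi_mod Cmod_R Rabs_pos_eq ?Rmult_1_r; try lra.
  apply: Rmult_le_compat_l; first lra; apply: Rinv_le_contravar => //.
  by apply: circ_far; lra.
have c_f s : 0 <= s <= 1 -> cont_all (fun t => f (Phi s t)).
  move=> Hs t; apply: cont_comp; first exact: rderiv_cont (dPhi_t s t).
  by apply: analytic_cont Hf _; apply: Phi_in.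
have c_fk s : 0 <= s <= 1 -> cont_all (fun t => f (Phi s t) * ker t)%C.
  by move=> Hs t; apply: cont_mult; [apply: c_f | apply: c_ker].
pose J s := cmean (fun t => f (Phi s t) * ker t)%C.
(* The factor [s] cancels in [dPhi / (Phi - z)], so the integrand extends
   continuously to [s = 0]. *)
have J_const s : 0 < s <= 1 -> J 1 = J s.
  move=> Hs.
  have G := goursat_loop Phi P Q (fun w => f w / (w - z))%C (2 * r)
     dPhi_s dPhi_t cP cQ s ltac:(lra).
  have {}G := G ltac:(by move=> *; apply: P_le).
  have {}G := G ltac:(move=> x t Hx; rewrite /Q !Cmod_mult Cmod_Ci expi_mod !Cmod_R
                       !Rabs_pos_eq; nra).
  have far x t : s <= x <= 1 -> (Phi x t - z)%C <> 0.
    move=> Hx; have -> : (Phi x t - z = x * (circ a r t - z))%C by rewrite /Phi; ring.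
    apply: Cmult_neq_0; first by move/RtoC_inj; lra.
    exact: circ_neq.
  have dk x t : s <= x <= 1 -> exists l, has_deriv (fun w => f w / (w - z))%C (Phi x t) l.
    move=> Hx; have Hf' := analytic_deriv _ _ _ Hf (Phi_in x t ltac:(lra)).
    eexists; apply: has_deriv_div Hf' _ (far x t Hx).
    by apply: has_deriv_minus; [apply: has_deriv_id | apply: has_deriv_const].
  have {}G := G dk ltac:(by move=> x; rewrite /Phi /circ expi_0 expi_2PI)
                  ltac:(by move=> x; rewrite /P /circ expi_0 expi_2PI).
  have E x : s <= x <= 1 ->
      cmean (fun t => f (Phi x t) / (Phi x t - z) * Q x t)%C = (Ci * J x)%C.
    move=> Hx; rewrite /J -cmean_scal; last by apply: c_fk; lra.
    apply: cmean_ext => t; rewrite /ker /Q.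
    have -> : (Phi x t - z = x * (circ a r t - z))%C by rewrite /Phi; ring.
    field; split; first exact: circ_neq.
    by move/RtoC_inj; lra.
  apply: (Cmult_cancel_l Ci); first exact: Ci_nz.
  by rewrite -!E; try lra; rewrite /cmean G.
have E1 : J 1 = cmean (fun t => f (circ a r t) * ker t)%C.
  apply: cmean_ext => t; congr (f _ * _)%C; rewrite /Phi; ring.
rewrite -[RHS]E1.
have E0 : J 0 = f z.
  rewrite /J -(Cmult_1_r (f z)) -(cmean_kernel a r z Hz) -cmean_scal //.
  apply: cmean_ext => t; congr (f _ * _)%C; rewrite /Phi; ring.
rewrite -E0; apply/eq_sym/Ceq_minus/Cmod_eq_0/Rle_antisym; last exact: Cmod_ge_0.
apply: le_epsilon => e He; rewrite Rplus_0_l.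
have He' : 0 < e * d / r by apply: Rdiv_lt_0_compat => //; nra.
have cf : cont (T := C_UniformSpace) f z.
  by apply: analytic_cont Hf _; rewrite /disc; lra.
have [x [Hx Hfx]] := proj1 (cont_C_eps _ _) cf _ He'.
pose s := Rmin 1 (x / (4 * r)).
have xr : 0 < x / (4 * r) by apply: Rdiv_lt_0_compat; lra.
have Hs : 0 < s <= 1 by split; [apply: Rmin_pos; lra | apply: Rmin_l].
rewrite (J_const s Hs) /J -cmean_minus; try by apply: c_fk; lra.
apply: cmean_bound.
  by move=> t; apply: cont_minus; apply: c_fk; lra.
move=> t _; have -> : (f (Phi s t) * ker t - f (Phi 0 t) * ker t =
                     (f (Phi s t) - f z) * ker t)%C.
  have -> : Phi 0 t = z by rewrite /Phi; ring.
  ring.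
rewrite Cmod_mult; have -> : e = (e * d / r) * (r / d) by field; lra.
apply: Rmult_le_compat; try exact: Cmod_ge_0; last exact: ker_le.
apply/Rlt_le/Hfx.
have -> : (Phi s t - z = s * P s t)%C by rewrite /Phi /P; ring.
rewrite Cmod_mult Cmod_R Rabs_pos_eq; last lra.
have : s <= x / (4 * r) by apply: Rmin_r.
move/Rle_div_r => K; have := K ltac:(lra) => {}K.
have := P_le s t; nra.
Qed.

(** * Consequences of Cauchy's formula *)

Lemma cmean_deriv (K : C -> R -> C) (K' : R -> C) z d B : 0 < d ->
  (forall w, Cmod (w - z) < d -> cont_all (K w)) -> cont_all K' ->
  (forall w t, Cmod (w - z) < d -> 0 <= t <= 2 * PI ->
     Cmod (K w t - K z t - K' t * (w - z)) <= B * Cmod (w - z) ^ 2) ->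
  has_deriv (fun w => cmean (K w)) z (cmean K').
Proof.
move=> Hd cK cK' HB; apply/has_deriv_eps => e He.
have B1 : 0 < Rabs B + 1 by have := Rabs_pos B; lra.
exists (Rmin d (e / (Rabs B + 1))); split.
  by apply: Rmin_pos => //; apply: Rdiv_lt_0_compat.
move=> w Hw.
have Hw1 := Rlt_le_trans _ _ _ Hw (Rmin_l _ _).
have {}Hw := Rlt_le_trans _ _ _ Hw (Rmin_r _ _).
have cz := cK z ltac:(by rewrite Cmod_sub_self).
have cw := cK w Hw1.
have E : (cmean (K w) - cmean (K z) - cmean K' * (w - z) =
          cmean (fun t => K w t - K z t - (w - z) * K' t))%C.
  rewrite cmean_minus ?cmean_minus ?cmean_scal //; first ring.
  - by move=> t; apply: cont_minus.
  - by move=> t; apply: cont_mult; [apply: cont_const | apply: cK'].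
rewrite E; apply: cmean_bound.
  move=> t; apply: cont_minus; first exact: cont_minus.
  by apply: cont_mult; [apply: cont_const | apply: cK'].
move=> t Ht; rewrite (Cmult_comm (w - z)).
apply: Rle_trans (HB w t Hw1 Ht) _.
have x0 := Cmod_ge_0 (w - z); have B2 := Rle_abs B.
move/Rlt_div_r: Hw => Hw; have {}Hw := Hw B1.
have : 0 <= Cmod (w - z) * (e - Cmod (w - z) * (Rabs B + 1)) by apply: Rmult_le_pos; lra.
have : 0 <= Cmod (w - z) * Cmod (w - z) * (Rabs B + 1 - B) by apply: Rmult_le_pos; nra.
lra.
Qed.

Lemma cont_all_bounded f : cont_all f ->
  exists M, 0 < M /\ forall t, 0 <= t <= 2 * PI -> Cmod (f t) <= M.
Proof.
move=> Hf; have P0 := two_PI_pos.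
have [t0 [H0 _]] := continuity_ab_maj (fun t => Cmod (f t)) 0 (2 * PI) ltac:(lra)
  (fun t _ => proj2 (continuity_pt_filterlim _ _) (cont_Cmod f t (Hf t))).
exists (Cmod (f t0) + 1); split; first by have := Cmod_ge_0 (f t0); lra.
by move=> t /H0; lra.
Qed.

Section CauchyKernel.

Variables (psi : R -> C) (a : C) (r : R) (z : C).
Hypothesis c_psi : cont_all psi.
Hypothesis Hz : disc a r z.

Let d := r - Cmod (z - a).

Let d_pos : 0 < d.
Proof. by move: Hz; rewrite /disc /d; lra. Qed.

Let near w : Cmod (w - z) < d / 2 -> disc a r w.
Proof.
move=> Hw; have := Cmod_triangle (w - z) (z - a); rewrite /disc.
have -> : (w - z + (z - a) = w - a)%C by ring.
have := d_pos; rewrite /d in Hw *; lra.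
Qed.

Let circ_far_near w t : Cmod (w - z) < d / 2 -> d / 2 <= Cmod (circ a r t - w).
Proof.
move=> Hw; have r0 : 0 <= r by have := Cmod_ge_0 (z - a); have := d_pos; rewrite /d; lra.
have := circ_far a r t w r0; have := Cmod_triangle (w - z) (z - a).
have -> : (w - z + (z - a) = w - a)%C by ring.
rewrite /d in Hw *; lra.
Qed.

Lemma cont_kernel w : disc a r w -> cont_all (fun t => psi t / (circ a r t - w))%C.
Proof.
move=> Hw t; apply: cont_div => //; last exact: circ_neq.
by apply: cont_minus; [apply: cont_circ | apply: cont_const].
Qed.

Lemma cont_kernel2 w : disc a r w ->
  cont_all (fun t => psi t / ((circ a r t - w) * (circ a r t - w)))%C.
Proof.
move=> Hw t; apply: cont_div => //.
- by apply: cont_mult; apply: cont_minus; (apply: cont_circ || apply: cont_const).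
- by apply: Cmult_neq_0; apply: circ_neq.
Qed.

Lemma cauchy_integral_deriv :
  has_deriv (fun w => cmean (fun t => psi t / (circ a r t - w)))%C z
            (cmean (fun t => psi t / ((circ a r t - z) * (circ a r t - z))))%C.
Proof.
have [M [M0 HM]] := cont_all_bounded psi c_psi.
have d2 : 0 < d / 2 by have := d_pos; lra.
apply: (cmean_deriv _ _ z (d / 2) (M * (/ (d / 2) * / (d / 2) * / (d / 2)))) => //.
- by move=> w Hw; apply/cont_kernel/near.
- exact: cont_kernel2.
- move=> w t Hw Ht; have Hn := circ_neq a r t w (near w Hw).
  have Hn0 := circ_neq a r t z Hz.
  have F := circ_far_near w t Hw.
  have F0 := circ_far_near z t ltac:(by rewrite Cmod_sub_self).
  set x := (circ a r t - z)%C in Hn0 F0 *; set y := (circ a r t - w)%C in Hn F *.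
  have -> : (psi t / y - psi t / x - psi t / (x * x) * (w - z) =
             psi t * (/ y * / x * / x) * ((w - z) * (w - z)))%C.
    have E : (w - z = x - y)%C by rewrite /x /y; ring.
    by rewrite E; field.
  rewrite !Cmod_mult !Cmod_inv // -/(pow _ 2) /=.
  have -> : Cmod (w - z) * (Cmod (w - z) * 1) = Cmod (w - z) * Cmod (w - z) by ring.
  apply: Rmult_le_compat_r; first by have := Cmod_ge_0 (w - z); nra.
  have I0 := Rinv_0_lt_compat _ d2.
  have I1 : / Cmod x <= / (d / 2) by apply: Rinv_le_contravar.
  have I2 : / Cmod y <= / (d / 2) by apply: Rinv_le_contravar.
  have J1 : 0 < / Cmod x by apply/Rinv_0_lt_compat; lra.
  have J2 : 0 < / Cmod y by apply/Rinv_0_lt_compat; lra.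
  apply: Rmult_le_compat; [exact: Cmod_ge_0 | nra | exact: HM |].
  by apply: Rmult_le_compat; try nra; apply: Rmult_le_compat; lra.
Qed.

Lemma cauchy_integral_deriv2 : exists l,
  has_deriv (fun w => cmean (fun t => psi t / ((circ a r t - w) * (circ a r t - w))))%C z l.
Proof.
have [M [M0 HM]] := cont_all_bounded psi c_psi.
have d2 : 0 < d / 2 by have := d_pos; lra.
pose i := / (d / 2).
pose K' t := (psi t / ((circ a r t - z) * (circ a r t - z)) * (2 / (circ a r t - z)))%C.
exists (cmean K').
apply: (cmean_deriv _ _ z (d / 2) (M * (i * i * i * i * 3))) => //.
- by move=> w Hw; apply/cont_kernel2/near.
- move=> t; apply: cont_mult; first exact: cont_kernel2.
  apply: cont_div; first exact: cont_const; last exact: circ_neq.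
  by apply: cont_minus; [apply: cont_circ | apply: cont_const].
- move=> w t Hw Ht; have Hn := circ_neq a r t w (near w Hw).
  have Hn0 := circ_neq a r t z Hz.
  have F := circ_far_near w t Hw.
  have F0 := circ_far_near z t ltac:(by rewrite Cmod_sub_self).
  rewrite /K'.
  set x := (circ a r t - z)%C in Hn0 F0 *; set y := (circ a r t - w)%C in Hn F *.
  have -> : (psi t / (y * y) - psi t / (x * x) - psi t / (x * x) * (2 / x) * (w - z) =
             psi t * (/ y * / y * / x * / x + 2 * (/ y * / x * / x * / x))
             * ((w - z) * (w - z)))%C.
    have E : (w - z = x - y)%C by rewrite /x /y; ring.
    by rewrite E; field.
  rewrite Cmod_mult (Cmod_mult (w - z)).
  have -> : Cmod (w - z) ^ 2 = Cmod (w - z) * Cmod (w - z) by ring.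
  apply: Rmult_le_compat_r; first by have := Cmod_ge_0 (w - z); nra.
  have I0 := Rinv_0_lt_compat _ d2; rewrite -/i in I0.
  have I1 : / Cmod x <= i by apply: Rinv_le_contravar.
  have I2 : / Cmod y <= i by apply: Rinv_le_contravar.
  have J1 : 0 < / Cmod x by apply/Rinv_0_lt_compat; lra.
  have J2 : 0 < / Cmod y by apply/Rinv_0_lt_compat; lra.
  rewrite Cmod_mult; apply: Rmult_le_compat; try exact: Cmod_ge_0; first exact: HM.
  apply: Rle_trans (Cmod_triangle _ _) _.
  rewrite !Cmod_mult !Cmod_inv // Cmod_R Rabs_pos_eq; last lra.
  have P4 p q u v : 0 < p <= i -> 0 < q <= i -> 0 < u <= i -> 0 < v <= i ->
      p * q * u * v <= i * i * i * i.
    move=> *; apply: Rmult_le_compat; try lra.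
    - by repeat (apply: Rmult_le_pos; try lra).
    - apply: Rmult_le_compat; try lra; last by apply: Rmult_le_compat; lra.
      by apply: Rmult_le_pos; lra.
  have := P4 (/ Cmod y) (/ Cmod y) (/ Cmod x) (/ Cmod x) ltac:(lra) ltac:(lra)
            ltac:(lra) ltac:(lra).
  have := P4 (/ Cmod y) (/ Cmod x) (/ Cmod x) (/ Cmod x) ltac:(lra) ltac:(lra)
            ltac:(lra) ltac:(lra).
  lra.
Qed.

End CauchyKernel.

Definition boundary_values f a r t : C := (f (circ a r t) * (r * expi t))%C.

Lemma cont_boundary_values f a r r' : 0 < r < r' -> analytic_on (disc a r') f ->
  cont_all (boundary_values f a r).
Proof.
move=> Hr Hf t; apply: cont_mult.
- apply: cont_comp; first exact: cont_circ.
  by apply: analytic_cont Hf _; rewrite /disc circ_dist; lra.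
- by apply: cont_mult; [apply: cont_const | apply: cont_expi].
Qed.

Lemma cauchy_formula' f a r r' z :
  r < r' -> analytic_on (disc a r') f -> disc a r z ->
  f z = cmean (fun t => boundary_values f a r t / (circ a r t - z))%C.
Proof.
move=> Hr Hf Hz; rewrite (cauchy_formula f a r r' z) //.
apply: cmean_ext => t; rewrite /boundary_values; field; exact: circ_neq.
Qed.

Lemma disc_pos a r z : disc a r z -> 0 < r.
Proof. by rewrite /disc; have := Cmod_ge_0 (z - a); lra. Qed.

Lemma disc_near a r z : disc a r z ->
  exists d, 0 < d /\ forall w, Cmod (w - z) < d -> disc a r w.
Proof. by move=> Hz; apply: open_C_disc Hz; apply: disc_open. Qed.

(** Near a point, [f'] is the derivative of the Cauchy integral of [f], which can
    be differentiated once more under the integral sign. *)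
Theorem analytic_derivative (D : C -> Prop) f :
  open (T := C_UniformSpace) D -> analytic_on D f -> analytic_on D (C_derive f).
Proof.
move=> oD Hf; apply: analytic_intro => a Da.
have [r' [r0 Hr']] := open_C_disc D a oD Da.
have Hf' := analytic_sub _ _ _ Hr' Hf.
pose r := r' / 2.
have cb : cont_all (boundary_values f a r).
  by apply: cont_boundary_values Hf'; rewrite /r; lra.
have Ha : disc a r a by apply: disc_center; rewrite /r; lra.
have [l Hl] := cauchy_integral_deriv2 (boundary_values f a r) a r a cb Ha.
exists l; apply: has_deriv_ext_loc Hl; exists r; split; first by rewrite /r; lra.
move=> w Hw; symmetry; apply: C_derive_has.
apply: has_deriv_ext_loc (cauchy_integral_deriv (boundary_values f a r) a r w cb Hw).
have [e [He Hd]] := disc_near a r w Hw; exists e; split=> // v Hv.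
by rewrite (cauchy_formula' f a r r' v) //; [rewrite /r; lra | apply: Hd].
Qed.

Definition dquot (f : C -> C) (b z : C) : C :=
  if excluded_middle_informative (z = b) then C_derive f b
  else ((f z - f b) / (z - b))%C.

Lemma dquot_b f b : dquot f b b = C_derive f b.
Proof. by rewrite /dquot; case: excluded_middle_informative. Qed.

Lemma dquot_neq f b z : z <> b -> dquot f b z = ((f z - f b) / (z - b))%C.
Proof. by rewrite /dquot; case: excluded_middle_informative. Qed.

Lemma dquot_spec f b z : (f z - f b = dquot f b z * (z - b))%C.
Proof.
case: (classic (z = b)) => [-> | H]; first ring.
rewrite dquot_neq //; field; exact: Cminus_eq_contra.
Qed.

(** At [b] itself the quotient agrees with the Cauchy integral of
    [f(zeta) / (zeta - b)], because the constant term of [f] cancels. *)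
Theorem analytic_dquot (D : C -> Prop) f b :
  open (T := C_UniformSpace) D -> analytic_on D f -> D b -> analytic_on D (dquot f b).
Proof.
move=> oD Hf Db; apply: analytic_intro => z Dz.
case: (classic (z = b)) => [-> | Hzb].
- have [r' [r0 Hr']] := open_C_disc D b oD Db.
  have Hf' := analytic_sub _ _ _ Hr' Hf.
  pose r := r' / 2.
  have cb : cont_all (boundary_values f b r).
    by apply: cont_boundary_values Hf'; rewrite /r; lra.
  have Hb : disc b r b by apply: disc_center; rewrite /r; lra.
  have ck := cont_kernel (boundary_values f b r) b r cb b Hb.
  have Hd := cauchy_integral_deriv _ b r b ck Hb.
  eexists; apply: has_deriv_ext_loc Hd; exists r; split; first by rewrite /r; lra.
  move=> w Hw; case: (classic (w = b)) => [-> | Hwb].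
  + rewrite dquot_b; symmetry; apply: C_derive_has.
    have := cauchy_integral_deriv (boundary_values f b r) b r b cb Hb.
    have -> : cmean (fun t => boundary_values f b r t / (circ b r t - b) / (circ b r t - b))%C =
              cmean (fun t => boundary_values f b r t / ((circ b r t - b) * (circ b r t - b)))%C.
      by apply: cmean_ext => t; field; apply: circ_neq.
    apply: has_deriv_ext_loc; exists r; split; first by rewrite /r; lra.
    by move=> v Hv; rewrite (cauchy_formula' f b r r' v) //; rewrite /r; lra.
  + have Hn := Cminus_eq_contra _ _ Hwb.
    apply: (Cmult_cancel_l (w - b)) => //.
    rewrite (Cmult_comm _ (dquot f b w)) -dquot_spec -cmean_scal; last first.
      exact: cont_kernel.
    rewrite (cauchy_formula' f b r r' w) ?(cauchy_formula' f b r r' b) //; try (rewrite /r; lra).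
    rewrite -cmean_minus; try exact: cont_kernel.
    apply: cmean_ext => t; field.
    by split; apply: circ_neq.
- have Hn := Cminus_eq_contra _ _ Hzb.
  have Hq : has_deriv (fun w => (f w - f b) / (w - b))%C z
     ((C_derive f z - 0) * (z - b) / ((z - b) * (z - b))
        - (f z - f b) * (1 - 0) / ((z - b) * (z - b)))%C.
    have := has_deriv_div _ _ z _ _
      (has_deriv_minus _ _ _ _ _ (analytic_deriv D f z Hf Dz) (has_deriv_const (f b) z))
      (has_deriv_minus _ _ _ _ _ (has_deriv_id z) (has_deriv_const b z)) Hn.
    by congr has_deriv; field.
  eexists; apply: has_deriv_ext_loc Hq.
  exists (Cmod (z - b)); split; first by apply/Cmod_gt_0.
  move=> w Hw; rewrite dquot_neq // => E; move: Hw; rewrite E Cmod_sub_sym; lra.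
Qed.

Lemma analytic_pow (D : C -> Prop) f n :
  analytic_on D f -> analytic_on D (fun z => f z ^ n)%C.
Proof.
move=> Hf; apply: analytic_intro => z Dz.
exact: has_deriv_pow (analytic_deriv D f z Hf Dz).
Qed.

Lemma le_of_pow_le x M K : 0 <= x -> 0 <= M -> (forall n : nat, x ^ n <= K * M ^ n) -> x <= M.
Proof.
move=> x0 M0 H; apply: Rnot_lt_le => Hlt.
case: (Req_dec M 0) => [E | Hn].
  by have := H 1%nat; rewrite E /= in Hlt *; lra.
have Mp : 0 < M by lra.
have q1 : 1 < x / M by apply/Rlt_div_r => //; lra.
have [n Hk] := Pow_x_infinity (x / M) ltac:(rewrite Rabs_pos_eq; lra) (K + 1).
have := Hk n (le_n n); rewrite Rabs_pos_eq; last by apply: pow_le; lra.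
rewrite /Rdiv Rpow_mult_distr pow_inv => G.
have Pn : 0 < M ^ n by apply: pow_lt.
have : x ^ n * / M ^ n <= K by apply/Rle_div_l.
lra.
Qed.

(** Cauchy's formula for [f ^ n] bounds [|f z| ^ n] by a constant times [M ^ n];
    the constant disappears in the limit. *)
Theorem maximum_principle f a r r' M z :
  r < r' -> analytic_on (disc a r') f ->
  (forall t, 0 <= t <= 2 * PI -> Cmod (f (circ a r t)) <= M) ->
  disc a r z -> Cmod (f z) <= M.
Proof.
move=> Hr Hf HM Hz; have r0 := disc_pos _ _ _ Hz.
have P0 := two_PI_pos.
have M0 : 0 <= M by apply: Rle_trans (Cmod_ge_0 _) (HM 0 ltac:(lra)).
have d0 : 0 < r - Cmod (z - a) by rewrite /disc in Hz; lra.
apply: (le_of_pow_le _ _ (r / (r - Cmod (z - a)))) => // [|n].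
  exact: Cmod_ge_0.
have Hfn := analytic_pow _ _ n Hf.
rewrite -Cmod_pow (cauchy_formula' _ a r r' z Hr Hfn Hz).
apply: cmean_bound.
  apply: cont_kernel => //; apply: cont_boundary_values Hfn; lra.
move=> t Ht; have Hn := circ_neq a r t z Hz.
rewrite /boundary_values Cmod_div // !Cmod_mult Cmod_pow expi_mod Cmod_R.
rewrite Rabs_pos_eq; last lra.
have F := circ_far a r t z ltac:(lra).
have Q : Cmod (f (circ a r t)) ^ n <= M ^ n.
  by apply: pow_incr; split; [apply: Cmod_ge_0 | apply: HM].
have Q0 : 0 <= Cmod (f (circ a r t)) ^ n by apply/pow_le/Cmod_ge_0.
have I : / Cmod (circ a r t - z) <= / (r - Cmod (z - a)) by apply: Rinv_le_contravar.
have I0 : 0 < / Cmod (circ a r t - z) by apply: Rinv_0_lt_compat; lra.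
have -> : Cmod (f (circ a r t)) ^ n * (r * 1) / Cmod (circ a r t - z) =
          (r * / Cmod (circ a r t - z)) * Cmod (f (circ a r t)) ^ n by rewrite /Rdiv; ring.
apply: Rmult_le_compat => //; first nra.
by rewrite /Rdiv; apply: Rmult_le_compat_l; lra.
Qed.

(** The maximum principle for [f(z) / (z - a)] on circles of radius tending to
    [r]. *)
Theorem schwarz f a r M z :
  analytic_on (disc a r) f -> (forall w, disc a r w -> Cmod (f w) <= M) -> f a = 0 ->
  disc a r z -> Cmod (dquot f a z) <= M / r.
Proof.
move=> Hf HM fa Hz; have r0 := disc_pos _ _ _ Hz.
have Hz' : Cmod (z - a) < r by [].
have M0 : 0 <= M by apply: Rle_trans (Cmod_ge_0 _) (HM z Hz).
have Hq := analytic_dquot _ f a (disc_open a r) Hf (disc_center a r r0).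
have K s : Cmod (z - a) < s < r -> Cmod (dquot f a z) * s <= M.
  move=> Hs; have s0 : 0 < s by have := Cmod_ge_0 (z - a); lra.
  apply/Rle_div_r => //.
  apply: (maximum_principle _ a s r) => //; [lra | move=> t _ | rewrite /disc; lra].
  have Hd := circ_dist a s t ltac:(lra).
  have Hn : (circ a s t - a)%C <> 0 by apply/Cmod_gt_0; lra.
  have Ht : circ a s t <> a by move=> E; apply: Hn; rewrite E; ring.
  rewrite dquot_neq // fa Cmod_div // Hd.
  have -> : (f (circ a s t) - 0)%C = f (circ a s t) by ring.
  apply: Rmult_le_compat_r; first by apply/Rlt_le/Rinv_0_lt_compat.
  by apply: HM; rewrite /disc Hd; lra.
apply/Rle_div_r => //.
apply: Rnot_lt_le => Hlt.
set x := Cmod (dquot f a z) in K Hlt.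
have x0 : 0 < x.
  have := Cmod_ge_0 (dquot f a z); rewrite -/x; case=> // E.
  by move: Hlt; rewrite -E; lra.
have Hm : M / x < r by apply/Rlt_div_l => //; lra.
pose s := (Rmax (M / x) (Cmod (z - a)) + r) / 2.
have Hs : Rmax (M / x) (Cmod (z - a)) < s < r.
  have : Rmax (M / x) (Cmod (z - a)) < r by apply: Rmax_lub_lt.
  rewrite /s; lra.
have := Rmax_l (M / x) (Cmod (z - a)); have := Rmax_r (M / x) (Cmod (z - a)) => H1 H2.
have := K s ltac:(lra).
have : M / x < s by lra.
move/Rlt_div_l => G; have := G x0; lra.
Qed.

Corollary schwarz_le f a r M z :
  analytic_on (disc a r) f -> (forall w, disc a r w -> Cmod (f w) <= M) -> f a = 0 ->
  disc a r z -> Cmod (f z) <= M / r * Cmod (z - a).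
Proof.
move=> Hf HM fa Hz; have := schwarz f a r M z Hf HM fa Hz.
have := dquot_spec f a z; rewrite fa.
have -> : (f z - 0 = f z)%C by ring.
move=> -> H; rewrite Cmod_mult; apply: Rmult_le_compat_r => //; exact: Cmod_ge_0.
Qed.

Corollary schwarz_deriv f a r M : 0 < r ->
  analytic_on (disc a r) f -> (forall w, disc a r w -> Cmod (f w) <= M) -> f a = 0 ->
  Cmod (C_derive f a) <= M / r.
Proof.
move=> r0 Hf HM fa; rewrite -dquot_b; apply: schwarz => //; exact: disc_center.
Qed.

Corollary bounded_lipschitz f z r M w :
  analytic_on (disc z r) f -> (forall v, disc z r v -> Cmod (f v) <= M) ->
  disc z r w -> Cmod (f w - f z) <= 2 * M / r * Cmod (w - z).
Proof.
move=> Hf HM Hw; have r0 := disc_pos _ _ _ Hw.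
apply: (schwarz_le (fun v => f v - f z)%C z r (2 * M) w) => //.
- apply: analytic_intro => v Hv; eexists.
  by apply: has_deriv_minus (analytic_deriv _ _ _ Hf Hv) (has_deriv_const _ _).
- move=> v Hv; apply: Rle_trans (Cmod_triangle _ _) _; rewrite Cmod_opp.
  have := HM v Hv; have := HM z (disc_center z r r0); lra.
- ring.
Qed.

(** Cauchy's formula passes to the limit, and a Cauchy integral of a continuous
    function is differentiable. *)
Theorem uniform_limit_analytic (g : nat -> C -> C) f a r :
  (forall n, analytic_on (disc a r) (g n)) ->
  (forall e, 0 < e -> exists n, forall z, disc a r z -> Cmod (g n z - f z) <= e) ->
  analytic_on (disc a r) f.
Proof.
move=> Hg Hlim; apply: analytic_intro => z Hz; have r0 := disc_pos _ _ _ Hz.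
pose s := (Cmod (z - a) + r) / 2.
have Hs : Cmod (z - a) < s < r by rewrite /disc in Hz; rewrite /s; lra.
have s0 : 0 < s by have := Cmod_ge_0 (z - a); lra.
have cf w : disc a r w -> cont (T := C_UniformSpace) f w.
  move=> Hw; apply/cont_C_eps => e He.
  have [n Hn] := Hlim (e / 4) ltac:(lra).
  have [d [Hd Hdn]] := proj1 (cont_C_eps _ _) (analytic_cont _ _ _ (Hg n) Hw) (e / 4) ltac:(lra).
  have [d' [Hd' Hin]] := disc_near a r w Hw.
  exists (Rmin d d'); split; first exact: Rmin_pos.
  move=> v Hv.
  have H1 := Hdn v (Rlt_le_trans _ _ _ Hv (Rmin_l _ _)).
  have H2 := Hn v (Hin v (Rlt_le_trans _ _ _ Hv (Rmin_r _ _))).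
  have H3 := Hn w Hw.
  have -> : (f v - f w = - (g n v - f v) + ((g n v - g n w) + (g n w - f w)))%C by ring.
  have T1 := Cmod_triangle (- (g n v - f v)) ((g n v - g n w) + (g n w - f w)).
  have T2 := Cmod_triangle (g n v - g n w) (g n w - f w).
  rewrite Cmod_opp in T1; lra.
have cb : cont_all (boundary_values f a s).
  move=> t; apply: cont_mult.
  - by apply: cont_comp; [apply: cont_circ | apply: cf; rewrite /disc circ_dist; lra].
  - by apply: cont_mult; [apply: cont_const | apply: cont_expi].
have E w : disc a s w -> f w = cmean (fun t => boundary_values f a s t / (circ a s t - w))%C.
  move=> Hw; have Hw' : Cmod (w - a) < s by [].
  apply/Ceq_minus/Cmod_eq_0/Rle_antisym; last exact: Cmod_ge_0.
  apply: le_epsilon => e He; rewrite Rplus_0_l.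
  pose d := s - Cmod (w - a); have d0 : 0 < d by rewrite /d; lra.
  pose B := 1 + s / d.
  have B1 : 1 < B.
    have sd : 0 < s / d by apply: Rdiv_lt_0_compat.
    by rewrite /B; lra.
  have [n Hn] := Hlim (e / B) ltac:(by apply: Rdiv_lt_0_compat; lra).
  have cn : cont_all (boundary_values (g n) a s).
    by apply: cont_boundary_values (Hg n); lra.
  have -> : (f w - cmean (fun t => boundary_values f a s t / (circ a s t - w)) =
     - (g n w - f w) + cmean (fun t => boundary_values (g n) a s t / (circ a s t - w)
                   - boundary_values f a s t / (circ a s t - w)))%C.
    rewrite cmean_minus; try by apply: cont_kernel.
    rewrite -(cauchy_formula' (g n) a s r w) //; [ring | lra].
  apply: Rle_trans (Cmod_triangle _ _) _; rewrite Cmod_opp.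
  have -> : e = e / B + (e / B) * (s / d) by rewrite /B; field; rewrite -/B; split; lra.
  apply: Rplus_le_compat; first by apply: Hn; rewrite /disc; lra.
  apply: cmean_bound.
    by move=> t; apply: cont_minus; apply: cont_kernel.
  move=> t _; have Hnz := circ_neq a s t w Hw.
  have -> : (boundary_values (g n) a s t / (circ a s t - w)
                   - boundary_values f a s t / (circ a s t - w) =
     (g n (circ a s t) - f (circ a s t)) * (s * expi t / (circ a s t - w)))%C.
    by rewrite /boundary_values; field.
  rewrite Cmod_mult; apply: Rmult_le_compat; try exact: Cmod_ge_0.
  - by apply: Hn; rewrite /disc circ_dist; lra.
  - rewrite Cmod_div // Cmod_mult expi_mod Cmod_R Rabs_pos_eq ?Rmult_1_r; last lra.
    apply: Rmult_le_compat_l; first lra; apply: Rinv_le_contravar => //.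
    by apply: circ_far; lra.
have Hz' : disc a s z by rewrite /disc; lra.
eexists; apply: has_deriv_ext_loc (cauchy_integral_deriv _ a s z cb Hz').
have [d [Hd Hin]] := disc_near a s z Hz'.
by exists d; split=> // w Hw; rewrite -E //; apply: Hin.
Qed.

(** * Injective analytic functions *)

Lemma cont_all_away f : cont_all f -> (forall t, f t <> 0) ->
  exists m, 0 < m /\ forall t, 0 <= t <= 2 * PI -> m <= Cmod (f t).
Proof.
move=> Hf Hn; have P0 := two_PI_pos.
have [t0 [H0 _]] := continuity_ab_min (fun t => Cmod (f t)) 0 (2 * PI) ltac:(lra)
  (fun t _ => proj2 (continuity_pt_filterlim _ _) (cont_Cmod f t (Hf t))).
by exists (Cmod (f t0)); split; [apply/Cmod_gt_0 | exact: H0].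
Qed.

(** The maximum principle applied to [1 / f]. *)
Lemma exists_zero f a r r' m : 0 < r < r' -> analytic_on (disc a r') f ->
  (forall t, 0 <= t <= 2 * PI -> m <= Cmod (f (circ a r t))) -> Cmod (f a) < m ->
  exists z, disc a r' z /\ f z = 0.
Proof.
move=> Hr Hf Hm Ha; apply: NNPP => none.
have Hn z : disc a r' z -> f z <> 0 by move=> Hz E; apply: none; exists z.
have m0 : 0 < m by have := Cmod_ge_0 (f a); lra.
have Hfi : analytic_on (disc a r') (fun z => / f z)%C.
  apply: analytic_intro => z Hz; eexists.
  exact: has_deriv_inv (analytic_deriv _ _ _ Hf Hz) (Hn z Hz).
have := maximum_principle _ a r r' (/ m) a ltac:(lra) Hfi _ (disc_center a r ltac:(lra)).
have fa : f a <> 0 by apply: Hn; apply: disc_center; lra.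
rewrite Cmod_inv // => K.
have : / Cmod (f a) <= / m.
  apply: K => t Ht; have Hc : f (circ a r t) <> 0.
    by apply: Hn; rewrite /disc circ_dist; lra.
  by rewrite Cmod_inv //; apply: Rinv_le_contravar => //; apply: Hm.
have p : 0 < Cmod (f a) by apply/Cmod_gt_0.
move/Rinv_le_contravar => G; have := G (Rinv_0_lt_compat _ p); rewrite !Rinv_inv; lra.
Qed.

Lemma conformal_circle_min (D : C -> Prop) f a r r' : conformal_on D f ->
  0 < r < r' -> (forall z, disc a r' z -> D z) ->
  exists m, 0 < m /\ forall t, 0 <= t <= 2 * PI -> m <= Cmod (f (circ a r t) - f a).
Proof.
move=> [Hf inj] Hr HD.
have Hc t : D (circ a r t) by apply: HD; rewrite /disc circ_dist; lra.
apply: cont_all_away => t.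
- apply: cont_minus; last exact: cont_const.
  by apply: cont_comp; [apply: cont_circ | apply: analytic_cont Hf _].
- apply: Cminus_eq_contra => E.
  have Ea : circ a r t = a by apply: inj => //; apply/HD/disc_center; lra.
  have := circ_dist a r t ltac:(lra); rewrite Ea Cmod_sub_self; lra.
Qed.

(** For [w] close to [f a] the function [f - w] is smaller at [a] than on a circle
    about [a], where injectivity bounds [f - f a] from below. *)
Theorem conformal_open_map (D : C -> Prop) f a r : conformal_on D f ->
  0 < r -> (forall z, disc a r z -> D z) ->
  exists m, 0 < m /\ forall w, disc (f a) m w -> exists z, disc a r z /\ f z = w.
Proof.
move=> Hf r0 HD.
have [m [m0 Hm]] := conformal_circle_min D f a (r / 2) r Hf ltac:(lra) HD.
exists (m / 2); split=> [|w Hw]; first lra.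
have Hfw : analytic_on (disc a r) (fun z => f z - w)%C.
  apply: analytic_intro => z Hz; eexists; apply: has_deriv_minus (has_deriv_const _ _).
  by apply: analytic_deriv (proj1 Hf) _; apply: HD.
have [z [Hz E]] : exists z, disc a r z /\ (f z - w)%C = 0.
  apply: (exists_zero _ a (r / 2) r (m / 2)) => //; first lra.
  - move=> t Ht; have := Hm t Ht.
    have := Cmod_tri_sub (f (circ a (r / 2) t) - f a) (f (circ a (r / 2) t) - w).
    have -> : (f (circ a (r / 2) t) - f a - (f (circ a (r / 2) t) - w) = w - f a)%C by ring.
    rewrite /disc in Hw; lra.
  - by rewrite Cmod_sub_sym.
by exists z; split=> //; apply/Ceq_minus.
Qed.

Lemma rderiv_line f (z v : C) (t : R) l :
  has_deriv f (z + t * v) l -> rderiv (fun u : R => f (z + u * v)%C) t (l * v).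
Proof.
move=> /has_deriv_eps H.
have v1 : 0 < Cmod v + 1 by have := Cmod_ge_0 v; lra.
have K e : 0 < e -> exists d, 0 < d /\ forall u, Rabs (u - t) < d ->
    Cmod (f (z + u * v) - f (z + t * v) - RtoC (u - t) * (l * v))%C <= e * Rabs (u - t).
  move=> He; have [d [Hd Hdw]] := H (e / (Cmod v + 1)) ltac:(by apply: Rdiv_lt_0_compat).
  exists (d / (Cmod v + 1)); split; first by apply: Rdiv_lt_0_compat.
  move=> u Hu.
  have E : (z + u * v - (z + t * v) = RtoC (u - t) * v)%C by rewrite RtoC_minus; ring.
  have Em : Cmod (z + u * v - (z + t * v)) = Rabs (u - t) * Cmod v.
    by rewrite E Cmod_mult Cmod_R.
  have a0 := Rabs_pos (u - t); have c0 := Cmod_ge_0 v.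
  have := Hdw (z + u * v)%C; rewrite Em => G.
  have {}G := G ltac:(move/Rlt_div_r: Hu => Hu; have := Hu v1; nra).
  have -> : (f (z + u * v) - f (z + t * v) - RtoC (u - t) * (l * v) =
    f (z + u * v) - f (z + t * v) - l * (z + u * v - (z + t * v)))%C.
    by rewrite E; ring.
  apply: Rle_trans G _.
  have -> : e / (Cmod v + 1) * (Rabs (u - t) * Cmod v) =
            e * Rabs (u - t) * (Cmod v / (Cmod v + 1)) by field; lra.
  rewrite -[X in _ <= X]Rmult_1_r; apply: Rmult_le_compat_l; first nra.
  by apply/Rle_div_l => //; lra.
have part (h : C -> R) (g : R -> R) (m : R) : (forall c, Rabs (h c) <= Cmod c) ->
    (forall u : R, h (f (z + u * v) - f (z + t * v) - RtoC (u - t) * (l * v))%C =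
               g u - g t - (u - t) * m) -> is_derive g t m.
  move=> Hh Hg; split; first exact: is_linear_scal_l.
  move=> x Hx; rewrite -(is_filter_lim_locally_unique _ _ Hx) => e.
  have [d [Hd Hdw]] := K e (cond_pos e).
  exists (mkposreal d Hd) => u Hu.
  change (Rabs (g u - g t - (u - t) * m) <= e * Rabs (u - t)).
  by rewrite -Hg; apply: Rle_trans (Hh _) _; apply: Hdw.
split.
- apply: (part Re); first exact: re_le_Cmod.
  by move=> u; rewrite /Re /Im /=; ring.
- apply: (part Im); first by move=> c; apply: Rle_trans (Rmax_r _ _) (Rmax_Cmod c).
  by move=> u; rewrite /Re /Im /=; ring.
Qed.

Lemma deriv_zero_const f a r z : (forall w, disc a r w -> has_deriv f w 0) ->
  disc a r z -> f z = f a.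
Proof.
move=> Hf Hz.
have G := CInt_FTC (fun u => f (a + u * (z - a))%C) (fun _ => RtoC 0) 0 1 ltac:(lra).
have {}G : CInt (fun _ => RtoC 0) 0 1 = (f (a + RtoC 1 * (z - a)) - f (a + RtoC 0 * (z - a)))%C.
  apply: G => [t Ht | t _]; last exact: cont_const.
  have -> : RtoC 0 = (0 * (z - a))%C by ring.
  apply/rderiv_line/Hf; rewrite /disc.
  have -> : (a + t * (z - a) - a = t * (z - a))%C by ring.
  rewrite Cmod_mult Cmod_R Rabs_pos_eq; last lra.
  rewrite /disc in Hz; have := Cmod_ge_0 (z - a); nra.
move: G; rewrite /CInt RInt_const scal_R_Cmult.
have -> : (a + 1 * (z - a) = z)%C by ring.
have -> : (a + 0 * (z - a) = a)%C by ring.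
by rewrite Cmult_0_r => E; apply/Ceq_minus.
Qed.

(** If [f'] vanished at [a], the difference quotients of [f] at points [b] near
    [a] would be small at [a] but not on a circle about [a], hence would have a
    zero; by injectivity this zero could only be [b] itself, so that [f'] would
    vanish identically near [a]. *)
Theorem conformal_deriv_neq (D : C -> Prop) f a :
  open (T := C_UniformSpace) D -> conformal_on D f -> D a -> C_derive f a <> 0.
Proof.
move=> oD Hf Da E0; have [an inj] := Hf.
have [r' [r0 HD]] := open_C_disc D a oD Da.
pose r := r' / 2.
have [m [m0 Hm]] := conformal_circle_min D f a r r' Hf ltac:(rewrite /r; lra) HD.
have rp : 0 < r by rewrite /r; lra.
have cq : cont (T := C_UniformSpace) (dquot f a) a.
  by apply: analytic_cont (analytic_dquot D f a oD an Da) Da.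
have cf : cont (T := C_UniformSpace) f a by apply: analytic_cont an Da.
have m4 : 0 < m / (4 * r) by apply: Rdiv_lt_0_compat; lra.
have [d1 [Hd1 K1]] := proj1 (cont_C_eps _ _) cq _ m4.
have [d2 [Hd2 K2]] := proj1 (cont_C_eps _ _) cf (m / 2) ltac:(lra).
pose d := Rmin r (Rmin d1 d2).
have d0 : 0 < d by do 2 (apply: Rmin_pos => //).
have flat b : disc a d b -> has_deriv f b 0.
  rewrite /disc => Hb.
  have Hb0 : Cmod (b - a) < r by apply: Rlt_le_trans Hb (Rmin_l _ _).
  have Hb1 : Cmod (b - a) < d1.
    by apply: Rlt_le_trans Hb _; apply: Rle_trans (Rmin_r _ _) (Rmin_l _ _).
  have Hb2 : Cmod (b - a) < d2.
    by apply: Rlt_le_trans Hb _; apply: Rle_trans (Rmin_r _ _) (Rmin_r _ _).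
  have Db : D b by apply: HD; rewrite /disc; rewrite /r in Hb0; lra.
  suff <- : C_derive f b = 0 by apply: analytic_deriv an Db.
  case: (classic (b = a)) => [-> // | Hba].
  have Hq := analytic_sub _ _ _ HD (analytic_dquot D f b oD an Db).
  have [z [Hz Ez]] : exists z, disc a r' z /\ dquot f b z = 0.
    apply: (exists_zero _ a r r' (m / (4 * r))) => //; first by rewrite /r; lra.
    - move=> t Ht.
      have Hcb : 0 < Cmod (circ a r t - b).
        by have := circ_far a r t b ltac:(lra); lra.
      have Hn : circ a r t <> b.
        by move=> Ec; move: Hcb; rewrite Ec Cmod_sub_self; lra.
      rewrite dquot_neq // Cmod_div; last exact: Cminus_eq_contra.
      have H1 := Hm t Ht; have H2 := K2 b Hb2.
      have H3 := Cmod_tri_sub (f (circ a r t) - f a) (f (circ a r t) - f b).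
      have E3 : (f (circ a r t) - f a - (f (circ a r t) - f b) = f b - f a)%C by ring.
      rewrite E3 in H3.
      have H4 := Cmod_tri_sub (circ a r t - b) (circ a r t - a).
      have E4 : (circ a r t - b - (circ a r t - a) = a - b)%C by ring.
      rewrite E4 (Cmod_sub_sym a) circ_dist in H4; last lra.
      have -> : m / (4 * r) = (m / 2) * / (2 * r) by field; lra.
      apply: Rmult_le_compat; try lra.
      + by apply/Rlt_le/Rinv_0_lt_compat; lra.
      + by apply: Rinv_le_contravar; lra.
    - have := K1 b Hb1; rewrite dquot_b E0 !dquot_neq //; last exact: not_eq_sym.
      have -> : ((f b - f a) / (b - a) - 0 = (f a - f b) / (a - b))%C.
        have := Cminus_eq_contra _ _ Hba.
        have := Cminus_eq_contra _ _ (not_eq_sym Hba).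
        by move=> ? ?; field.
      by [].
  case: (classic (z = b)) => [Ezb | Hzb]; first by rewrite -Ez Ezb dquot_b.
  case: Hzb; apply: inj => //; first exact: HD.
  by apply/Ceq_minus; rewrite dquot_spec Ez; ring.
have Hp : disc a d (a + RtoC (d / 2))%C.
  rewrite /disc; have -> : (a + RtoC (d / 2) - a = RtoC (d / 2))%C by ring.
  by rewrite Cmod_R Rabs_pos_eq; lra.
have Ec := deriv_zero_const f a d _ flat Hp.
have Dp : D (a + RtoC (d / 2))%C.
  apply: HD; rewrite /disc in Hp *; apply: Rlt_trans Hp _.
  have : d <= r by apply: Rmin_l.
  rewrite /r; lra.
have := inj _ _ Dp Da Ec => Ea.
have : RtoC (d / 2) = 0.
  have -> : RtoC (d / 2) = (a + RtoC (d / 2) - a)%C by ring.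
  by rewrite Ea; ring.
move/RtoC_inj; lra.
Qed.

Lemma has_deriv_quot_loc f z l (q : C -> C) d : 0 < d ->
  cont (T := C_UniformSpace) q z -> q z = l ->
  (forall w, Cmod (w - z) < d -> (f w - f z = q w * (w - z))%C) -> has_deriv f z l.
Proof.
move=> Hd Hq Hl H.
apply: (has_deriv_ext_loc (fun w => f z + q w * (w - z))%C).
  by exists d; split=> // w Hw; rewrite -H //; ring.
by exists q; split=> //; split=> // w; ring.
Qed.

Theorem conformal_inverse_cont (D : C -> Prop) f g a :
  open (T := C_UniformSpace) D -> conformal_on D f -> (forall z, D z -> g (f z) = z) ->
  D a -> cont (T := C_UniformSpace) g (f a).
Proof.
move=> oD Hf Hg Da; apply/cont_C_eps => e He.
have [r [r0 HD]] := open_C_disc D a oD Da.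
have [m [m0 Hm]] := conformal_open_map D f a (Rmin e r) Hf (Rmin_pos _ _ He r0)
  ltac:(by move=> z Hz; apply: HD; apply: Rlt_le_trans Hz (Rmin_r _ _)).
exists m; split=> // w /Hm [z [Hz <-]].
rewrite !Hg //; first by apply: Rlt_le_trans Hz (Rmin_l _ _).
by apply: HD; apply: Rlt_le_trans Hz (Rmin_r _ _).
Qed.

(** [w - f a = q (g w) * (g w - a)] with [q] the nonvanishing difference quotient
    of [f] at [a], and [g] is continuous by the open mapping property. *)
Theorem conformal_inverse_deriv (D : C -> Prop) f g a :
  open (T := C_UniformSpace) D -> conformal_on D f -> (forall z, D z -> g (f z) = z) ->
  D a -> has_deriv g (f a) (/ C_derive f a).
Proof.
move=> oD Hf Hg Da; have [an inj] := Hf.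
have [r [r0 HD]] := open_C_disc D a oD Da.
have [m [m0 Hm]] := conformal_open_map D f a r Hf r0 HD.
have nz : C_derive f a <> 0 by apply: conformal_deriv_neq Hf Da.
apply: (has_deriv_quot_loc _ _ _ (fun w => / dquot f a (g w))%C m) => //.
- apply: cont_inv; last by rewrite Hg // dquot_b.
  apply: cont_comp; first exact: conformal_inverse_cont Hf Hg Da.
  rewrite Hg //; exact: analytic_cont (analytic_dquot D f a oD an Da) Da.
- by rewrite Hg // dquot_b.
- move=> w /Hm [z [Hz <-]]; have Dz := HD z Hz.
  rewrite !Hg // dquot_spec.
  have nq : dquot f a z <> 0.
    case: (classic (z = a)) => [-> | Hza]; first by rewrite dquot_b.
    move=> Eq; apply: Hza; apply: inj => //.
    by apply/Ceq_minus; rewrite dquot_spec Eq; ring.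
  by field.
Qed.

Lemma conformal_image_open (D : C -> Prop) f :
  open (T := C_UniformSpace) D -> conformal_on D f -> open (T := C_UniformSpace) (image f D).
Proof.
move=> oD Hf w [z [Dz <-]].
have [r [r0 HD]] := open_C_disc D z oD Dz.
have [m [m0 Hm]] := conformal_open_map D f z r Hf r0 HD.
apply/locally_C_iff; exists m; split=> // v /Hm [u [Hu <-]].
by exists u; split=> //; apply: HD.
Qed.

(** * Automorphisms of the disk *)

Definition mob (a z : C) : C := ((z - a) / (1 - Cconj a * z))%C.

Lemma mob_den (a z : C) : Cmod a < 1 -> Cmod z <= 1 -> (1 - Cconj a * z)%C <> 0.
Proof.
move=> Ha Hz E; have {}E := proj2 (Ceq_minus _ _) E.
have {}E : 1 = Cmod (Cconj a * z) by rewrite -E Cmod_1.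
rewrite Cmod_mult Cmod_conj in E; have := Cmod_ge_0 z; have := Cmod_ge_0 a; nra.
Qed.

Lemma mob_identity (a z : C) : Cmod a < 1 -> Cmod z <= 1 ->
  (1 - Cmod (mob a z) ^ 2) * Cmod (1 - Cconj a * z) ^ 2 =
  (1 - Cmod a ^ 2) * (1 - Cmod z ^ 2).
Proof.
move=> Ha Hz; have Hn := mob_den a z Ha Hz.
have Hp : 0 < Cmod (1 - Cconj a * z) by apply/Cmod_gt_0.
rewrite /mob Cmod_div //.
have -> : (1 - (Cmod (z - a) / Cmod (1 - Cconj a * z)) ^ 2) * Cmod (1 - Cconj a * z) ^ 2 =
   Cmod (1 - Cconj a * z) ^ 2 - Cmod (z - a) ^ 2 by field; lra.
rewrite !Cmod2_alt /Re /Im /=; ring.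
Qed.

Lemma sq_le_1 x : 0 <= x -> x ^ 2 <= 1 -> x <= 1.
Proof. by move=> ? ?; nra. Qed.

Lemma sq_lt_1 x : 0 <= x -> x ^ 2 < 1 -> x < 1.
Proof. by move=> ? ?; nra. Qed.

Lemma mob_le (a z : C) : Cmod a < 1 -> Cmod z <= 1 -> Cmod (mob a z) <= 1.
Proof.
move=> Ha Hz; apply: sq_le_1; first exact: Cmod_ge_0.
have := mob_identity a z Ha Hz.
have Hp : 0 < Cmod (1 - Cconj a * z) by apply/Cmod_gt_0/mob_den.
have a0 := Cmod_ge_0 a; have z0 := Cmod_ge_0 z => E.
have : 0 <= (1 - Cmod a ^ 2) * (1 - Cmod z ^ 2) by apply: Rmult_le_pos; nra.
rewrite -E => H; apply: Rnot_lt_le => K; have : 0 < Cmod (1 - Cconj a * z) ^ 2 by nra.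
nra.
Qed.

Lemma mob_lt (a z : C) : Cmod a < 1 -> Cmod z < 1 -> Cmod (mob a z) < 1.
Proof.
move=> Ha Hz; apply: sq_lt_1; first exact: Cmod_ge_0.
have := mob_identity a z Ha ltac:(lra).
have Hp : 0 < Cmod (1 - Cconj a * z) by apply/Cmod_gt_0/mob_den; lra.
have a0 := Cmod_ge_0 a; have z0 := Cmod_ge_0 z => E.
have : 0 < (1 - Cmod a ^ 2) * (1 - Cmod z ^ 2) by apply: Rmult_lt_0_compat; nra.
rewrite -E => H; apply: Rnot_le_lt => K; have : 0 < Cmod (1 - Cconj a * z) ^ 2 by nra.
nra.
Qed.

Lemma mob_a a : mob a a = 0.
Proof. by rewrite /mob /Cdiv; ring. Qed.

Lemma mob_0 a : mob a 0 = (- a)%C.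
Proof.
have E : (1 - Cconj a * 0 = 1)%C by ring.
by rewrite /mob E; field; apply: C1_nz.
Qed.

Lemma has_deriv_mob (a z : C) : Cmod a < 1 -> Cmod z <= 1 ->
  has_deriv (mob a) z
    (RtoC (1 - Cmod a ^ 2) / ((1 - Cconj a * z) * (1 - Cconj a * z))).
Proof.
move=> Ha Hz; have Hn := mob_den a z Ha Hz.
have := has_deriv_div _ _ z _ _
  (has_deriv_minus _ _ _ _ _ (has_deriv_id z) (has_deriv_const a z))
  (has_deriv_minus _ _ _ _ _ (has_deriv_const 1 z)
     (has_deriv_mult _ _ _ _ _ (has_deriv_const (Cconj a) z) (has_deriv_id z))) Hn.
congr has_deriv; congr (_ / _)%C.
rewrite RtoC_minus Cmod2_conj; ring.
Qed.

Lemma mob_inv (a z : C) : Cmod a < 1 -> Cmod z < 1 -> mob (- a) (mob a z) = z.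
Proof.
move=> Ha Hz; have Hn := mob_den a z Ha ltac:(lra).
have K : (1 - Cconj a * a)%C <> 0 by apply: mob_den; lra.
have E : (1 - Cconj (- a) * mob a z = (1 - Cconj a * a) / (1 - Cconj a * z))%C.
  by rewrite /mob Copp_conj; field.
rewrite {1}/mob E /mob; field; split=> //.
Qed.

Lemma mob_opp_a a : mob (- a) 0 = a.
Proof. by rewrite mob_0; ring. Qed.

Lemma analytic_mob a : Cmod a < 1 -> analytic_on unit_disk (mob a).
Proof.
move=> Ha; apply: analytic_intro => z Hz; eexists; apply: has_deriv_mob => //.
by rewrite /unit_disk in Hz; lra.
Qed.

(** * Square roots on simply connected regions *)

(** Principal square root, on the right half-plane. *)
Definition csq (w : C) : C :=
  (sqrt ((Cmod w + Re w) / 2), Im w / (2 * sqrt ((Cmod w + Re w) / 2))).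

Lemma csq_pos w : 0 < Re w -> 0 < (Cmod w + Re w) / 2.
Proof. have := Cmod_ge_0 w; lra. Qed.

Lemma csq_sq w : 0 < Re w -> (csq w * csq w = w)%C.
Proof.
move=> Hw; have Hp := csq_pos w Hw; have E2 := Cmod2_alt w; rewrite /csq.
move: Hw Hp E2; case: w => x y; rewrite /Re /Im /fst /snd => Hx.
set m := Cmod (x, y); set r := (m + x) / 2 => Hp E2.
have s0 : 0 < sqrt r by apply: sqrt_lt_R0.
have ss : sqrt r * sqrt r = r by apply: sqrt_sqrt; lra.
rewrite /Cmult /=; congr pair.
- have -> : sqrt r * sqrt r - y / (2 * sqrt r) * (y / (2 * sqrt r)) =
            sqrt r * sqrt r - y ^ 2 / (4 * (sqrt r * sqrt r)) by field; lra.
  rewrite ss; have -> : y ^ 2 = m ^ 2 - x ^ 2 by lra.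
  have -> : m = 2 * r - x by rewrite /r; field.
  by field; lra.
- field; lra.
Qed.

Lemma csq_cont w : 0 < Re w -> cont (T := C_UniformSpace) csq w.
Proof.
move=> Hw; have Hp := csq_pos w Hw; apply/cont_parts.
have [cr ci] := proj1 (cont_parts _ _) (cont_id w).
have cm : continuous (fun v : C_UniformSpace => sqrt ((Cmod v + Re v) / 2)) w.
  apply: (continuous_comp (fun v : C_UniformSpace => (Cmod v + Re v) / 2) sqrt).
    apply: (continuous_mult (fun v : C_UniformSpace => Cmod v + Re v) (fun _ => / 2)).
    - exact: (continuous_plus _ _ _ (cont_Cmod _ _ (cont_id w)) cr).
    - exact: continuous_const.
  exact: continuous_sqrt.
split; first exact: cm.
apply: (continuous_mult (fun v : C_UniformSpace => Im v)
   (fun v : C_UniformSpace => / (2 * sqrt ((Cmod v + Re v) / 2)))) => //.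
apply: (continuous_comp (fun v : C_UniformSpace => 2 * sqrt ((Cmod v + Re v) / 2)) Rinv).
- apply: (continuous_mult (fun _ : C_UniformSpace => 2)); [exact: continuous_const | exact: cm].
- apply: continuous_Rinv; have := sqrt_lt_R0 _ Hp; lra.
Qed.

Lemma csq_1 : csq 1 = 1.
Proof.
rewrite /csq Cmod_1 /Re /Im /=; have -> : (1 + 1) / 2 = 1 by field.
rewrite sqrt_1; congr pair; field.
Qed.

Lemma ratio_Re_pos (x y : C) : Cmod (y - x) < Cmod x -> 0 < Re (y / x).
Proof.
move=> H; have x0 : 0 < Cmod x by have := Cmod_ge_0 (y - x); lra.
have xn : x <> 0 by apply/Cmod_gt_0.
have E : (y / x = 1 + (y - x) / x)%C by field.
have B : Cmod ((y - x) / x) < 1.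
  by rewrite Cmod_div //; apply/Rlt_div_l => //; lra.
rewrite E; have := re_le_Cmod ((y - x) / x).
move=> G; have := Rabs_def2 _ _ (Rle_lt_trans _ _ _ G B).
rewrite /Re /=; lra.
Qed.

Definition clamp (t : R) : R := Rmax 0 (Rmin 1 t).

Lemma clamp_in t : 0 <= clamp t <= 1.
Proof. rewrite /clamp; split; [exact: Rmax_l | apply: Rmax_lub; [lra | exact: Rmin_l]]. Qed.

Lemma clamp_id t : 0 <= t <= 1 -> clamp t = t.
Proof. by move=> Ht; rewrite /clamp Rmin_right ?Rmax_right; lra. Qed.

Lemma clamp_low t : t <= 0 -> clamp t = 0.
Proof. by move=> Ht; rewrite /clamp Rmin_right ?Rmax_left; lra. Qed.

Lemma clamp_high t : 1 <= t -> clamp t = 1.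
Proof. by move=> Ht; rewrite /clamp Rmin_left ?Rmax_right; lra. Qed.

Lemma clamp_lip t u : Rabs (clamp t - clamp u) <= Rabs (t - u).
Proof.
have clamp_cases x : (x <= 0 /\ clamp x = 0) \/ (0 <= x <= 1 /\ clamp x = x) \/
    (1 <= x /\ clamp x = 1).
  case: (Rle_dec x 0) => H; first by left; rewrite clamp_low.
  case: (Rle_dec 1 x) => H'; first by right; right; rewrite clamp_high.
  by right; left; rewrite clamp_id; lra.
case: (clamp_cases t) => [[? ->] | [[? ->] | [? ->]]];
case: (clamp_cases u) => [[? ->] | [[? ->] | [? ->]]];
  rewrite /Rabs; repeat case: Rcase_abs => ?; lra.
Qed.

Lemma clamp_cont t : continuous clamp t.
Proof.
move=> P [e He]; exists e => u Hu; apply: He.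
rewrite /ball /= /AbsRing_ball /= /abs /minus /plus /opp /= in Hu *.
exact: Rle_lt_trans (clamp_lip _ _) Hu.
Qed.

(** Turns paths and homotopies, which are given on the unit interval and the unit
    square only, into maps continuous everywhere. *)
Lemma cont_on_retract {T : UniformSpace} (D : T -> Prop) (g : T -> C) (c : T -> T) x :
  continuous_on (U := C_UniformSpace) D g -> (forall y, D (c y)) -> continuous c x ->
  cont (fun y => g (c y)) x.
Proof.
move=> Hg Hc cc P HP.
have [e He] := Hg (c x) (Hc x) P HP.
have K : locally x (fun y => ball (c x) e (c y)) := cc _ (locally_ball (c x) e).
rewrite /filtermap; apply: filter_imp K => y Hy; exact: He.
Qed.

(** A relative difference below one puts the ratio of two values into the right
    half-plane, where the principal square root is continuous. *)
Lemma relative_uniform_continuity (F : R * R -> C) :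
  (forall p, cont F p) -> (forall p, F p <> 0) ->
  exists d, 0 < d /\ forall x y u v, 0 <= x <= 1 -> 0 <= y <= 1 ->
    Rabs (u - x) < d -> Rabs (v - y) < d -> Cmod (F (u, v) - F (x, y)) < Cmod (F (x, y)).
Proof.
move=> cF nF.
have loc x y : exists d : posreal, forall u v, Rabs (u - x) < 2 * d -> Rabs (v - y) < 2 * d ->
    Cmod (F (u, v) - F (x, y)) < Cmod (F (x, y)) / 4.
  have p0 : 0 < Cmod (F (x, y)) / 4.
    have : 0 < Cmod (F (x, y)) by apply/Cmod_gt_0/nF.
    lra.
  have [d Hd] := proj1 (cont_eps _ _) (cF (x, y)) _ p0.
  have d2 : 0 < d / 2 by have := cond_pos d; lra.
  exists (mkposreal _ d2) => u v /= Hu Hv; apply: Hd; split=> /=;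
    rewrite /ball /= /AbsRing_ball /= /abs /minus /plus /opp /=.
  - by apply: Rlt_le_trans Hu _; lra.
  - by apply: Rlt_le_trans Hv _; lra.
pose delta x y := proj1_sig (constructive_indefinite_description _ (loc x y)).
have Hdelta x y := proj2_sig (constructive_indefinite_description _ (loc x y)).
have [d Hd] := compactness_value_2d 0 1 0 1 delta.
exists d; split; first exact: cond_pos.
move=> x y u v Hx Hy Hu Hv; apply: NNPP => bad.
apply: (Hd x y Hx Hy) => -[i [j [Hi [Hj [H1 [H2 H3]]]]]]; apply: bad.
have dp := cond_pos (delta i j).
have K1 := Hdelta i j x y; rewrite -/(delta i j) in K1.
have {}K1 := K1 ltac:(lra) ltac:(lra).
have K2 := Hdelta i j u v; rewrite -/(delta i j) in K2.
have {}K2 := K2 ltac:(have := Rabs_triang (u - x) (x - i);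
   replace (u - x + (x - i)) with (u - i) by ring; lra)
  ltac:(have := Rabs_triang (v - y) (y - j);
   replace (v - y + (y - j)) with (v - j) by ring; lra).
have E : (F (u, v) - F (x, y) = (F (u, v) - F (i, j)) - (F (x, y) - F (i, j)))%C by ring.
have := Cmod_minus_le (F (u, v) - F (i, j)) (F (x, y) - F (i, j)); rewrite E.
have := Cmod_tri_sub (F (i, j)) (F (x, y)); rewrite (Cmod_sub_sym (F (i, j))).
have := Cmod_ge_0 (F (i, j)); lra.
Qed.

(** Along the segment from the origin to a point of the square, the value of [G] is
    that at the origin times finitely many ratios close to one; their principal
    square roots depend continuously on the point. *)
Lemma square_sqrt (G : R * R -> C) :
  (forall p, cont G p) -> (forall p, G p <> 0) -> (exists c, (c * c = G (0, 0)%R)%C) ->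
  exists S : R * R -> C,
    (forall p, unit_square p -> cont S p) /\
    (forall p, unit_square p -> (S p * S p = G p)%C).
Proof.
move=> cG nG [c0 Hc0].
have [d [Hd Hclose]] := relative_uniform_continuity G cG nG.
have [N HN] := nfloor_ex (/ d) (Rlt_le _ _ (Rinv_0_lt_compat _ Hd)).
pose n := S N.
have n0 : 0 < INR n by apply: lt_0_INR; rewrite /n; lia.
have nd : / INR n < d.
  rewrite -(Rinv_inv d); apply: Rinv_lt_contravar.
    by apply: Rmult_lt_0_compat => //; apply: Rinv_0_lt_compat.
  by rewrite /n S_INR; lra.
pose scale (k : nat) (p : R * R) := (INR k / INR n * fst p, INR k / INR n * snd p).
pose ratio k p := (G (scale (S k) p) / G (scale k p))%C.
have c_scale k p : cont (fun p => G (scale k p)) p.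
  apply: (continuous_comp (scale k) G); last exact: cG.
  apply: (continuous_comp_2 (fun p : R * R => INR k / INR n * fst p)
     (fun p : R * R => INR k / INR n * snd p) (fun a b => (a, b))).
  - by apply: (continuous_mult (fun _ : R * R => INR k / INR n) (fst : R * R -> R));
      [apply: continuous_const | case: p => a b; apply: continuous_fst].
  - by apply: (continuous_mult (fun _ : R * R => INR k / INR n) (snd : R * R -> R));
      [apply: continuous_const | case: p => a b; apply: continuous_snd].
  - by apply: (continuous_ext (fun q : R * R => q)); [case | apply: continuous_id].
have Re_ratio k p : (k < n)%nat -> unit_square p -> 0 < Re (ratio k p).
  move=> Hk [[x0 x1] [y0 y1]]; apply: ratio_Re_pos.
  have kn : 0 <= INR k / INR n <= 1.
    split; first by apply: Rmult_le_pos; [apply: pos_INR | apply/Rlt_le/Rinv_0_lt_compat].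
    by apply/Rle_div_l => //; rewrite Rmult_1_l; apply/le_INR; lia.
  have Es : INR (S k) / INR n = INR k / INR n + / INR n by rewrite S_INR; field; lra.
  have i0 := Rinv_0_lt_compat _ n0.
  apply: Hclose; try by split; nra.
  - rewrite Es; have -> : (INR k / INR n + / INR n) * fst p - INR k / INR n * fst p =
      / INR n * fst p by ring.
    by rewrite Rabs_pos_eq; nra.
  - rewrite Es; have -> : (INR k / INR n + / INR n) * snd p - INR k / INR n * snd p =
      / INR n * snd p by ring.
    by rewrite Rabs_pos_eq; nra.
pose root := fix root k p : C :=
  match k with O => c0 | S j => (root j p * csq (ratio j p))%C end.
have root_spec k : (k <= n)%nat -> forall p, unit_square p ->
    cont (root k) p /\ (root k p * root k p = G (scale k p))%C.
  elim: k => [|k IH] Hk p Hp /=.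
    split; first exact: cont_const.
    by rewrite Hc0 /scale /= Rdiv_0_l !Rmult_0_l.
  have [IH1 IH2] := IH ltac:(lia) p Hp.
  have Hr := Re_ratio k p ltac:(lia) Hp.
  split.
  - apply: cont_mult => //; apply: cont_comp; last exact: csq_cont.
    by apply: cont_div; [apply: c_scale | apply: c_scale | apply: nG].
  - have -> : (root k p * csq (ratio k p) * (root k p * csq (ratio k p)) =
       (root k p * root k p) * (csq (ratio k p) * csq (ratio k p)))%C by ring.
    rewrite IH2 csq_sq // /ratio; field; exact: nG.
exists (root n); split=> p Hp; have [H1 H2] := root_spec n (le_n _) p Hp => //.
by rewrite H2 /scale /Rdiv Rinv_r ?Rmult_1_l; [case: (p) | lra].
Qed.

(** The ratio [p / q] is continuous with values in [{1, -1}]. *)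
Lemma path_sqrt_ratio (p q : R -> C) :
  (forall t, 0 <= t <= 1 -> cont (T := R_UniformSpace) p t) ->
  (forall t, 0 <= t <= 1 -> cont (T := R_UniformSpace) q t) ->
  (forall t, 0 <= t <= 1 -> (p t * p t = q t * q t)%C) ->
  (forall t, 0 <= t <= 1 -> q t <> 0) ->
  (p 0 * q 1 = p 1 * q 0)%C.
Proof.
move=> cp cq E nq.
pose h t := Re (p (clamp t) / q (clamp t)).
have sgn t : 0 <= t <= 1 -> (p t = q t \/ p t = - q t)%C.
  move=> Ht; have := E t Ht => /(proj1 (Ceq_minus _ _)).
  have -> : (p t * p t - q t * q t = (p t - q t) * (p t + q t))%C by ring.
  move=> Z; case: (classic (p t - q t = 0)%C) => [/Cminus_0_eq|N]; first by left.
  right; case: (classic (p t + q t = 0)%C) => [Z2 | N2].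
    by apply/Ceq_minus; rewrite -Z2; ring.
  by case: (Cmult_neq_0 _ _ N N2).
have hv t : 0 <= t <= 1 -> (p t = q t /\ h t = 1) \/ (p t = (- q t)%C /\ h t = -1).
  move=> Ht; rewrite /h clamp_id //; have nz := nq t Ht; case: (sgn t Ht) => ->; [left | right].
  - by split=> //; rewrite /Cdiv Cinv_r.
  - split=> //; have -> : (- q t / q t = - (1))%C by field.
    by rewrite /Re /=; lra.
have ch : continuity h.
  move=> t; apply/continuity_pt_filterlim.
  suff : cont (T := R_UniformSpace) (fun t => p (clamp t) / q (clamp t))%C t.
    by move/cont_parts => [].
  have cc := clamp_cont t; have Hc := clamp_in t.
  apply: cont_div; last exact: nq.
  - exact: (continuous_comp clamp p t cc (cp _ Hc)).
  - exact: (continuous_comp clamp q t cc (cq _ Hc)).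
have no0 : ~ (Rmin (h 0) (h 1) <= 0 <= Rmax (h 0) (h 1)).
  move/(IVT_gen h 0 1 0 ch) => [t [Ht Z]].
  rewrite Rmin_left ?Rmax_right in Ht; try lra.
  case: (hv t Ht) => -[_]; lra.
case: (hv 0 ltac:(lra)) => -[E0 H0]; case: (hv 1 ltac:(lra)) => -[E1 H1].
- by rewrite E0 E1; ring.
- by case: no0; rewrite H0 H1 /Rmin /Rmax; repeat case: Rle_dec => ?; lra.
- by case: no0; rewrite H0 H1 /Rmin /Rmax; repeat case: Rle_dec => ?; lra.
- by rewrite E0 E1; ring.
Qed.

Section SquareRoot.

Variables (D : C -> Prop) (f : C -> C) (z0 w0 : C).
Hypothesis D_open : open (T := C_UniformSpace) D.
Hypothesis D_conn : connected D.
Hypothesis D_sc : forall gamma : R -> C, closed_curve_in D gamma -> null_homotopic_in D gamma.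
Hypothesis f_cont : forall z, D z -> cont (T := C_UniformSpace) f z.
Hypothesis f_neq : forall z, D z -> f z <> 0.
Hypothesis Dz0 : D z0.
Hypothesis Hw0 : (w0 * w0 = f z0)%C.

(** [w] is the value at [z] of the square root of [f] continued along some path
    from [z0], starting with the value [w0]. *)
Definition continued_sqrt (z w : C) : Prop :=
  exists gam sig : R -> C,
    (forall t, cont (T := R_UniformSpace) gam t) /\
    (forall t, cont (T := R_UniformSpace) sig t) /\
    (forall t, D (gam t)) /\ (forall t, (sig t * sig t = f (gam t))%C) /\
    gam 0 = z0 /\ sig 0 = w0 /\ gam 1 = z /\ sig 1 = w.

Lemma cont_clamp_aff (g : R -> C) (a b t : R) :
  (forall t, cont (T := R_UniformSpace) g t) ->
  cont (T := R_UniformSpace) (fun t => g (clamp (a * t + b))) t.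
Proof.
move=> Hg; apply: (continuous_comp (fun t => clamp (a * t + b)) g); last exact: Hg.
apply: (continuous_comp (fun t => a * t + b) clamp); last exact: clamp_cont.
apply: (continuous_plus (fun t => a * t) (fun _ => b)); last exact: continuous_const.
by apply: (continuous_mult (fun _ => a) (fun t => t)); [apply: continuous_const | apply: continuous_id].
Qed.

(** Either the first half of a concatenated path has been traversed, or the
    second has not begun. *)
Lemma clamp_halves t : clamp (2 * t + 0) = 1 \/ clamp (2 * t + -1) = 0.
Proof. case: (Rle_dec (1 / 2) t) => H; [left; apply: clamp_high | right; apply: clamp_low]; lra. Qed.

Lemma continued_sqrt_disc z w v r : continued_sqrt z w ->
  (forall u, disc z r u -> D u /\ Cmod (f u - f z) < Cmod (f z)) -> disc z r v ->
  continued_sqrt v (w * csq (f v / f z)).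
Proof.
move=> [gam [sig [cg [cs [Dg [Hs [g0 [s0 [g1 s1]]]]]]]]] Hr Hv.
have r0 := disc_pos _ _ _ Hv.
have Dz : D z by case: (Hr z (disc_center z r r0)).
pose seg (u : R) := (z + u * (v - z))%C.
have Hseg u : disc z r (seg (clamp u)).
  rewrite /disc /seg; have -> : (z + clamp u * (v - z) - z = clamp u * (v - z))%C by ring.
  rewrite Cmod_mult Cmod_R Rabs_pos_eq; last by case: (clamp_in u).
  rewrite /disc in Hv; have := clamp_in u; have := Cmod_ge_0 (v - z); nra.
have c_seg t : cont (T := R_UniformSpace) seg t.
  apply: cont_plus; first exact: cont_const.
  by apply: cont_mult; [apply/rderiv_cont/rderiv_RtoC | apply: cont_const].
pose lift (u : R) := csq (f (seg (clamp u)) / f z).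
have Hre u : 0 < Re (f (seg (clamp u)) / f z).
  by apply: ratio_Re_pos; case: (Hr _ (Hseg u)).
have c_lift t : cont (T := R_UniformSpace) lift t.
  apply: cont_comp; last exact: csq_cont.
  apply: cont_div; last exact: f_neq; last exact: cont_const.
  apply: cont_comp; last by apply: f_cont; case: (Hr _ (Hseg t)).
  exact: (continuous_comp clamp seg t (clamp_cont t) (c_seg _)).
have cc u : clamp (clamp u) = clamp u by apply/clamp_id/clamp_in.
have lift0 : lift 0 = 1.
  rewrite /lift clamp_low; last lra.
  have -> : seg 0 = z by rewrite /seg; ring.
  rewrite /Cdiv Cinv_r; [exact: csq_1 | exact: f_neq].
exists (fun t => gam (clamp (2 * t + 0)) + (seg (clamp (2 * t + -1)) - z))%C,
       (fun t => sig (clamp (2 * t + 0)) * lift (clamp (2 * t + -1)))%C.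
have c1 : clamp (2 * 1 + 0) = 1 by apply: clamp_high; lra.
have c2 : clamp (2 * 1 + -1) = 1 by apply: clamp_high; lra.
have c3 : clamp (2 * 0 + 0) = 0 by apply: clamp_low; lra.
have c4 : clamp (2 * 0 + -1) = 0 by apply: clamp_low; lra.
have seg0 : seg 0 = z by rewrite /seg; ring.
have seg1 : seg 1 = v by rewrite /seg; ring.
split; [|split; [|split; [|split; [|split; [|split; [|split]]]]]].
- move=> t; apply: cont_plus; first exact: cont_clamp_aff.
  by apply: cont_minus; [apply: cont_clamp_aff | apply: cont_const].
- by move=> t; apply: cont_mult; apply: cont_clamp_aff.
- move=> t; case: (clamp_halves t) => ->.
  + rewrite g1; have -> : (z + (seg (clamp (2 * t + -1)) - z) = seg (clamp (2 * t + -1)))%C by ring.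
    by case: (Hr _ (Hseg (2 * t + -1))).
  + rewrite seg0; have -> : (gam (clamp (2 * t + 0)) + (z - z) = gam (clamp (2 * t + 0)))%C by ring.
    exact: Dg.
- move=> t; set x := clamp (2 * t + 0); set y := clamp (2 * t + -1).
  have -> : (sig x * lift y * (sig x * lift y) = (sig x * sig x) * (lift y * lift y))%C by ring.
  rewrite Hs; case: (clamp_halves t) => E; rewrite -/x -/y in E.
  + rewrite E g1 csq_sq; last exact: Hre.
    rewrite cc -/y; have -> : (z + (seg y - z) = seg y)%C by ring.
    field; exact: f_neq.
  + by rewrite E seg0 lift0 !Cmult_1_r; congr f; ring.
- by rewrite c3 c4 seg0 g0; ring.
- by rewrite c3 c4 s0 lift0; ring.
- by rewrite c1 c2 g1 seg1; ring.
- by rewrite c1 c2 s1 /lift (clamp_id 1) ?seg1 //; lra.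
Qed.

Lemma continued_sqrt_sq z w : continued_sqrt z w -> (w * w = f z)%C.
Proof. by move=> [gam [sig [_ [_ [_ [H [_ [_ [<- <-]]]]]]]]]. Qed.

Lemma continued_sqrt_disc_ex z : D z -> exists r, 0 < r /\
  forall u, disc z r u -> D u /\ Cmod (f u - f z) < Cmod (f z) / 4.
Proof.
move=> Dz; have [r1 [r10 H1]] := open_C_disc D z D_open Dz.
have p0 : 0 < Cmod (f z) / 4.
  have : 0 < Cmod (f z) by apply/Cmod_gt_0/f_neq.
  lra.
have [r2 [r20 H2]] := proj1 (cont_C_eps _ _) (f_cont z Dz) _ p0.
exists (Rmin r1 r2); split; first exact: Rmin_pos.
move=> u Hu; split.
- by apply: H1; apply: Rlt_le_trans Hu (Rmin_l _ _).
- by apply: H2; apply: Rlt_le_trans Hu (Rmin_r _ _).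
Qed.

Lemma continued_sqrt_ex z : D z -> exists w, continued_sqrt z w.
Proof.
move=> Dz; apply: NNPP => none.
have close u v r : (forall x, disc u r x -> D x /\ Cmod (f x - f u) < Cmod (f u) / 4) ->
    disc u (r / 2) v -> (exists w, continued_sqrt v w) -> exists w, continued_sqrt u w.
  move=> Hr Hv [w Hw]; have r0 := disc_pos _ _ _ Hv.
  exists (w * csq (f u / f v))%C; apply: (continued_sqrt_disc v w u (r / 2)) => //.
  - move=> x Hx; have Hx' : disc u r x.
      have := Cmod_triangle (x - v) (v - u); rewrite /disc in Hv Hx *.
      have -> : (x - v + (v - u) = x - u)%C by ring.
      lra.
    have [Dx Fx] := Hr x Hx'; split=> //.
    have [_ Fv] := Hr v ltac:(rewrite /disc in Hv *; lra).
    have -> : (f x - f v = (f x - f u) - (f v - f u))%C by ring.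
    have := Cmod_minus_le (f x - f u) (f v - f u).
    have := Cmod_tri_sub (f u) (f v); rewrite (Cmod_sub_sym (f u)).
    have := Cmod_ge_0 (f v - f u); lra.
  - by rewrite /disc Cmod_sub_sym.
have [u [Du [Uu Vu]]] : exists u, D u /\ (D u /\ exists w, continued_sqrt u w) /\
    (D u /\ ~ exists w, continued_sqrt u w).
  apply: D_conn.
  - move=> u [Du [w Hw]]; have [r [r0 Hr]] := continued_sqrt_disc_ex u Du.
    apply/locally_C_iff; exists r; split=> // v Hv; split; first by case: (Hr v Hv).
    exists (w * csq (f v / f u))%C; apply: (continued_sqrt_disc u w v r) => // x Hx.
    have [Dx Fx] := Hr x Hx; split=> //.
    have := Cmod_ge_0 (f x - f u); lra.
  - move=> u [Du Nu]; have [r [r0 Hr]] := continued_sqrt_disc_ex u Du.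
    apply/locally_C_iff; exists (r / 2); split; first lra.
    move=> v Hv; split.
      by case: (Hr v) => //; rewrite /disc in Hv *; lra.
    by move=> Hw; apply: Nu; apply: (close u v r).
  - move=> u Du; case: (classic (exists w, continued_sqrt u w)); [by left | by right].
  - exists z0; split=> //; split=> //; exists w0.
    exists (fun _ => z0), (fun _ => w0).
    by do 2 (split; first by move=> t; apply: cont_const).
  - by exists z.
by case: Vu => _; apply; case: Uu.
Qed.

(** Two continuations ending at the same point form a loop. The square root along
    a null homotopy of this loop takes equal values at both ends of the loop. *)
Lemma continued_sqrt_uniq z w1 w2 :
  continued_sqrt z w1 -> continued_sqrt z w2 -> w1 = w2.
Proof.
move=> H1 H2; have E1 := continued_sqrt_sq z w1 H1; have E2 := continued_sqrt_sq z w2 H2.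
case: H1 => [ga1 [si1 [cg1 [cs1 [Dg1 [Hs1 [g10 [s10 [g11 s11]]]]]]]]].
case: H2 => [ga2 [si2 [cg2 [cs2 [Dg2 [Hs2 [g20 [s20 [g21 s21]]]]]]]]].
have Dz : D z by rewrite -g11; apply: Dg1.
have w2n : w2 <> 0 by move=> E; apply: (f_neq z Dz); rewrite -E2 E; ring.
have w0n : w0 <> 0 by move=> E; apply: (f_neq z0 Dz0); rewrite -Hw0 E; ring.
pose back t := clamp (-2 * t + 2).
have back_halves t : clamp (2 * t + 0) = 1 \/ back t = 1.
  by case: (Rle_dec (1 / 2) t) => H; [left | right]; apply: clamp_high; lra.
pose gam t := (ga1 (clamp (2 * t + 0)) + (ga2 (back t) - z))%C.
pose sig t := (si1 (clamp (2 * t + 0)) * (si2 (back t) / w2))%C.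
have cgam t : cont (T := R_UniformSpace) gam t.
  apply: cont_plus; first exact: cont_clamp_aff.
  by apply: cont_minus; [apply: cont_clamp_aff | apply: cont_const].
have csig t : cont (T := R_UniformSpace) sig t.
  apply: cont_mult; first exact: cont_clamp_aff.
  by apply: cont_div => //; [apply: cont_clamp_aff | apply: cont_const].
have Dgam t : D (gam t).
  rewrite /gam; case: (back_halves t) => ->.
  + have -> : (ga1 1 + (ga2 (back t) - z) = ga2 (back t))%C by rewrite g11; ring.
    exact: Dg2.
  + have -> : (ga1 (clamp (2 * t + 0)) + (ga2 1 - z) = ga1 (clamp (2 * t + 0)))%C.
      by rewrite g21; ring.
    exact: Dg1.
have sq_sig t : (sig t * sig t = f (gam t))%C.
  rewrite /sig /gam; set x := clamp (2 * t + 0).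
  have -> : (si1 x * (si2 (back t) / w2) * (si1 x * (si2 (back t) / w2)) =
     (si1 x * si1 x) * (si2 (back t) * si2 (back t)) / (w2 * w2))%C by field.
  rewrite Hs1 Hs2 E2; case: (back_halves t) => E; rewrite -/x in E; rewrite E.
  + rewrite g11; have -> : (z + (ga2 (back t) - z) = ga2 (back t))%C by ring.
    field; exact: f_neq.
  + rewrite g21; have -> : (ga1 x + (z - z) = ga1 x)%C by ring.
    field; exact: f_neq.
have b0 : back 0 = 1 by apply: clamp_high; lra.
have b1 : back 1 = 0 by apply: clamp_low; lra.
have c1 : clamp (2 * 1 + 0) = 1 by apply: clamp_high; lra.
have c0 : clamp (2 * 0 + 0) = 0 by apply: clamp_low; lra.
have gam0 : gam 0 = z0 by rewrite /gam c0 b0 g10 g21; ring.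
have gam1 : gam 1 = z0 by rewrite /gam c1 b1 g11 g20; ring.
have sig0 : sig 0 = w0 by rewrite /sig c0 b0 s10 s21; field.
have sig1 : sig 1 = (w1 * w0 / w2)%C by rewrite /sig c1 b1 s11 s20; field.
have closed : closed_curve_in D gam.
  split; last by split=> //; rewrite gam0 gam1.
  by apply: continuous_on_forall => t _; apply: cgam.
have [H [cH [DH [H0 [H1 Hb]]]]] := D_sc gam closed.
pose c2 (p : R * R) := (clamp (fst p), clamp (snd p)).
have c2_in p : unit_square (c2 p) by split; apply: clamp_in.
have c2_cont p : continuous c2 p.
  apply: (continuous_comp_2 (fun p : R * R => clamp (fst p))
     (fun p : R * R => clamp (snd p)) (fun a b => (a, b))).
  - apply: (continuous_comp fst clamp); last exact: clamp_cont.
    by case: p => a b; apply: continuous_fst.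
  - apply: (continuous_comp snd clamp); last exact: clamp_cont.
    by case: p => a b; apply: continuous_snd.
  - by apply: (continuous_ext (fun q : R * R => q)); [case | apply: continuous_id].
have c2_id p : unit_square p -> c2 p = p.
  by case: p => a b [/= Ha Hb']; rewrite /c2 /= !clamp_id.
have u0 : unit_interval 0 by split; lra.
have u1 : unit_interval 1 by split; lra.
pose G p := f (H (c2 p)).
have [S [cS HS]] : exists S : R * R -> C,
    (forall p, unit_square p -> cont S p) /\
    (forall p, unit_square p -> (S p * S p = G p)%C).
  apply: square_sqrt.
  - move=> p; apply: cont_comp; last by apply: f_cont; apply: DH.
    exact: (cont_on_retract unit_square H c2 p cH c2_in (c2_cont p)).
  - by move=> p; apply: f_neq; apply: DH.
  - exists w0; rewrite /G c2_id; last by split.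
    by rewrite H0 // gam0.
have {}HS p : unit_square p -> (S p * S p = f (H p))%C.
  by move=> Hp; rewrite HS // /G c2_id.
have cont_s t s : unit_interval t -> unit_interval s ->
    cont (T := R_UniformSpace) (fun s => S (s, t)) s.
  move=> Ht Hs; apply: (continuous_comp_2 (fun s : R => s) (fun _ : R => t) (fun a b => S (a, b))).
  - exact: continuous_id.
  - exact: continuous_const.
  - apply: (continuous_ext S); first by case.
    by apply: cS; split.
have cont_t s t : unit_interval s -> unit_interval t ->
    cont (T := R_UniformSpace) (fun t => S (s, t)) t.
  move=> Hs Ht; apply: (continuous_comp_2 (fun _ : R => s) (fun t : R => t) (fun a b => S (a, b))).
  - exact: continuous_const.
  - exact: continuous_id.
  - apply: (continuous_ext S); first by case.
    by apply: cS; split.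
have flat (p : R -> C) : (forall t, unit_interval t -> cont (T := R_UniformSpace) p t) ->
    (forall t, unit_interval t -> (p t * p t = f z0)%C) -> p 0 = p 1.
  move=> cp Hp.
  have := path_sqrt_ratio p (fun _ => w0) cp (fun t _ => cont_const _ _)
    ltac:(by move=> t Ht; rewrite Hp) ltac:(by move=> t _).
  by rewrite !(Cmult_comm _ w0); apply: Cmult_cancel_l.
have A1 : S (0, 0) = S (1, 0).
  apply: (flat (fun s => S (s, 0))) => s Hs; first exact: cont_s.
  by rewrite HS; [case: (Hb s Hs) => -> _; rewrite gam0 | split].
have A2 : S (1, 0) = S (1, 1).
  apply: (flat (fun t => S (1, t))) => t Ht; first exact: cont_t.
  by rewrite HS; [rewrite H1 // gam0 | split].
have A3 : S (0, 1) = S (1, 1).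
  apply: (flat (fun s => S (s, 1))) => s Hs; first exact: cont_s.
  by rewrite HS; [case: (Hb s Hs) => _ ->; rewrite gam0 | split].
have K := path_sqrt_ratio (fun t => S (0, t)) sig
  ltac:(by move=> t Ht; apply: cont_t) ltac:(by move=> t _; apply: csig)
  ltac:(by move=> t Ht; rewrite HS; [rewrite H0 // sq_sig | split])
  ltac:(by move=> t _ E; apply: (f_neq (gam t) (Dgam t)); rewrite -sq_sig E; ring).
rewrite /= A3 -A2 -A1 sig0 sig1 in K.
have Sn : S (0, 0) <> 0.
  move=> E; apply: (f_neq z0 Dz0); rewrite -gam0 -H0 // -HS; last by split.
  by rewrite E; ring.
have {}K := Cmult_cancel_l _ _ _ Sn K.
apply: (Cmult_cancel_l (w0 / w2)).
  by apply: Cmult_neq_0 => //; move=> E; apply: C1_nz; rewrite -(Cinv_r w2) // E; ring.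
have -> : (w0 / w2 * w1 = w1 * w0 / w2)%C by field.
by rewrite K; field.
Qed.

Lemma continuous_sqrt_region : exists g : C -> C, forall z, D z ->
  (g z * g z = f z)%C /\ cont (T := C_UniformSpace) g z.
Proof.
pose g z := epsilon (inhabits (RtoC 0)) (continued_sqrt z).
have Hg z : D z -> continued_sqrt z (g z).
  by move=> Dz; apply: epsilon_spec; apply: continued_sqrt_ex.
exists g => z Dz; split; first by apply/continued_sqrt_sq/Hg.
have [r [r0 Hr]] := continued_sqrt_disc_ex z Dz.
apply: (cont_ext_loc (T := C_UniformSpace) (fun v => g z * csq (f v / f z))%C).
  apply/locally_C_iff; exists r; split=> // v Hv; have [Dv _] := Hr v Hv.
  apply: (continued_sqrt_uniq v); last exact: Hg.
  apply: (continued_sqrt_disc z (g z) v r) => //; first exact: Hg.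
  move=> u Hu; have [Du Fu] := Hr u Hu; split=> //.
  have := Cmod_ge_0 (f u - f z); lra.
apply: cont_mult; first exact: cont_const.
apply: (cont_comp csq); last first.
  apply: csq_cont; apply: ratio_Re_pos; rewrite Cmod_sub_self; apply/Cmod_gt_0; exact: f_neq.
by apply: cont_div; [apply: f_cont | apply: cont_const | apply: f_neq].
Qed.

End SquareRoot.

Lemma sqrt_exists (w : C) : exists v, (v * v = w)%C.
Proof.
have half_turn u : 0 < Re (- u) -> exists v, (v * v = u)%C.
  move=> H; exists (Ci * csq (- u))%C.
  have -> : (Ci * csq (- u) * (Ci * csq (- u)) = (Ci * Ci) * (csq (- u) * csq (- u)))%C by ring.
  rewrite csq_sq //; have -> : (Ci * Ci = - 1)%C by rewrite /Ci /Cmult /Copp /=; congr pair; ring.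
  ring.
case: (Rlt_dec 0 (Re w)) => [H | H]; first by exists (csq w); apply: csq_sq.
case: (Rlt_dec (Re w) 0) => [H' | H']; first by apply: half_turn; rewrite /Re /= in H' *; lra.
have quarter_turn u : 0 < Im u -> Re u = 0 -> exists v, (v * v = u)%C.
  case: u => x y; rewrite /Im /Re /= => Hy ->.
  exists (sqrt (y / 2), sqrt (y / 2)).
  have ss : sqrt (y / 2) * sqrt (y / 2) = y / 2 by apply: sqrt_sqrt; lra.
  by rewrite /Cmult /=; congr pair; lra.
have E0 : Re w = 0 by lra.
case: (Rtotal_order 0 (Im w)) => [P | [P | P]]; first exact: quarter_turn.
- exists (RtoC 0); move: E0 P; case: (w) => x y; rewrite /Re /Im /fst /snd => -> <-.
  by rewrite Cmult_0_l.
- have [v Hv] := quarter_turn (- w)%C ltac:(rewrite /Im /= in P *; lra)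
                   ltac:(rewrite /Re /= in E0 *; lra).
  exists (Ci * v)%C.
  have -> : (Ci * v * (Ci * v) = (Ci * Ci) * (v * v))%C by ring.
  rewrite Hv; have -> : (Ci * Ci = - 1)%C by rewrite /Ci /Cmult /Copp /=; congr pair; ring.
  ring.
Qed.

Theorem analytic_sqrt (D : C -> Prop) f :
  simply_connected_region D -> analytic_on D f -> (forall z, D z -> f z <> 0) ->
  exists g, analytic_on D g /\ forall z, D z -> (g z * g z = f z)%C.
Proof.
move=> [[oD cD] scD] Hf nf.
case: (classic (exists z0, D z0)) => [[z0 Dz0] | N]; last first.
  by exists f; split=> // z Dz; case: N; exists z.
have [w0 Hw0] := sqrt_exists (f z0).
have cf z : D z -> cont (T := C_UniformSpace) f z by apply: analytic_cont.
have [g Hg] := continuous_sqrt_region D f z0 w0 oD cD scD cf nf Dz0 Hw0.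
exists g; split=> [|z /Hg [] //]; apply: analytic_intro => z Dz.
have [gg cg] := Hg z Dz.
have gn : (g z + g z)%C <> 0.
  have -> : (g z + g z = RtoC 2 * g z)%C by ring.
  apply: Cmult_neq_0; first by move/RtoC_inj; lra.
  by move=> E; apply: (nf z Dz); rewrite -gg E; ring.
have [q [cq [ql Hq]]] := analytic_deriv D f z Hf Dz.
have cs : cont (T := C_UniformSpace) (fun v => g v + g z)%C z.
  by apply: cont_plus => //; apply: cont_const.
have [r [r0 HD]] := open_C_disc D z oD Dz.
have p0 : 0 < Cmod (g z + g z) by apply/Cmod_gt_0.
have [d [Hd Hs]] := proj1 (cont_C_eps _ _) cs _ p0.
exists (q z / (g z + g z))%C.
apply: (has_deriv_quot_loc _ _ _ (fun v => q v / (g v + g z))%C (Rmin r d)) => //.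
- exact: Rmin_pos.
- exact: cont_div.
- move=> v Hv.
  have [gv _] := Hg v (HD v (Rlt_le_trans _ _ _ Hv (Rmin_l _ _))).
  have nv : (g v + g z)%C <> 0.
    move=> E; have := Hs v (Rlt_le_trans _ _ _ Hv (Rmin_r _ _)).
    rewrite E; have -> : (0 - (g z + g z) = - (g z + g z))%C by ring.
    rewrite Cmod_opp; lra.
  apply: (Cmult_cancel_l (g v + g z)) => //.
  have -> : ((g v + g z) * (g v - g z) = g v * g v - g z * g z)%C by ring.
  by rewrite gg gv Hq; field.
Qed.

(** * The unit disk *)

Lemma unit_disk_disc z : unit_disk z <-> disc 0 1 z.
Proof. by rewrite /unit_disk /disc; have -> : (z - 0 = z)%C by ring. Qed.

Lemma unit_disk_of_disc z : disc 0 1 z -> unit_disk z.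
Proof. by case: (unit_disk_disc z). Qed.

Lemma disc_of_unit_disk z : unit_disk z -> disc 0 1 z.
Proof. by case: (unit_disk_disc z). Qed.

Lemma unit_disk_0 : unit_disk 0.
Proof. by rewrite /unit_disk Cmod_0; lra. Qed.

Lemma unit_disk_open : open (T := C_UniformSpace) unit_disk.
Proof.
move=> z /unit_disk_disc /(disc_open 0 1 z).
by apply: filter_imp => w Hw; apply/unit_disk_disc.
Qed.

Lemma unit_disk_convex z w t : unit_disk z -> unit_disk w -> 0 <= t <= 1 ->
  unit_disk (RtoC (1 - t) * z + t * w)%C.
Proof.
rewrite /unit_disk => Hz Hw Ht; apply: Rle_lt_trans (Cmod_triangle _ _) _.
rewrite !Cmod_mult !Cmod_R !Rabs_pos_eq; try lra.
case: (Req_dec t 0) => [-> | tn]; first lra.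
have : 0 < t * (1 - Cmod w) by apply: Rmult_lt_0_compat; lra.
have : 0 <= (1 - t) * (1 - Cmod z) by apply: Rmult_le_pos; lra.
lra.
Qed.

(** The function equal to [1] on [U] and to [-1] elsewhere would be continuous
    along the segment. *)
Lemma segment_connected (U V : C -> Prop) (x y : C) :
  open (T := C_UniformSpace) U -> open (T := C_UniformSpace) V ->
  let path (t : R) := (RtoC (1 - clamp t) * x + clamp t * y)%C in
  (forall t, U (path t) \/ V (path t)) -> U x -> V y ->
  exists t, U (path t) /\ V (path t).
Proof.
move=> oU oV path cover Ux Vy; apply: NNPP => none.
have cp t : cont (T := R_UniformSpace) path t.
  have cc : cont (T := R_UniformSpace) (fun t => RtoC (clamp t)) t.
    exact/cont_RtoC/clamp_cont.
  apply: (cont_ext (fun t => (1 - RtoC (clamp t)) * x + clamp t * y)%C).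
    by move=> u; rewrite /path RtoC_minus.
  apply: cont_plus; apply: cont_mult => //; try exact: cont_const.
  by apply: cont_minus => //; apply: cont_const.
pose h t := if excluded_middle_informative (U (path t)) then 1 else -1.
have hv t : (U (path t) /\ h t = 1) \/ (V (path t) /\ h t = -1).
  rewrite /h; case: excluded_middle_informative => H; first by left.
  by right; split=> //; case: (cover t).
have locconst (W : C -> Prop) t v : open (T := C_UniformSpace) W -> W (path t) ->
    (forall u, W (path u) -> h u = v) -> continuity_pt h t.
  move=> oW Wt Hv; apply/continuity_pt_filterlim.
  apply: (continuous_ext_loc (U := R_UniformSpace) _ (fun _ => v)); last exact: continuous_const.
  have K : locally (T := R_UniformSpace) t (fun u => W (path u)) := cp t W (oW _ Wt).
  by apply: filter_imp K => u Hu; rewrite Hv.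
have ch : continuity h.
  move=> t; case: (hv t) => -[Ht _].
  - apply: (locconst U t 1) => // u Hu; case: (hv u) => -[] // Vu _.
    by case: none; exists u.
  - apply: (locconst V t (-1)) => // u Hu; case: (hv u) => -[] // Uu _.
    by case: none; exists u.
have p0 : path 0 = x.
  rewrite /path clamp_low; last lra.
  rewrite RtoC_minus; ring.
have p1 : path 1 = y.
  rewrite /path clamp_high; last lra.
  rewrite RtoC_minus; ring.
have h0 : h 0 = 1.
  by case: (hv 0) => -[] // V0 _; case: none; exists 0; split=> //; rewrite p0.
have h1 : h 1 = -1.
  by case: (hv 1) => -[] // U1 _; case: none; exists 1; split=> //; rewrite p1.
have [t [_ Z]] : {t | Rmin 0 1 <= t <= Rmax 0 1 /\ h t = 0}.
  apply: IVT_gen => //; rewrite h0 h1 /Rmin /Rmax; repeat case: Rle_dec => ?; lra.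
case: (hv t) => -[_]; lra.
Qed.

Lemma unit_disk_connected : connected unit_disk.
Proof.
move=> U V oU oV cover [x [Dx Ux]] [y [Dy Vy]].
have Dp t : unit_disk (RtoC (1 - clamp t) * x + clamp t * y)%C.
  by apply: unit_disk_convex => //; apply: clamp_in.
have [t Ht] := segment_connected U V x y oU oV (fun t => cover _ (Dp t)) Ux Vy.
by eexists; split; [apply: (Dp t) | exact: Ht].
Qed.

Theorem unit_disk_simply_connected : simply_connected_region unit_disk.
Proof.
split; first by split; [apply: unit_disk_open | apply: unit_disk_connected].
move=> gam [cg [Dg g01]].
have cgc t : cont (T := R_UniformSpace) (fun t => gam (clamp t)) t.
  apply: (cont_on_retract (T := R_UniformSpace) unit_interval gam clamp t) => //.
  - exact: clamp_in.
  - exact: clamp_cont.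
exists (fun p => RtoC (1 - fst p) * gam (clamp (snd p)) + fst p * gam 0)%C.
split; [|split; [|split; [|split]]].
- apply: continuous_on_forall => p _.
  have cf : cont (fun p : R * R => RtoC (fst p)) p.
    by apply: cont_RtoC; case: (p) => a b; apply: continuous_fst.
  apply: (cont_ext (fun p : R * R => (1 - RtoC (fst p)) * gam (clamp (snd p)) + fst p * gam 0)%C).
    by move=> u; rewrite RtoC_minus.
  apply: cont_plus; apply: cont_mult => //; try exact: cont_const.
  + by apply: cont_minus => //; apply: cont_const.
  + apply: (continuous_comp snd (fun t => gam (clamp t))); last exact: cgc.
    by case: (p) => a b; apply: continuous_snd.
- move=> [s t] [/= Hs Ht]; apply: unit_disk_convex => //.
  + by apply: Dg; apply: clamp_in.
  + by apply: Dg; split; lra.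
- move=> t Ht /=; rewrite clamp_id // RtoC_minus; ring.
- move=> t Ht /=; rewrite RtoC_minus; ring.
- move=> s Hs /=; rewrite clamp_id; last lra.
  by rewrite clamp_id -?g01; [rewrite RtoC_minus; split; ring | lra].
Qed.

(** * A determinant estimate *)

Fixpoint csum (u : nat -> C) (n : nat) : C :=
  match n with O => RtoC 0 | S m => (csum u m + u m)%C end.

Module DeterminantBound.

Import all_boot all_fingroup all_algebra boolp GRing.Theory.
Local Open Scope R_scope.

(** A copy of the type of complex numbers, to carry the ring structure that the
    theory of determinants expects. *)
Definition cring : Type := C.

HB.instance Definition _ := gen_eqMixin cring.
HB.instance Definition _ := gen_choiceMixin cring.

Lemma cring_addA : associative (Cplus : cring -> cring -> cring).
Proof. by move=> x y z; apply: Cplus_assoc. Qed.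

Lemma cring_addC : commutative (Cplus : cring -> cring -> cring).
Proof. by move=> x y; apply: Cplus_comm. Qed.

Lemma cring_add0 : left_id (RtoC 0 : cring) Cplus.
Proof. exact: Cplus_0_l. Qed.

Lemma cring_addN : left_inverse (RtoC 0 : cring) Copp Cplus.
Proof. by move=> x; rewrite Cplus_comm Cplus_opp_r. Qed.

HB.instance Definition _ :=
  GRing.isZmodule.Build cring cring_addA cring_addC cring_add0 cring_addN.

Lemma cring_mulA : associative (Cmult : cring -> cring -> cring).
Proof. by move=> x y z; apply: Cmult_assoc. Qed.

Lemma cring_mulC : commutative (Cmult : cring -> cring -> cring).
Proof. by move=> x y; apply: Cmult_comm. Qed.

Lemma cring_mul1 : left_id (RtoC 1 : cring) Cmult.
Proof. exact: Cmult_1_l. Qed.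

Lemma cring_mulD : left_distributive (Cmult : cring -> cring -> cring) Cplus.
Proof. by move=> x y z; apply: Cmult_plus_distr_r. Qed.

Lemma cring_1_neq : (RtoC 1 : cring) != RtoC 0.
Proof. by apply/eqP; apply: C1_nz. Qed.

HB.instance Definition _ := GRing.Zmodule_isComNzRing.Build cring
  cring_mulA cring_mulC cring_mul1 cring_mulD cring_1_neq.

Lemma csum_big (u : nat -> C) n :
  csum u n = (\sum_(k < n) (u k : cring))%R :> cring.
Proof.
elim: n => [|n IH]; first by rewrite big_ord0.
by rewrite big_ord_recr /= -IH.
Qed.

Lemma Cmod_big_sum (I : Type) (r : seq I) (F : I -> cring) M :
  (forall i, (Cmod (F i) <= M)) ->
  (Cmod (\sum_(i <- r) F i)%R <= INR (size r) * M).
Proof.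
move=> H; elim: r => [|x r IH]; first by rewrite big_nil Cmod_0 /=; lra.
rewrite big_cons; have T := Cmod_triangle (F x) (\sum_(i <- r) F i)%R.
apply: Rle_trans T _; rewrite [size _]/= S_INR; have := H x; lra.
Qed.

Lemma Cmod_big_prod (I : Type) (r : seq I) (F : I -> cring) M :
  (forall i, (Cmod (F i) <= M)) ->
  (Cmod (\prod_(i <- r) F i)%R <= Rpow_def.pow M (size r)).
Proof.
move=> H; elim: r => [|x r IH]; first by rewrite big_nil Cmod_1 /=; lra.
rewrite big_cons.
have -> : Cmod (F x * \prod_(i <- r) F i)%R =
          Rmult (Cmod (F x)) (Cmod (\prod_(i <- r) F i)%R) by apply: Cmod_mult.
by apply: Rmult_le_compat => //; apply: Cmod_ge_0.
Qed.

Lemma Cmod_sign (b : bool) (x : cring) : Cmod ((-1) ^+ b * x)%R = Cmod x.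
Proof.
case: b; last by rewrite expr0 mul1r.
by rewrite expr1 mulN1r; apply: Cmod_opp.
Qed.

Lemma size_index_enum (T : finType) : size (index_enum T) = #|T|.
Proof. by rewrite -sum1_size -sum1_card. Qed.

Lemma Cmod_det N (A : 'M[cring]_N) M : (forall i j, (Cmod (A i j) <= M)) ->
  (Cmod (\det A)%R <= INR (N`!) * Rpow_def.pow M N).
Proof.
move=> H; rewrite /determinant.
have := @Cmod_big_sum _ (index_enum ('S_N : finType))
  (fun s => (-1) ^+ s * \prod_i A i (s i))%R (Rpow_def.pow M N).
rewrite size_index_enum card_Sn.
apply=> s; rewrite Cmod_sign.
have := @Cmod_big_prod _ (index_enum ('I_N : finType)) (fun i => A i (s i)) M.
by rewrite size_index_enum card_ord; apply.
Qed.

Lemma pow_expr (c : cring) n : Cpow c n = (c ^+ n)%R :> cring.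
Proof. by elim: n => [|n IH] //=; rewrite exprS -IH. Qed.

(** The determinant of [A^T A] is the square of the product of the diagonal entries
    [c ^ k], while Leibniz's formula bounds it by [N! * M ^ N]. *)
Lemma gram_triangular (A : nat -> nat -> C) (c : C) (M : R) (N : nat) :
  (forall k n, (n < k)%coq_nat -> A k n = RtoC 0) ->
  (forall k, A k k = Cpow c k) ->
  (forall m n, (m < N)%coq_nat -> (n < N)%coq_nat ->
     (Cmod (csum (fun k => Cmult (A k m) (A k n)) N) <= M)) ->
  (Rpow_def.pow (Cmod c) (N * N.-1) <= INR (N`!) * Rpow_def.pow M N).
Proof.
move=> tri diag bound.
pose B : 'M[cring]_N := (\matrix_(k, n) (A k n : cring))%R.
have dB : (\det B)%R = (\prod_(i < N) (c : cring) ^+ i)%R.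
  rewrite -det_tr det_trig; first by apply: eq_bigr => i _; rewrite !mxE diag pow_expr.
  apply/is_trig_mxP => i j ij; rewrite !mxE; apply: tri; exact/ltP.
have E : (\det (B^T *m B))%R = ((c : cring) ^+ (N * N.-1))%R.
  rewrite det_mulmx det_tr dB prodrXr -expr2 -exprM; congr (_ ^+ _)%R.
  rewrite -(big_mkord xpredT id) bin2_sum bin2 muln2 halfK.
  by case: (N) => // n; rewrite /= oddM /= andNb subn0.
have -> : Rpow_def.pow (Cmod c) (N * N.-1) = Cmod (\det (B^T *m B))%R.
  by rewrite E -pow_expr Cmod_pow.
apply: Cmod_det => i j; rewrite !mxE.
have := bound i j (elimT ltP (ltn_ord i)) (elimT ltP (ltn_ord j)).
rewrite csum_big => H; apply: Rle_trans H; apply: Req_le; congr Cmod.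
by apply: eq_bigr => k _; rewrite !mxE.
Qed.

Lemma fact_le_pow N : (INR (N`!) <= Rpow_def.pow (INR N) N).
Proof.
have H n : (n`! <= N ^ n)%N || (N < n)%N.
  elim: n => [|n IH]; first by rewrite fact0 expn0.
  case: (leqP n.+1 N) => Hn; last by rewrite orbT.
  rewrite orbF; move: IH; rewrite ltnNge (ltnW Hn) orbF => IH.
  by rewrite factS expnS leq_mul.
have := H N; rewrite ltnn orbF => /leP /le_INR HN; apply: Rle_trans HN _.
have P k : INR (N ^ k)%N = Rpow_def.pow (INR N) k.
  by elim: k => [|k IH]; [rewrite expn0 | rewrite expnS -multE mult_INR IH].
by rewrite P; apply: Rle_refl.
Qed.

Lemma pow_lt_compat x y n : 0 <= x -> x < y -> Rpow_def.pow x n.+1 < Rpow_def.pow y n.+1.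
Proof.
move=> x0 xy; elim: n => [|n IH]; first by rewrite /= !Rmult_1_r.
rewrite -(tech_pow_Rmult x) -(tech_pow_Rmult y); apply: Rmult_le_0_lt_compat => //.
exact: pow_le.
Qed.

(** The preceding estimate for matrices of size [N + 1], of which an [N + 1]-st root
    can be taken because [n! <= n ^ n]. *)
Theorem gram_triangular_bound (A : nat -> nat -> C) (c : C) (M : R) (N : nat) :
  (forall k n, (n < k)%coq_nat -> A k n = RtoC 0) ->
  (forall k, A k k = Cpow c k) ->
  (forall m n, (m < N.+1)%coq_nat -> (n < N.+1)%coq_nat ->
     (Cmod (csum (fun k => Cmult (A k m) (A k n)) N.+1) <= M)) ->
  (Rpow_def.pow (Cmod c) N <= INR N.+1 * M).
Proof.
move=> tri diag bound.
have M0 : (0 <= M).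
  have L : (0 < N.+1)%coq_nat by apply/ltP.
  by apply: Rle_trans (bound 0%N 0%N L L); apply: Cmod_ge_0.
have H := gram_triangular A c M N.+1 tri diag bound.
have {}H : (Rpow_def.pow (Rpow_def.pow (Cmod c) N) N.+1 <=
            Rpow_def.pow (INR N.+1 * M) N.+1).
  rewrite -pow_mult Rpow_mult_distr multE mulnC; apply: Rle_trans H _.
  apply: Rmult_le_compat_r; first exact: pow_le.
  exact: fact_le_pow.
apply: Rnot_lt_le => K.
have P0 : (0 <= INR N.+1 * M) by apply: Rmult_le_pos => //; apply: pos_INR.
have := pow_lt_compat _ _ N P0 K; lra.
Qed.

End DeterminantBound.

(** * The Bieberbach-Eilenberg inequality and Koebe's quarter theorem *)

(** The gauge below is bounded by the inverse of the value at the tag, so a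
    uniform lower bound for the gauge is an upper bound for the function. *)
Lemma square_bounded (h : R * R -> R) (a b c d : R) :
  (forall x y, a <= x <= b -> c <= y <= d -> continuous h (x, y)) ->
  exists M, forall x y, a <= x <= b -> c <= y <= d -> h (x, y) <= M.
Proof.
move=> ch.
pose P u v (e : posreal) := a <= u <= b -> c <= v <= d ->
  (Rabs (h (u, v)) + 1) * e <= 1 /\
  forall x y, Rabs (x - u) < e -> Rabs (y - v) < e -> h (x, y) <= h (u, v) + 1.
have loc u v : exists e : posreal, P u v e.
  case: (classic (a <= u <= b /\ c <= v <= d)) => [[Hu Hv] | N]; last first.
    by exists (mkposreal 1 Rlt_0_1) => Hu Hv; case: N.
  have K : locally (u, v) (fun p => h p <= h (u, v) + 1).
    apply: (ch u v Hu Hv (fun r => r <= h (u, v) + 1)).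
    exists (mkposreal 1 Rlt_0_1) => r; rewrite /ball /= /AbsRing_ball /abs /minus /plus /opp /=.
    by move/Rabs_def2; lra.
  case: K => e0 He0.
  have q0 : 0 < / (Rabs (h (u, v)) + 1).
    by apply: Rinv_0_lt_compat; have := Rabs_pos (h (u, v)); lra.
  exists (mkposreal _ (Rmin_pos _ _ (cond_pos e0) q0)) => _ _ /=; split.
  - have p0 : 0 < Rabs (h (u, v)) + 1 by have := Rabs_pos (h (u, v)); lra.
    apply: (Rle_trans _ ((Rabs (h (u, v)) + 1) * / (Rabs (h (u, v)) + 1))).
      by apply: Rmult_le_compat_l; [lra | apply: Rmin_r].
    by rewrite Rinv_r; lra.
  - move=> x y Hx Hy; apply: He0; split;
      rewrite /ball /= /AbsRing_ball /abs /minus /plus /opp /=.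
    + by apply: Rlt_le_trans Hx (Rmin_l _ _).
    + by apply: Rlt_le_trans Hy (Rmin_l _ _).
pose delta u v := proj1_sig (constructive_indefinite_description _ (loc u v)).
have Hdelta u v : P u v (delta u v).
  exact: proj2_sig (constructive_indefinite_description _ (loc u v)).
have [e He] := compactness_value_2d a b c d delta.
have e0 := cond_pos e; exists (1 / e + 1) => x y Hx Hy; apply: NNPP => bad.
apply: (He x y Hx Hy) => -[u [v [Hu [Hv [H1 [H2 H3]]]]]]; apply: bad.
have [K1 K2] := Hdelta u v Hu Hv.
have := K2 x y H1 H2.
have A0 := Rle_abs (h (u, v)); have A1 := Rabs_pos (h (u, v)).
have : Rabs (h (u, v)) + 1 <= 1 / e by apply/Rle_div_r => //; nra.
lra.
Qed.

Lemma cmean_csum (u : nat -> R -> C) n : (forall k, cont_all (u k)) ->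
  cmean (fun t => csum (fun k => u k t) n) = csum (fun k => cmean (u k)) n.
Proof.
move=> cu; elim: n => [|n IH] /=; first exact: cmean_const.
rewrite cmean_plus ?IH //; elim: n {IH} => [|n IH] t /=; first exact: cont_const.
by apply: cont_plus; [apply: IH | apply: cu].
Qed.

Lemma cont_csum (u : nat -> R -> C) n t :
  (forall k, cont (T := R_UniformSpace) (u k) t) ->
  cont (T := R_UniformSpace) (fun t => csum (fun k => u k t) n) t.
Proof.
move=> cu; elim: n => [|n IH] /=; first exact: cont_const.
by apply: cont_plus.
Qed.

Lemma csum_scal (c : C) u n : csum (fun k => c * u k)%C n = (c * csum u n)%C.
Proof. by elim: n => [|n IH] /=; [ring | rewrite IH; ring]. Qed.

Lemma csum_ext (u v : nat -> C) n : (forall k, u k = v k) -> csum u n = csum v n.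
Proof. by move=> H; elim: n => [|n IH] //=; rewrite IH H. Qed.

Lemma geometric_remainder (x : C) n : (1 - x)%C <> 0 ->
  (/ (1 - x) = csum (fun k => x ^ k) n + x ^ n * / (1 - x))%C.
Proof.
move=> Hx; elim: n => [|n IH] /=; first by ring.
rewrite {1}IH; field; done.
Qed.

Lemma mean_value G r r' : 0 < r < r' -> analytic_on (disc 0 r') G ->
  cmean (fun t => G (circ 0 r t)) = G 0.
Proof.
move=> Hr HG; rewrite (cauchy_formula G 0 r r' 0) //; [|lra|apply: disc_center; lra].
apply: cmean_ext => t.
have E : (circ 0 r t - 0 = r * expi t)%C by rewrite /circ; ring.
have n0 : (r * expi t)%C <> 0.
  by rewrite -E; apply/circ_neq/disc_center; lra.
by rewrite E /Cdiv Cinv_r // Cmult_1_r.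
Qed.

Lemma linear_growth_le_1 x M : 0 <= x -> (forall n, x ^ n <= INR (S n) * M) -> x <= 1.
Proof.
move=> x0 H; apply: Rnot_lt_le => x1.
pose y := sqrt x.
have yy : y * y = x by apply: sqrt_sqrt.
have y1 : 1 < y by rewrite -sqrt_1; apply: sqrt_lt_1; lra.
have M0 : 0 <= M by have := H 0%nat; rewrite /=; lra.
have [n Hn] := nfloor_ex (2 * M / ((y - 1) * (y - 1)))
  ltac:(apply: Rmult_le_pos; [lra | apply/Rlt_le/Rinv_0_lt_compat; nra]).
pose m := S n.
have m1 : 1 <= INR m by rewrite /m S_INR; have := pos_INR n; lra.
have K : 2 * M < INR m * ((y - 1) * (y - 1)).
  by apply/Rlt_div_l; [nra | rewrite /m S_INR; lra].
have P : 1 + INR m * (y - 1) <= y ^ m.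
  have := poly m (y - 1) ltac:(lra); by replace (1 + (y - 1)) with y by ring.
have := H m; rewrite -yy Rpow_mult_distr S_INR => Hm.
have : (1 + INR m * (y - 1)) * (1 + INR m * (y - 1)) <= y ^ m * y ^ m.
  by apply: Rmult_le_compat => //; nra.
have : INR m * (2 * M) < INR m * (INR m * ((y - 1) * (y - 1))) by apply: Rmult_lt_compat_l; lra.
have : M <= INR m * M by nra.
have : 0 <= INR m * (y - 1) by nra.
lra.
Qed.

Section BieberbachEilenberg.

Variable F : C -> C.
Hypothesis F_an : analytic_on unit_disk F.
Hypothesis F_0 : F 0 = 0.
Hypothesis F_prod : forall z u, unit_disk z -> unit_disk u -> (F z * F u)%C <> 1.
Variable r : R.
Hypothesis Hr : 0 < r < 1.

Let z (t : R) := circ 0 r t.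
Let q (t : R) := Cinv (expi t).

Let z_disk t : unit_disk (z t).
Proof. by apply/unit_disk_of_disc; rewrite /z /disc circ_dist; lra. Qed.

Let expi_neq t : expi t <> 0.
Proof. by move=> E; have := expi_mod t; rewrite E Cmod_0; lra. Qed.

Let z_q t : (z t * q t = r)%C.
Proof. by rewrite /z /q /circ; field; apply: expi_neq. Qed.

Let F1 := dquot F 0.

Let F1_an : analytic_on unit_disk F1.
Proof.
apply: analytic_dquot => //; first exact: unit_disk_open.
by rewrite /unit_disk Cmod_0; lra.
Qed.

Let F_fact w : F w = (w * F1 w)%C.
Proof.
apply: Cminus_0_eq.
have -> : (F w - w * F1 w = (F w - F 0) - F1 w * (w - 0))%C by rewrite F_0; ring.
by rewrite dquot_spec /F1; ring.
Qed.

Let cont_q : cont_all q.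
Proof. by move=> t; apply: cont_inv; [apply: cont_expi | apply: expi_neq]. Qed.

Let cont_on_circle G : analytic_on unit_disk G -> cont_all (fun t => G (z t)).
Proof.
move=> HG t; apply: cont_comp; first exact: cont_circ.
by apply: analytic_cont HG _; apply: z_disk.
Qed.

(** The [n]-th Taylor coefficient of [G], times [r ^ n]. *)
Let coef (G : C -> C) n := cmean (fun t => G (z t) * q t ^ n)%C.

Let cont_coef G n : analytic_on unit_disk G -> cont_all (fun t => G (z t) * q t ^ n)%C.
Proof.
by move=> HG t; apply: cont_mult; [apply: cont_on_circle | apply: cont_pow].
Qed.

(** The mean value property for [w ^ (k - n) * G w]. *)
Let coef_shift G k n : analytic_on unit_disk G -> (n <= k)%nat ->
  coef (fun w => w ^ k * G w)%C n = (r ^ n * (0 ^ (k - n) * G 0))%C.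
Proof.
move=> HG nk; have HG' : analytic_on (disc 0 1) (fun w => w ^ (k - n) * G w)%C.
  apply: analytic_intro => w /unit_disk_of_disc Hw.
  have [m Hm] := has_deriv_pow _ w _ (k - n) (has_deriv_id w).
  by eexists; apply: has_deriv_mult Hm (analytic_deriv _ _ _ HG Hw).
rewrite -(mean_value _ r 1 ltac:(lra) HG') -cmean_scal; last first.
  move=> t; apply: (cont_comp (fun w => w ^ (k - n) * G w)%C); first exact: cont_circ.
  by apply: analytic_cont HG' _; apply/disc_of_unit_disk/z_disk.
apply: cmean_ext => t; rewrite -/(z t).
have -> : (r ^ n)%C = (z t ^ n * q t ^ n)%C by rewrite -Cpow_mult_l z_q.
have -> : (z t ^ k = z t ^ n * z t ^ (k - n))%C.
  by rewrite -Cpow_add_r; congr Cpow; lia.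
ring.
Qed.

Let A k n := coef (fun w => F w ^ k)%C n.

Let A_fact k n : A k n = coef (fun w => w ^ k * F1 w ^ k)%C n.
Proof. by apply: cmean_ext => t; rewrite F_fact Cpow_mult_l. Qed.

Let A_below k n : (n < k)%nat -> A k n = 0.
Proof.
move=> H; rewrite A_fact coef_shift; [|exact: analytic_pow|lia].
have -> : (k - n = S (k - n - 1))%nat by lia.
by rewrite /=; ring.
Qed.

Let A_diag k : A k k = ((r * C_derive F 0) ^ k)%C.
Proof.
rewrite A_fact coef_shift; [|exact: analytic_pow|lia].
by rewrite Nat.sub_diag /= /F1 dquot_b Cmult_1_l Cpow_mult_l.
Qed.

Let ker w u := (/ (1 - F w * F u))%C.

Let ker_den w u : unit_disk w -> unit_disk u -> (1 - F w * F u)%C <> 0.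
Proof. by move=> Hw Hu E; apply: (F_prod w u Hw Hu); apply/eq_sym/Cminus_0_eq. Qed.

Let ker_an u : unit_disk u -> analytic_on unit_disk (fun w => ker w u).
Proof.
move=> Hu; apply: analytic_intro => w Hw; eexists.
apply: (has_deriv_inv (fun w => 1 - F w * F u)%C w _ _ (ker_den w u Hw Hu)).
apply: has_deriv_minus; first exact: has_deriv_const.
by apply: has_deriv_mult (analytic_deriv _ _ _ F_an Hw) (has_deriv_const _ _).
Qed.

(** The remainder of the geometric series of [1 / (1 - F w * F u)] vanishes to
    order [N] at [w = 0], so it does not contribute to low coefficients. *)
Let ker_coef u n N : unit_disk u -> (n < N)%nat ->
  coef (fun w => ker w u) n = csum (fun k => A k n * F u ^ k)%C N.
Proof.
move=> Hu nN.
pose rest w := (w ^ N * (F1 w ^ N * F u ^ N * ker w u))%C.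
have rest_an : analytic_on unit_disk (fun w => F1 w ^ N * F u ^ N * ker w u)%C.
  apply: analytic_intro => w Hw; eexists.
  apply: has_deriv_mult (analytic_deriv _ _ _ (ker_an u Hu) Hw).
  by apply: has_deriv_mult (analytic_deriv _ _ _ (analytic_pow _ _ N F1_an) Hw)
                           (has_deriv_const _ _).
have -> : coef (fun w => ker w u) n =
   cmean (fun t => csum (fun k => F u ^ k * (F (z t) ^ k * q t ^ n)) N + rest (z t) * q t ^ n)%C.
  apply: cmean_ext => t; rewrite /ker (geometric_remainder _ N (ker_den _ _ (z_disk t) Hu)).
  rewrite Cmult_plus_distr_r; congr (_ + _)%C.
    rewrite Cmult_comm -csum_scal; apply: csum_ext => k.
    by rewrite Cpow_mult_l; ring.
  by rewrite /rest /ker {1}F_fact !Cpow_mult_l; ring.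
rewrite cmean_plus; last first.
- apply: cont_coef; apply: analytic_intro => w Hw.
  have [m Hm] := has_deriv_pow _ w _ N (has_deriv_id w).
  by eexists; apply: has_deriv_mult Hm (analytic_deriv _ _ _ rest_an Hw).
- move=> t; apply: cont_csum => k; apply: cont_mult; first exact: cont_const.
  by apply: (cont_coef (fun w => F w ^ k)%C); apply: analytic_pow.
have -> : cmean (fun t => rest (z t) * q t ^ n)%C = 0.
  etransitivity; first by apply: (coef_shift _ N n rest_an); lia.
  have -> : (N - n = S (N - n - 1))%nat by lia.
  by rewrite /=; ring.
rewrite Cplus_0_r (cmean_csum (fun k t => F u ^ k * (F (z t) ^ k * q t ^ n))%C); last first.
  move=> k t; apply: cont_mult; first exact: cont_const.
  by apply: (cont_coef (fun w => F w ^ k)%C); apply: analytic_pow.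
apply: csum_ext => k; rewrite cmean_scal; last by apply: (cont_coef (fun w => F w ^ k)%C); apply: analytic_pow.
by rewrite Cmult_comm.
Qed.

Let coef_bound (G : R -> C) n M : cont_all G ->
  (forall t, 0 <= t <= 2 * PI -> Cmod (G t) <= M) ->
  Cmod (cmean (fun t => G t * q t ^ n)%C) <= M.
Proof.
move=> HG HM; apply: cmean_bound.
  by move=> t; apply: cont_mult => //; apply: cont_pow.
move=> t Ht; rewrite Cmod_mult Cmod_pow /q Cmod_inv // expi_mod Rinv_1 pow1 Rmult_1_r.
exact: HM.
Qed.

(** The matrix of coefficients of [1 / (1 - F z * F u)] is bounded by the maximum
    on the torus [|z| = |u| = r]; by the geometric series it has the form [A^T A],
    where [A] is triangular because [F ^ k] vanishes to order [k] at the origin. *)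
Lemma bieberbach_eilenberg_radius : r * Cmod (C_derive F 0) <= 1.
Proof.
have [M HM] : exists M, forall t s, 0 <= t <= 2 * PI -> 0 <= s <= 2 * PI ->
    Cmod (ker (z t) (z s)) <= M.
  apply: (square_bounded (fun p => Cmod (ker (z (fst p)) (z (snd p)))) 0 (2 * PI) 0 (2 * PI)).
  move=> t s _ _; apply: cont_Cmod; apply: cont_inv; last exact: ker_den.
  apply: cont_minus; first exact: cont_const.
  apply: cont_mult.
  - apply: (continuous_comp fst (fun t => F (z t))); first exact: continuous_fst.
    exact: cont_on_circle.
  - apply: (continuous_comp snd (fun t => F (z t))); first exact: continuous_snd.
    exact: cont_on_circle.
have -> : r * Cmod (C_derive F 0) = Cmod (r * C_derive F 0)%C.
  by rewrite Cmod_mult Cmod_R Rabs_pos_eq; lra.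
apply: (linear_growth_le_1 _ M); first exact: Cmod_ge_0.
move=> N; apply: (DeterminantBound.gram_triangular_bound A) => //.
move=> m n Hm Hn.
have cB : cont_all (fun s => csum (fun k => A k n * F (z s) ^ k)%C (S N)).
  move=> s; apply: (cont_csum (fun k s => A k n * F (z s) ^ k)%C) => k.
  apply: cont_mult; first exact: cont_const.
  by apply: (cont_on_circle (fun w => F w ^ k)%C); apply: analytic_pow.
have -> : csum (fun k => A k m * A k n)%C (S N) =
   cmean (fun s => csum (fun k => A k n * F (z s) ^ k)%C (S N) * q s ^ m)%C.
  have cu k : cont_all (fun s => A k n * (F (z s) ^ k * q s ^ m))%C.
    move=> s; apply: cont_mult; first exact: cont_const.
    by apply: (cont_coef (fun w => F w ^ k)%C); apply: analytic_pow.
  rewrite -(cmean_ext (fun s => csum (fun k => A k n * (F (z s) ^ k * q s ^ m))%C (S N))).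
    rewrite (cmean_csum (fun k s => A k n * (F (z s) ^ k * q s ^ m))%C) //.
    apply: csum_ext => k; rewrite cmean_scal; first exact: Cmult_comm.
    by apply: (cont_coef (fun w => F w ^ k)%C); apply: analytic_pow.
  move=> s; rewrite Cmult_comm -csum_scal; apply: csum_ext => k; ring.
apply: coef_bound => // s Hs.
rewrite -(ker_coef (z s) n (S N) (z_disk s)) //.
apply: coef_bound => [|t Ht]; last exact: HM.
by apply: (cont_on_circle (fun w => ker w (z s))); apply: ker_an.
Qed.

End BieberbachEilenberg.

Theorem bieberbach_eilenberg F : analytic_on unit_disk F -> F 0 = 0 ->
  (forall z u, unit_disk z -> unit_disk u -> (F z * F u)%C <> 1) ->
  Cmod (C_derive F 0) <= 1.
Proof.
move=> HF F0 HP; apply: Rnot_lt_le => H.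
set x := Cmod (C_derive F 0) in H.
pose r := (/ x + 1) / 2.
have x0 : 0 < / x < 1.
  split; first by apply: Rinv_0_lt_compat; lra.
  by rewrite -Rinv_1; apply: Rinv_lt_contravar; lra.
have := bieberbach_eilenberg_radius F HF F0 HP r ltac:(rewrite /r; lra).
rewrite -/x /r; have : / x * x = 1 by apply: Rinv_l; lra.
nra.
Qed.

(** The square root [h] of the normalized map never takes two opposite values,
    so [(h - 1) / (h + 1)] satisfies the hypothesis of the preceding theorem. *)
Theorem koebe_quarter F w : conformal_on unit_disk F -> ~ image F unit_disk w ->
  Cmod (C_derive F 0) <= 4 * Cmod (F 0 - w).
Proof.
move=> [HF inj] Hw.
have D0 := unit_disk_0.
have nw z : unit_disk z -> (F z - w)%C <> 0.
  by move=> Dz /Cminus_0_eq E; apply: Hw; exists z.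
pose e := (F 0 - w)%C; have en : e <> 0 by apply: nw.
have Hf : analytic_on unit_disk (fun z => (F z - w) / e)%C.
  apply: analytic_intro => z Dz; eexists.
  exact: (has_deriv_div _ _ z _ _ (has_deriv_minus _ _ _ _ _ (analytic_deriv _ _ _ HF Dz)
           (has_deriv_const w z)) (has_deriv_const e z) en).
have nf z : unit_disk z -> ((F z - w) / e)%C <> 0.
  move=> Dz E; apply: (nw z Dz).
  have -> : (F z - w = (F z - w) / e * e)%C by field.
  by rewrite E; ring.
have [g [Hg gg]] := analytic_sqrt _ _ unit_disk_simply_connected Hf nf.
(* [g 0] is a square root of one; the factor makes [h 0 = 1]. *)
pose h z := (g z * g 0)%C.
have g00 : (g 0 * g 0 = 1)%C by rewrite gg // /e; field.
have hh z : unit_disk z -> (h z * h z = (F z - w) / e)%C.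
  move=> Dz; have -> : (h z * h z = (g z * g z) * (g 0 * g 0))%C by rewrite /h; ring.
  by rewrite g00 gg // Cmult_1_r.
have h0 : h 0 = 1 by [].
have dh z : unit_disk z -> has_deriv h z (C_derive h z).
  move=> Dz; apply/has_C_derive/has_deriv_ex; eexists.
  by apply: has_deriv_mult (analytic_deriv _ _ _ Hg Dz) (has_deriv_const _ _).
have sum_neq z u : unit_disk z -> unit_disk u -> (h z + h u)%C <> 0.
  move=> Dz Du E.
  have Eh : h z = (- h u)%C by rewrite -(Cplus_0_l (- h u)) -E; ring.
  have Ef : ((F z - w) / e = (F u - w) / e)%C by rewrite -!hh // Eh; ring.
  have EF : F z = F u.
    have -> : F z = ((F z - w) / e * e + w)%C by field.
    by rewrite Ef; field.
  have Ez := inj z u Dz Du EF; rewrite Ez in Eh.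
  have h2 : (h u + h u = 0)%C by rewrite {1}Eh; ring.
  apply: (nf u Du); rewrite -hh //.
  have -> : (h u * h u = (h u + h u) * (h u / 2))%C by field.
  by rewrite h2; ring.
have den z : unit_disk z -> (h z + 1)%C <> 0 by move=> Dz; rewrite -h0; apply: sum_neq.
pose G z := ((h z - 1) / (h z + 1))%C.
have dG z : unit_disk z -> has_deriv G z
    (((C_derive h z - 0) * (h z + 1) - (h z - 1) * (C_derive h z + 0)) / ((h z + 1) * (h z + 1))).
  move=> Dz.
  exact: (has_deriv_div _ _ z _ _ (has_deriv_minus _ _ _ _ _ (dh z Dz) (has_deriv_const 1 z))
           (has_deriv_plus _ _ _ _ _ (dh z Dz) (has_deriv_const 1 z)) (den z Dz)).
have BE : Cmod (C_derive G 0) <= 1.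
  apply: bieberbach_eilenberg.
  - by apply: analytic_intro => z Dz; eexists; apply: dG.
  - rewrite /G h0; have -> : (1 - 1 = 0)%C by ring.
    by rewrite /Cdiv Cmult_0_l.
  - move=> z u Dz Du E; apply: (sum_neq z u Dz Du).
    have dz := den z Dz; have du := den u Du.
    have K : ((h z - 1) * (h u - 1) = (h z + 1) * (h u + 1))%C.
      have -> : ((h z - 1) * (h u - 1) = (G z * G u) * ((h z + 1) * (h u + 1)))%C.
        by rewrite /G; field; split.
      by rewrite E; ring.
    have -> : (h z + h u = ((h z + 1) * (h u + 1) - (h z - 1) * (h u - 1)) / 2)%C by field.
    by rewrite K; field.
have E1 : C_derive G 0 = (C_derive h 0 / 2)%C.
  rewrite (C_derive_has _ _ _ (dG 0 D0)) h0.
  by field; split; move=> E; apply: C1_nz; have := f_equal Re E; rewrite /Re /=; lra.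
have E2 : (C_derive F 0 / e = 2 * C_derive h 0)%C.
  have d1 := has_deriv_mult _ _ _ _ _ (dh 0 D0) (dh 0 D0).
  have d2 : has_deriv (fun z => (F z - w) / e)%C 0 (C_derive F 0 / e).
    have := has_deriv_div _ _ 0 _ _
      (has_deriv_minus _ _ _ _ _ (analytic_deriv _ _ _ HF D0) (has_deriv_const w 0))
      (has_deriv_const e 0) en.
    by congr has_deriv; field.
  have d3 : has_deriv (fun z => h z * h z)%C 0 (C_derive F 0 / e).
    apply: has_deriv_ext_loc d2; exists 1; split; first lra.
    by move=> v Hv; rewrite hh //; apply: unit_disk_of_disc.
  by rewrite (has_deriv_uniq _ _ _ _ d3 d1) h0; ring.
have -> : C_derive F 0 = (4 * e * C_derive G 0)%C.
  have -> : C_derive F 0 = (C_derive F 0 / e * e)%C by field.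
  by rewrite E2 E1; field.
rewrite !Cmod_mult Cmod_R Rabs_pos_eq; last lra.
rewrite -/e; have := Cmod_ge_0 e; nra.
Qed.

(** * The extremal problem of the Riemann mapping theorem *)

Lemma conformal_comp (D E : C -> Prop) f g :
  conformal_on D f -> (forall z, D z -> E (f z)) -> conformal_on E g ->
  conformal_on D (fun z => g (f z)).
Proof.
move=> [Hf If] HE [Hg Ig]; split.
- apply: analytic_intro => z Dz; eexists.
  by apply: has_deriv_comp (analytic_deriv _ _ _ Hg (HE z Dz)) (analytic_deriv _ _ _ Hf Dz).
- by move=> z w Dz Dw E1; apply: If => //; apply: Ig => //; apply: HE.
Qed.

Lemma C_derive_comp (D E : C -> Prop) f g z :
  analytic_on D f -> analytic_on E g -> D z -> E (f z) ->
  C_derive (fun z => g (f z)) z = (C_derive g (f z) * C_derive f z)%C.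
Proof.
move=> Hf Hg Dz Ez; apply: C_derive_has.
by apply: has_deriv_comp (analytic_deriv _ _ _ Hg Ez) (analytic_deriv _ _ _ Hf Dz).
Qed.

Lemma conformal_sqrt (D : C -> Prop) f s :
  conformal_on D f -> analytic_on D s -> (forall z, D z -> (s z * s z = f z)%C) ->
  conformal_on D s.
Proof.
move=> [_ inj] Hs ss; split=> // z w Dz Dw E; apply: inj => //.
by rewrite -!ss // E.
Qed.

Lemma conformal_mob a : Cmod a < 1 -> conformal_on unit_disk (mob a).
Proof.
move=> Ha; split; first exact: analytic_mob.
by move=> z w Hz Hw E; rewrite -(mob_inv a z Ha Hz) -(mob_inv a w Ha Hw) E.
Qed.

Lemma C_derive_mob_a a : Cmod a < 1 -> C_derive (mob a) a = RtoC (/ (1 - Cmod a ^ 2)).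
Proof.
move=> Ha; rewrite (C_derive_has _ _ _ (has_deriv_mob a a Ha (Rlt_le _ _ Ha))).
have a0 := Cmod_ge_0 a.
have -> : (1 - Cconj a * a)%C = RtoC (1 - Cmod a ^ 2).
  by rewrite RtoC_minus Cmod2_conj; ring.
have n0 : 1 - Cmod a ^ 2 <> 0 by nra.
rewrite RtoC_inv //; field; by move/RtoC_inj.
Qed.

Lemma C_derive_mob_0 a : Cmod a < 1 -> C_derive (mob a) 0 = RtoC (1 - Cmod a ^ 2).
Proof.
move=> Ha; have H0 : Cmod 0 <= 1 by rewrite Cmod_0; lra.
rewrite (C_derive_has _ _ _ (has_deriv_mob a 0 Ha H0)).
have -> : (1 - Cconj a * 0 = 1)%C by ring.
by field.
Qed.

Section ExtremalProblem.

Variables (D : C -> Prop) (z0 : C).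
Hypothesis D_sc : simply_connected_region D.
Hypothesis Dz0 : D z0.

Let D_open : open (T := C_UniformSpace) D := proj1 (proj1 D_sc).

(** The Riemann map is sought among these, by maximizing [|phi' z0|]. *)
Definition competitor (phi : C -> C) : Prop :=
  conformal_on D phi /\ (forall z, D z -> unit_disk (phi z)) /\ phi z0 = 0.

Lemma competitor_mob phi : conformal_on D phi -> (forall z, D z -> unit_disk (phi z)) ->
  competitor (fun z => mob (phi z0) (phi z)).
Proof.
move=> Hf Hd; have Ha : Cmod (phi z0) < 1 by apply: Hd.
split; first by apply: conformal_comp Hf Hd (conformal_mob _ Ha).
split; last exact: mob_a.
by move=> z Dz; apply: mob_lt => //; apply: Hd.
Qed.

Lemma competitor_mob_deriv phi : conformal_on D phi -> (forall z, D z -> unit_disk (phi z)) ->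
  Cmod (C_derive (fun z => mob (phi z0) (phi z)) z0) =
  Cmod (C_derive phi z0) / (1 - Cmod (phi z0) ^ 2).
Proof.
move=> [Hf _] Hd; have Ha : Cmod (phi z0) < 1 by apply: Hd.
have a0 := Cmod_ge_0 (phi z0).
rewrite (C_derive_comp D unit_disk) //; last exact: analytic_mob.
rewrite C_derive_mob_a // Cmod_mult Cmod_R Rabs_pos_eq; first by rewrite Rmult_comm.
by apply/Rlt_le/Rinv_0_lt_compat; nra.
Qed.

(** If [w] is omitted, the square root of [z - w] never takes opposite values, so
    it omits a disc, and inversion in that disc gives a bounded map. *)
Lemma competitor_exists : (exists w, ~ D w) -> exists phi, competitor phi.
Proof.
move=> [w Hw].
have Hid : conformal_on D (fun z => z - w)%C.
  split; first by apply: analytic_intro => z _; eexists;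
    apply: has_deriv_minus (has_deriv_id _) (has_deriv_const _ _).
  move=> u v _ _ E; have -> : u = (u - w + w)%C by ring.
  by rewrite E; ring.
have nz z : D z -> (z - w)%C <> 0 by move=> Dz /Cminus_0_eq E; apply: Hw; rewrite -E.
have [h [Hh hh]] := analytic_sqrt D _ D_sc (proj1 Hid) nz.
have ch := conformal_sqrt _ _ _ Hid Hh hh.
have hn z : D z -> h z <> 0 by move=> Dz E; apply: (nz z Dz); rewrite -hh // E; ring.
have opp z u : D z -> D u -> h z <> (- h u)%C.
  move=> Dz Du E.
  have Ezu : z = u.
    apply: (proj2 Hid) => //; rewrite -!hh // E; ring.
  apply: (hn u Du); rewrite Ezu in E.
  have -> : h u = ((h u + h u) / 2)%C by field.
  by rewrite {1}E; field.
have [r [r0 Hr]] := open_C_disc D z0 D_open Dz0.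
have [m [m0 Hm]] := conformal_open_map D h z0 r ch r0 Hr.
have far z : D z -> m <= Cmod (h z + h z0).
  move=> Dz; apply: Rnot_lt_le => K.
  have [u [Hu Eu]] : exists u, disc z0 r u /\ h u = (- h z)%C.
    apply: Hm; rewrite /disc; have -> : (- h z - h z0 = - (h z + h z0))%C by ring.
    by rewrite Cmod_opp.
  by apply: (opp u z) => //; apply: Hr.
have sn z : D z -> (h z + h z0)%C <> 0.
  by move=> Dz; apply/Cmod_gt_0; have := far z Dz; lra.
have m2 : RtoC (m / 2) <> 0 by move/RtoC_inj; lra.
pose phi z := (RtoC (m / 2) / (h z + h z0))%C.
have cphi : conformal_on D phi.
  split.
  - apply: analytic_intro => z Dz; eexists.
    exact: (has_deriv_div _ _ z _ _ (has_deriv_const _ z)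
      (has_deriv_plus _ _ _ _ _ (analytic_deriv _ _ _ Hh Dz) (has_deriv_const (h z0) z)) (sn z Dz)).
  - move=> z u Dz Du E; apply: (proj2 ch) => //.
    have nz' := sn z Dz; have nu := sn u Du.
    have -> : h z = (RtoC (m / 2) / phi z - h z0)%C by rewrite /phi; field; split.
    by rewrite E /phi; field; split.
exists (fun z => mob (phi z0) (phi z)); apply: competitor_mob => // z Dz.
rewrite /unit_disk /phi Cmod_div; last exact: sn.
rewrite Cmod_R Rabs_pos_eq; last lra.
have F := far z Dz; apply/Rlt_div_l; lra.
Qed.

(** If a competitor omits a value [a] of the disk, the square root of its
    composition with a disk automorphism vanishing at [a] yields a competitor
    with a larger derivative. *)
Lemma competitor_improve phi a : competitor phi -> unit_disk a -> ~ image phi D a ->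
  exists F, competitor F /\
    Cmod (C_derive F z0) * (2 * sqrt (Cmod a)) = Cmod (C_derive phi z0) * (1 + Cmod a).
Proof.
move=> [cphi [dphi phi0]] Ha Na.
have a0 : 0 < Cmod a.
  by apply/Cmod_gt_0 => E; apply: Na; exists z0; rewrite E.
have Ha' : Cmod a < 1 by [].
pose psi z := mob a (phi z).
have cpsi : conformal_on D psi by apply: conformal_comp cphi dphi (conformal_mob a Ha).
have npsi z : D z -> psi z <> 0.
  move=> Dz E; apply: Na; exists z; split=> //.
  by rewrite -(mob_inv a (phi z)) //; [rewrite -/(psi z) E mob_opp_a | apply: dphi].
have [s [Hs ss]] := analytic_sqrt D psi D_sc (proj1 cpsi) npsi.
have cs := conformal_sqrt _ _ _ cpsi Hs ss.
have ds z : D z -> unit_disk (s z).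
  move=> Dz; apply: sq_lt_1; first exact: Cmod_ge_0.
  have -> : Cmod (s z) ^ 2 = Cmod (psi z) by rewrite -ss // Cmod_mult; ring.
  by apply: mob_lt => //; apply: dphi.
exists (fun z => mob (s z0) (s z)); split; first exact: competitor_mob.
rewrite competitor_mob_deriv //.
have Es : Cmod (s z0) ^ 2 = Cmod a.
  have -> : Cmod (s z0) ^ 2 = Cmod (psi z0) by rewrite -ss // Cmod_mult; ring.
  by rewrite /psi phi0 mob_0 Cmod_opp.
have Esq : Cmod (s z0) = sqrt (Cmod a).
  by rewrite -Es /= Rmult_1_r sqrt_square //; apply: Cmod_ge_0.
have dpsi : C_derive psi z0 = (RtoC (1 - Cmod a ^ 2) * C_derive phi z0)%C.
  rewrite /psi (C_derive_comp D unit_disk) //; [|by case: cphi|exact: analytic_mob|exact: dphi].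
  by rewrite phi0 C_derive_mob_0.
have d2 : (C_derive psi z0 = 2 * s z0 * C_derive s z0)%C.
  have d1 := has_deriv_mult _ _ _ _ _ (analytic_deriv _ _ _ Hs Dz0) (analytic_deriv _ _ _ Hs Dz0).
  have d3 : has_deriv (fun z => s z * s z)%C z0 (C_derive psi z0).
    have [r [r0 Hr]] := open_C_disc D z0 D_open Dz0.
    apply: has_deriv_ext_loc (analytic_deriv _ _ _ (proj1 cpsi) Dz0).
    by exists r; split=> // z Hz; rewrite ss //; apply: Hr.
  by rewrite (has_deriv_uniq _ _ _ _ d3 d1); ring.
have := f_equal Cmod d2; rewrite dpsi !Cmod_mult !Cmod_R !Rabs_pos_eq; [|nra|nra].
rewrite Es Esq => K.
set x := Cmod (C_derive s z0) in K *; set y := Cmod (C_derive phi z0) in K *.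
have -> : x / (1 - Cmod a) * (2 * sqrt (Cmod a)) = 2 * sqrt (Cmod a) * x / (1 - Cmod a).
  by field; lra.
by rewrite -K; field; lra.
Qed.

Lemma competitor_deriv_pos phi : competitor phi -> 0 < Cmod (C_derive phi z0).
Proof. by move=> [cphi _]; apply/Cmod_gt_0/(conformal_deriv_neq D). Qed.

Lemma competitor_rotate phi : competitor phi ->
  exists psi, competitor psi /\ C_derive psi z0 = RtoC (Cmod (C_derive phi z0)).
Proof.
move=> Hphi; have dp := competitor_deriv_pos phi Hphi.
case: Hphi => [cphi [dphi phi0]].
set d := C_derive phi z0 in dp *.
have dn : d <> 0 by apply/Cmod_gt_0.
pose c := (RtoC (Cmod d) / d)%C.
have cm : Cmod c = 1 by rewrite /c Cmod_div // Cmod_R Rabs_pos_eq; [field | ]; lra.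
have cn : c <> 0 by apply/Cmod_gt_0; lra.
have Hd := has_deriv_mult _ _ _ _ _ (has_deriv_const c z0) (analytic_deriv _ _ _ (proj1 cphi) Dz0).
exists (fun z => c * phi z)%C; split; last first.
  by rewrite (C_derive_has _ _ _ Hd) -/d /c; field.
split; [split | split].
- apply: analytic_intro => z Dz; eexists.
  by apply: has_deriv_mult (has_deriv_const _ _) (analytic_deriv _ _ _ (proj1 cphi) Dz).
- move=> z w Dz Dw /(Cmult_cancel_l _ _ _ cn); exact: (proj2 cphi).
- by move=> z Dz; rewrite /unit_disk Cmod_mult cm Rmult_1_l; apply: dphi.
- by rewrite phi0 Cmult_0_r.
Qed.

(** A competitor whose derivative is within a factor [1 - e ^ 2] of the supremum
    [s] covers the disc of radius [1 - 3 * e]: an omitted value [a] would give a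
    competitor with derivative above [s], as [(1 + t ^ 2) / (2 * t)] exceeds
    [1 / (1 - e ^ 2)] for [t = sqrt |a|]. The choice [e = 1 / (n + 4)] keeps the
    radius positive. *)
Lemma extremal_sequence : (exists w, ~ D w) ->
  exists (s : R) (phi : nat -> C -> C) (p : nat -> R), 0 < s /\ forall n,
    competitor (phi n) /\ C_derive (phi n) z0 = RtoC (p n) /\ p n <= s /\
    s * (1 - (/ INR (n + 4)) ^ 2) < p n /\
    forall a, Cmod a < 1 - 3 * / INR (n + 4) -> image (phi n) D a.
Proof.
move=> Hw; have [phi0 Hphi0] := competitor_exists Hw.
have [r [r0 Hr]] := open_C_disc D z0 D_open Dz0.
pose E x := exists phi, competitor phi /\ x = Cmod (C_derive phi z0).
have [s [ub lub]] : {s | is_lub E s}.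
  apply: completeness; last by exists (Cmod (C_derive phi0 z0)), phi0.
  exists (1 / r) => _ [phi [[cphi [dphi pz]] ->]].
  apply: schwarz_deriv => //; first exact: analytic_sub Hr (proj1 cphi).
  by move=> w Hw'; apply/Rlt_le/dphi/Hr.
have sp : 0 < s.
  apply: Rlt_le_trans (competitor_deriv_pos _ Hphi0) _.
  by apply: ub; exists phi0.
have pick n : exists psi, competitor psi /\
    C_derive psi z0 = RtoC (Cmod (C_derive psi z0)) /\
    s * (1 - (/ INR (n + 4)) ^ 2) < Cmod (C_derive psi z0).
  apply: NNPP => none.
  have n4 : 0 < / INR (n + 4) by apply: Rinv_0_lt_compat; apply: lt_0_INR; lia.
  have q := pow_lt _ 2 n4.
  suff K : s <= s * (1 - (/ INR (n + 4)) ^ 2) by nra.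
  apply: lub => _ [phi [Hphi ->]]; apply: Rnot_lt_le => K; apply: none.
  have [psi [Hpsi Epsi]] := competitor_rotate phi Hphi.
  exists psi; split=> //; rewrite Epsi Cmod_R Rabs_pos_eq; last exact: Cmod_ge_0.
  by split.
pose phi n := proj1_sig (constructive_indefinite_description _ (pick n)).
have Hphi n := proj2_sig (constructive_indefinite_description _ (pick n)).
exists s, phi, (fun n => Cmod (C_derive (phi n) z0)); split=> // n.
have [H1 [H2 H3]] := Hphi n; rewrite -/(phi n) in H1 H2 H3.
do 2 (split=> //); split; first by apply: ub; exists (phi n).
split=> // a Ha; apply: NNPP => Na.
have n4 : 4 <= INR (n + 4).
  by rewrite plus_INR /=; have := pos_INR n; lra.
set e := / INR (n + 4) in H3 Ha.
have e0 : 0 < e <= / 4.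
  by split; [apply: Rinv_0_lt_compat; lra | apply: Rinv_le_contravar; lra].
have [F [HF EF]] := competitor_improve (phi n) a H1 ltac:(rewrite /unit_disk; lra) Na.
have FS : Cmod (C_derive F z0) <= s by apply: ub; exists F.
set t := sqrt (Cmod a) in EF.
have t0 : 0 <= t by apply: sqrt_pos.
have tt : t * t = Cmod a by apply/sqrt_sqrt/Cmod_ge_0.
set x := Cmod (C_derive (phi n) z0) in H3 EF; set y := Cmod (C_derive F z0) in FS EF.
have K1 : x * (1 + t * t) <= s * (2 * t).
  by rewrite tt -EF; apply: Rmult_le_compat_r; lra.
have K2 : s * ((1 - e ^ 2) * (1 + t * t)) < s * (2 * t).
  apply: Rlt_le_trans K1; rewrite -Rmult_assoc; apply: Rmult_lt_compat_r; [nra | exact: H3].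
have {}K2 := Rmult_lt_reg_l _ _ _ sp K2.
have t1 : t < 1 by nra.
have K3 : (1 - t) ^ 2 < 2 * e ^ 2 by nra.
have K4 : 1 - t < 3 / 2 * e.
  apply: Rnot_le_lt => K; have : (3 / 2 * e) ^ 2 <= (1 - t) ^ 2 by apply: pow_incr; lra.
  nra.
nra.
Qed.

End ExtremalProblem.

(** * The Riemann mapping theorem *)

Lemma C_complete (u : nat -> C) :
  (forall e, 0 < e -> exists N, forall m n, (N <= m)%nat -> (N <= n)%nat ->
     Cmod (u m - u n) <= e) ->
  exists l, forall e, 0 < e -> exists N, forall n, (N <= n)%nat -> Cmod (u n - l) <= e.
Proof.
move=> Hu.
have part (h : C -> R) : (forall c, Rabs (h c) <= Cmod c) ->
    (forall x y, h (x - y)%C = h x - h y) -> {l | Un_cv (fun n => h (u n)) l}.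
  move=> Hh Hs; apply: Rcomplete.R_complete => e He.
  have [N HN] := Hu (e / 2) ltac:(lra); exists N => m n Hm Hn.
  rewrite /R_dist -Hs; apply: Rle_lt_trans (Hh _) _.
  by have := HN m n Hm Hn; lra.
have [a Ha] := part Re re_le_Cmod ltac:(by []).
have [b Hb] := part Im (fun c => Rle_trans _ _ _ (Rmax_r _ _) (Rmax_Cmod c)) ltac:(by []).
exists (a, b) => e He.
have [N1 H1] := Ha (e / 2) ltac:(lra); have [N2 H2] := Hb (e / 2) ltac:(lra).
exists (N1 + N2)%nat => n Hn.
have {}H1 := H1 n ltac:(lia); have {}H2 := H2 n ltac:(lia).
have E : (u n - (a, b) = RtoC (Re (u n) - a) + Ci * RtoC (Im (u n) - b))%C.
  by case: (u n) => x y; rewrite /Ci /Cminus /Cplus /Copp /Cmult /RtoC /=; congr pair; ring.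
rewrite E; apply: Rle_trans (Cmod_triangle _ _) _.
rewrite Cmod_mult Cmod_Ci !Cmod_R; rewrite /R_dist in H1 H2; lra.
Qed.

(** Schwarz's lemma for the composition of [c * H] with the disk automorphism
    vanishing at [c * al]; the factor [c < 1], which tends to one in the end, keeps
    the parameter inside the disk when [al = 1]. *)
Lemma near_extremal H al v : analytic_on unit_disk H ->
  (forall w, unit_disk w -> Cmod (H w) <= 1) -> H 0 = RtoC al -> 0 <= al <= 1 ->
  unit_disk v -> Cmod (H v - al) * (1 - Cmod v) <= 1 - al ^ 2.
Proof.
move=> HH bH H0 Hal Dv; have Dv' : Cmod v < 1 by [].
have v0 := Cmod_ge_0 v.
have step c : 0 < c < 1 -> c * (Cmod (H v - al) * (1 - Cmod v)) <= 1 - (c * al) ^ 2.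
  move=> Hc; pose K w := (c * H w)%C; pose be := c * al.
  have Hbe : 0 <= be < 1 by rewrite /be; nra.
  have mbe : Cmod be < 1 by rewrite Cmod_R Rabs_pos_eq; lra.
  have bK w : unit_disk w -> Cmod (K w) <= 1.
    move=> Dw; rewrite /K Cmod_mult Cmod_R Rabs_pos_eq; last lra.
    have := bH w Dw; have := Cmod_ge_0 (H w); nra.
  have HM : analytic_on (disc 0 1) (fun w => mob be (K w)).
    apply: analytic_intro => w /unit_disk_of_disc Dw; eexists.
    apply: (has_deriv_comp (mob be) K w); first exact: has_deriv_mob mbe (bK w Dw).
    by apply: has_deriv_mult (has_deriv_const _ _) (analytic_deriv _ _ _ HH Dw).
  have := schwarz_le (fun w => mob be (K w)) 0 1 1 v HM
    ltac:(by move=> w /unit_disk_of_disc Dw; apply: mob_le => //; apply: bK)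
    ltac:(by rewrite /K H0 -RtoC_mult; apply: mob_a)
    (disc_of_unit_disk v Dv).
  have -> : (v - 0 = v)%C by ring.
  rewrite Rdiv_1_r Rmult_1_l /mob => S.
  have den := mob_den be (K v) mbe (bK v Dv).
  rewrite Cmod_div // in S; have dp : 0 < Cmod (1 - Cconj be * K v) by apply/Cmod_gt_0.
  move/Rle_div_l: S => S; have {}S := S dp.
  have Ec : (1 - Cconj be * K v = RtoC (1 - be ^ 2) - be * (K v - be))%C.
    have -> : Cconj be = RtoC be by rewrite /Cconj /RtoC /= Ropp_0.
    by rewrite RtoC_minus /= Rmult_1_r RtoC_mult; ring.
  have T := Cmod_minus_le (RtoC (1 - be ^ 2)) (be * (K v - be))%C.
  rewrite -Ec Cmod_mult !Cmod_R !Rabs_pos_eq in T; [|lra|nra].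
  have EK : Cmod (K v - be) = c * Cmod (H v - al).
    have -> : (K v - be = c * (H v - al))%C by rewrite /K /be RtoC_mult; ring.
    by rewrite Cmod_mult Cmod_R Rabs_pos_eq; lra.
  rewrite -Rmult_assoc -EK -/be; set x := Cmod (K v - be) in S T *.
  have x0 : 0 <= x by apply: Cmod_ge_0.
  set y := Cmod (1 - Cconj be * K v) in S T dp.
  have : y <= 1 - be ^ 2 + x by nra.
  have : 0 <= (1 - be ^ 2) * (1 - Cmod v) by apply: Rmult_le_pos; nra.
  nra.
set X := Cmod (H v - al) * (1 - Cmod v) in step *.
have X0 : 0 <= X by apply: Rmult_le_pos; [apply: Cmod_ge_0 | lra].
apply: Rnot_lt_le => K.
pose d := Rmin (1 / 2) ((X - (1 - al ^ 2)) / (2 * (X + 2))).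
have d0 : 0 < d <= 1 / 2.
  by split; [apply: Rmin_pos; [lra | apply: Rdiv_lt_0_compat; lra] | apply: Rmin_l].
have d1 : d * (2 * (X + 2)) <= X - (1 - al ^ 2) by apply/Rle_div_r; [lra | apply: Rmin_r].
have := step (1 - d) ltac:(lra).
have : ((1 - d) * al) ^ 2 >= al ^ 2 - 2 * d.
  have : 0 <= d * (1 - al ^ 2) by apply: Rmult_le_pos; nra.
  have : 0 <= d ^ 2 * al ^ 2 by apply: Rmult_le_pos; apply: pow2_ge_0.
  nra.
nra.
Qed.

(** Schwarz's lemma for [phi] followed by the automorphism sending [phi z] to the
    origin; the bound depends on [rho] alone. *)
Lemma disk_valued_growth z R0 rho : 0 <= rho < 1 -> exists rho', 0 <= rho' < 1 /\
  forall phi u, analytic_on (disc z R0) phi -> (forall w, disc z R0 w -> unit_disk (phi w)) ->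
    Cmod (phi z) <= rho -> disc z (R0 / 2) u -> Cmod (phi u) <= rho'.
Proof.
move=> Hrho; pose k := 1 - 3 / 4 * (1 - rho) ^ 2.
have k01 : 0 <= k < 1 by rewrite /k; nra.
exists (sqrt k); split.
  split; first exact: sqrt_pos.
  by rewrite -sqrt_1; apply: sqrt_lt_1; lra.
move=> phi u Hphi Dphi Hz Hu.
have Hu' : Cmod (u - z) < R0 / 2 by [].
have R0p : 0 < R0 by have := Cmod_ge_0 (u - z); lra.
have Du : disc z R0 u by rewrite /disc; lra.
set a := phi z in Hz; have Ha : Cmod a < 1 by lra.
have a0 := Cmod_ge_0 a.
have HM : analytic_on (disc z R0) (fun w => mob a (phi w)).
  apply: analytic_intro => w Dw; eexists.
  apply: (has_deriv_comp (mob a) phi w); last exact: analytic_deriv Hphi Dw.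
  by apply: has_deriv_mob => //; apply/Rlt_le/Dphi.
have S := schwarz_le _ z R0 1 u HM
  ltac:(by move=> w Dw; apply: mob_le => //; apply/Rlt_le/Dphi) (mob_a a) Du.
set x := Cmod (mob a (phi u)) in S.
have x0 : 0 <= x by apply: Cmod_ge_0.
have x1 : x <= 1 / 2.
  apply: Rle_trans S _; have -> : 1 / R0 * Cmod (u - z) = Cmod (u - z) / R0 by field; lra.
  by apply/Rle_div_l; lra.
have b1 : Cmod (phi u) < 1 by apply: Dphi.
have I := mob_identity a (phi u) Ha (Rlt_le _ _ b1); rewrite -/x in I.
have Y : 1 - Cmod a <= Cmod (1 - Cconj a * phi u).
  have := Cmod_tri_sub 1 (1 - Cconj a * phi u).
  have -> : (1 - (1 - Cconj a * phi u) = Cconj a * phi u)%C by ring.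
  rewrite Cmod_1 Cmod_mult Cmod_conj; have := Cmod_ge_0 (phi u); nra.
set y := Cmod (1 - Cconj a * phi u) in I Y.
have p0 := Cmod_ge_0 (phi u).
have bk : Cmod (phi u) ^ 2 <= k.
  have A1 : (1 - rho) ^ 2 <= y ^ 2 by apply: pow_incr; lra.
  have A2 : 3 / 4 <= 1 - x ^ 2 by nra.
  have A3 : 3 / 4 * (1 - rho) ^ 2 <= (1 - x ^ 2) * y ^ 2.
    by apply: Rmult_le_compat; nra.
  have A4 : (1 - Cmod a ^ 2) * (1 - Cmod (phi u) ^ 2) <= 1 - Cmod (phi u) ^ 2.
    have : 0 <= 1 - Cmod (phi u) ^ 2 by nra.
    have := pow2_ge_0 (Cmod a); nra.
  rewrite /k; lra.
by rewrite -(sqrt_pow2 _ p0); apply: sqrt_le_1_alt.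
Qed.

Section RiemannLimit.

Variables (D : C -> Prop) (z0 : C) (s : R) (phi : nat -> C -> C) (p : nat -> R).
Hypothesis D_region : region D.
Hypothesis Dz0 : D z0.
Hypothesis s_pos : 0 < s.
Hypothesis phi_comp : forall n, competitor D z0 (phi n).
Hypothesis phi_deriv : forall n, C_derive (phi n) z0 = RtoC (p n).
Hypothesis p_le : forall n, p n <= s.

Let eta n := / INR (n + 4).
Let r n := 1 - 3 * eta n.

Hypothesis p_gt : forall n, s * (1 - eta n ^ 2) < p n.
Hypothesis phi_image : forall n a, Cmod a < r n -> image (phi n) D a.

Let D_open : open (T := C_UniformSpace) D := proj1 D_region.

Lemma eta_bounds n : 0 < eta n <= / 4.
Proof.
have n4 : 4 <= INR (n + 4) by rewrite plus_INR /=; have := pos_INR n; lra.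
by split; [apply: Rinv_0_lt_compat; lra | apply: Rinv_le_contravar; lra].
Qed.

Lemma eta_small e : 0 < e -> exists N, forall n, (N <= n)%nat -> eta n <= e.
Proof.
move=> He; have [N HN] := nfloor_ex (/ e) (Rlt_le _ _ (Rinv_0_lt_compat _ He)).
exists N => n Hn; rewrite -(Rinv_inv e); apply: Rinv_le_contravar.
  exact: Rinv_0_lt_compat.
rewrite plus_INR /=; have := le_INR _ _ Hn; lra.
Qed.

Lemma r_large rho : rho < 1 -> exists N, forall n, (N <= n)%nat -> rho < r n.
Proof.
move=> H; have [N HN] := eta_small ((1 - rho) / 4) ltac:(lra).
by exists N => n /HN; rewrite /r; lra.
Qed.

Let g n (w : C) : C := epsilon (inhabits z0) (fun z => D z /\ phi n z = w).

Lemma g_spec n w : Cmod w < r n -> D (g n w) /\ phi n (g n w) = w.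
Proof. by move=> /phi_image H; apply: (epsilon_spec (inhabits z0) _ H). Qed.

Lemma g_phi n z : D z -> g n (phi n z) = z.
Proof.
move=> Dz; have [_ inj] := proj1 (phi_comp n).
have [Dg E] : D (g n (phi n z)) /\ phi n (g n (phi n z)) = phi n z.
  by apply: (epsilon_spec (inhabits z0) (fun u => D u /\ phi n u = phi n z)); exists z.
exact: inj.
Qed.

Lemma phi_z0 n : phi n z0 = 0.
Proof. by case: (phi_comp n) => _ [_]. Qed.

Lemma g_0 n : g n 0 = z0.
Proof. by rewrite -(phi_z0 n) g_phi. Qed.

Lemma g_deriv n w : Cmod w < r n -> has_deriv (g n) w (/ C_derive (phi n) (g n w)).
Proof.
move=> Hw; have [Dg E] := g_spec n w Hw; rewrite -{1}E.
apply: (conformal_inverse_deriv D (phi n)) => //; first by case: (phi_comp n).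
by move=> z Dz; apply: g_phi.
Qed.

(** The comparison of two of the extremal maps; for large indices it is close to
    the identity. *)
Let tau n m w := phi n (g m w).

Lemma tau_disk n m w : Cmod w < r m -> unit_disk (tau n m w).
Proof. by move=> /g_spec [Dg _]; case: (phi_comp n) => _ [H _]; apply: H. Qed.

Lemma tau_0 n m : tau n m 0 = 0.
Proof. by rewrite /tau g_0 phi_z0. Qed.

Lemma tau_an n m : analytic_on (disc 0 (r m)) (tau n m).
Proof.
apply: analytic_intro => w; rewrite /disc; have -> : (w - 0 = w)%C by ring.
move=> Hw; eexists; apply: has_deriv_comp (g_deriv m w Hw).
by apply: analytic_deriv (proj1 (proj1 (phi_comp n))) _; case: (g_spec m w Hw).
Qed.

Lemma disc_0 rho w : disc 0 rho w <-> Cmod w < rho.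
Proof. by rewrite /disc; have -> : (w - 0 = w)%C by ring. Qed.

Lemma r_pos m : 1 / 4 <= r m < 1.
Proof. by have := eta_bounds m; rewrite /r; lra. Qed.

Lemma tau_bound n m w : disc 0 (r m) w -> Cmod (tau n m w) <= 1.
Proof. by move=> /disc_0 Hw; apply/Rlt_le/tau_disk. Qed.

Lemma tau_schwarz n m w : Cmod w < r m -> Cmod (tau n m w) <= Cmod w / r m.
Proof.
move=> Hw; have := schwarz_le (tau n m) 0 (r m) 1 w (tau_an n m)
  (tau_bound n m) (tau_0 n m) (proj2 (disc_0 _ _) Hw).
have -> : (w - 0 = w)%C by ring.
by rewrite /Rdiv Rmult_1_l Rmult_comm.
Qed.

Lemma p_pos n : 0 < p n.
Proof.
have He := eta_bounds n; apply: Rlt_trans (p_gt n).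
by apply: Rmult_lt_0_compat => //; nra.
Qed.

Lemma tau_deriv_0 n m : C_derive (tau n m) 0 = RtoC (p n / p m).
Proof.
have Hr : Cmod 0 < r m by rewrite Cmod_0; have := r_pos m; lra.
have pm := p_pos m.
have pn : RtoC (p m) <> 0 by move/RtoC_inj; lra.
have dphi := analytic_deriv _ _ _ (proj1 (proj1 (phi_comp n))) Dz0.
have := has_deriv_comp (phi n) (g m) 0 (C_derive (phi n) z0) _ _ (g_deriv m 0 Hr).
rewrite g_0 !phi_deriv => K; rewrite phi_deriv in dphi.
by rewrite (C_derive_has _ _ _ (K dphi)) RtoC_div //; apply: Rgt_not_eq.
Qed.

Lemma tau_lipschitz n m rho w w' : (1 + rho) / 2 < r m -> Cmod w <= rho -> rho < 1 ->
  Cmod (w' - w) < (1 - rho) / 2 -> Cmod (tau n m w' - tau n m w) <= 4 / (1 - rho) * Cmod (w' - w).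
Proof.
move=> Hr Hw rho1 Hw'.
have sub v : disc w ((1 - rho) / 2) v -> disc 0 (r m) v.
  rewrite /disc => Hv; have -> : (v - 0 = v - w + w)%C by ring.
  have := Cmod_triangle (v - w) w; lra.
have := bounded_lipschitz (tau n m) w ((1 - rho) / 2) 1 w'
  (analytic_sub _ _ _ sub (tau_an n m)) ltac:(by move=> v /sub; apply: tau_bound) Hw'.
have -> : 2 * 1 / ((1 - rho) / 2) = 4 / (1 - rho) by field; lra.
by [].
Qed.

(** Both the radius [r m] and the derivative [p n / p m] of [tau n m] at the origin
    are close to one, so [tau n m w / w] is nearly constant. *)
Lemma tau_near_id n m rho w : (1 + rho) / 2 < r m -> Cmod w <= rho -> 0 <= rho < 1 ->
  Cmod (tau n m w - w) <= 6 * (3 * eta m + eta n) / (1 - rho).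
Proof.
move=> Hr Hw Hrho; have rm := r_pos m.
have em := eta_bounds m; have en := eta_bounds n; have pm := p_pos m; have pn := p_pos n.
pose H v := (r m * dquot (tau n m) 0 (r m * v))%C.
have in_disc v : unit_disk v -> disc 0 (r m) (r m * v)%C.
  rewrite /unit_disk => Hv; apply/disc_0; rewrite Cmod_mult Cmod_R Rabs_pos_eq; last lra.
  have := Cmod_ge_0 v; nra.
have rn0 : RtoC (r m) <> 0 by move/RtoC_inj; lra.
have HH : analytic_on unit_disk H.
  apply: analytic_intro => v Dv; eexists.
  apply: has_deriv_mult (has_deriv_const _ _) _.
  apply: (has_deriv_comp (dquot (tau n m) 0) (fun v => r m * v)%C v).
  - apply: analytic_deriv (analytic_dquot _ _ 0 (disc_open 0 (r m)) (tau_an n m) _) (in_disc v Dv).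
    by apply: disc_center; lra.
  - exact: has_deriv_mult (has_deriv_const _ _) (has_deriv_id _).
have bH v : unit_disk v -> Cmod (H v) <= 1.
  move=> Dv; rewrite /H Cmod_mult Cmod_R Rabs_pos_eq; last lra.
  have := schwarz (tau n m) 0 (r m) 1 _ (tau_an n m) (tau_bound n m) (tau_0 n m) (in_disc v Dv).
  by move/Rle_div_r => K; rewrite Rmult_comm; apply: K; lra.
pose al := r m * (p n / p m).
have H0 : H 0 = RtoC al.
  by rewrite /H Cmult_0_r dquot_b tau_deriv_0 -RtoC_mult.
have q1 : 1 - eta n ^ 2 <= p n / p m.
  apply/Rle_div_r => //; have := p_gt n; have := p_le m; nra.
have al1 : al <= 1.
  have := bH 0 ltac:(by rewrite /unit_disk Cmod_0; lra).
  rewrite H0 Cmod_R; have := Rle_abs al; lra.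
have al2 : 1 - (3 * eta m + eta n) <= al.
  have : r m * (1 - eta n ^ 2) <= al by apply: Rmult_le_compat_l; lra.
  rewrite /r; nra.
have al0 : 0 <= al.
  by apply: Rmult_le_pos; [lra | apply/Rlt_le/Rdiv_lt_0_compat].
pose v := (w / r m)%C.
have Ev : (r m * v = w)%C by rewrite /v; field.
have mv : Cmod v = Cmod w / r m by rewrite /v Cmod_div // Cmod_R Rabs_pos_eq; lra.
have mv1 : Cmod v <= (1 + rho) / 2.
  by rewrite mv; apply/Rle_div_l; [lra | nra].
have Dv : unit_disk v by rewrite /unit_disk; lra.
have N := near_extremal H al v HH bH H0 ltac:(by split) Dv.
have T : (tau n m w - w = v * ((H v - al) + RtoC (al - r m)))%C.
  have := dquot_spec (tau n m) 0 w; rewrite tau_0 => E.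
  have -> : tau n m w = (dquot (tau n m) 0 w * (w - 0))%C by rewrite -E; ring.
  by rewrite /H Ev RtoC_minus -{2 3}Ev; ring.
rewrite T Cmod_mult.
have T2 := Cmod_triangle (H v - al) (RtoC (al - r m)); rewrite Cmod_R in T2.
set x := Cmod (H v - al) in N T2; set e := 3 * eta m + eta n in al2 *.
have x0 : 0 <= x by apply: Cmod_ge_0.
have e0 : 0 < e by rewrite /e; lra.
have N1 : x * ((1 - rho) / 2) <= 2 * e.
  have : x * ((1 - rho) / 2) <= x * (1 - Cmod v) by apply: Rmult_le_compat_l; lra.
  nra.
have A : Rabs (al - r m) <= e.
  by apply: Rabs_le; rewrite /r -/e in al2 *; rewrite /e in al2 *; lra.
have v0 := Cmod_ge_0 v.
have Y0 := Cmod_ge_0 (H v - al + RtoC (al - r m)).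
apply: (Rle_trans _ (x + Rabs (al - r m))); first nra.
apply/Rle_div_r; first lra.
nra.
Qed.

Lemma tau_near_id_eps rho e : 0 <= rho < 1 -> 0 < e ->
  exists N, forall n m w, (N <= n)%nat -> (N <= m)%nat -> Cmod w <= rho ->
    (1 + rho) / 2 < r m /\ Cmod (tau n m w - w) <= e.
Proof.
move=> Hrho He.
have [N1 H1] := r_large ((1 + rho) / 2) ltac:(lra).
have [N2 H2] := eta_small (e * (1 - rho) / 24) ltac:(nra).
exists (N1 + N2)%nat => n m w Hn Hm Hw.
have Hr := H1 m ltac:(lia); split=> //.
apply: Rle_trans (tau_near_id n m rho w Hr Hw Hrho) _.
apply/Rle_div_l; first lra.
have := H2 n ltac:(lia); have := H2 m ltac:(lia); lra.
Qed.

Lemma g_tau m m' w : Cmod w < r m' -> g m (tau m m' w) = g m' w.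
Proof. by move=> /g_spec [Dg _]; rewrite /tau g_phi. Qed.

(** [tau n m'] is the composition of [tau n m] with [tau m m'], which is close to
    the identity; [tau n m] is Lipschitz with a constant independent of [n]. *)
Lemma tau_cauchy rho e : 0 <= rho < 1 -> 0 < e ->
  exists N, forall n m m' w, (N <= m)%nat -> (N <= m')%nat -> Cmod w <= rho ->
    Cmod (tau n m' w - tau n m w) <= e.
Proof.
move=> Hrho He; pose d := Rmin ((1 - rho) / 4) (e * (1 - rho) / 4).
have d0 : 0 < d by apply: Rmin_pos; nra.
have [N HN] := tau_near_id_eps rho d Hrho d0.
exists N => n m m' w Hm Hm' Hw.
have [Hr _] := HN m m w Hm Hm Hw.
have [Hr' Hd] := HN m m' w Hm Hm' Hw.
have -> : tau n m' w = tau n m (tau m m' w) by rewrite {1 2}/tau g_tau //; lra.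
have d1 : d <= (1 - rho) / 4 by apply: Rmin_l.
have d2 : d <= e * (1 - rho) / 4 by apply: Rmin_r.
apply: Rle_trans (tau_lipschitz n m rho w (tau m m' w) Hr Hw ltac:(lra) ltac:(lra)) _.
have -> : 4 / (1 - rho) * Cmod (tau m m' w - w) = 4 * Cmod (tau m m' w - w) / (1 - rho).
  by field; lra.
apply/Rle_div_l; lra.
Qed.

Lemma tau_limit n w : unit_disk w -> exists l, forall e, 0 < e ->
  exists N, forall m, (N <= m)%nat -> Cmod (tau n m w - l) <= e.
Proof.
move=> Dw; apply: C_complete => e He.
have [N HN] := tau_cauchy (Cmod w) e (conj (Cmod_ge_0 w) Dw) He.
by exists N => m m' Hm Hm'; apply: HN => //; apply: Rle_refl.
Qed.

(** The limit of [tau n m] as [m] tends to infinity. It represents [phi n] composed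
    with the Riemann map to be constructed. *)
Let T n w := epsilon (inhabits (RtoC 0)) (fun l => forall e, 0 < e ->
  exists N, forall m, (N <= m)%nat -> Cmod (tau n m w - l) <= e).

Lemma T_spec n w : unit_disk w -> forall e, 0 < e ->
  exists N, forall m, (N <= m)%nat -> Cmod (tau n m w - T n w) <= e.
Proof. by move=> /(tau_limit n) H; apply: (epsilon_spec (inhabits (RtoC 0)) _ H). Qed.

Lemma T_uniform rho e : 0 <= rho < 1 -> 0 < e ->
  exists N, forall n m w, (N <= m)%nat -> Cmod w <= rho -> Cmod (tau n m w - T n w) <= e.
Proof.
move=> Hrho He; have [N HN] := tau_cauchy rho e Hrho He.
exists N => n m w Hm Hw; apply: le_epsilon => e' He'.
have Dw : unit_disk w by rewrite /unit_disk; lra.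
have [N' HN'] := T_spec n w Dw e' He'.
have := HN n (N + N')%nat m w ltac:(lia) Hm Hw; have := HN' (N + N')%nat ltac:(lia).
have -> : (tau n m w - T n w = (tau n m w - tau n (N + N')%nat w) + (tau n (N + N')%nat w - T n w))%C.
  by ring.
have := Cmod_triangle (tau n m w - tau n (N + N')%nat w) (tau n (N + N')%nat w - T n w).
lra.
Qed.

Lemma T_an n : analytic_on unit_disk (T n).
Proof.
apply: analytic_intro => w Dw; have Dw' : Cmod w < 1 by [].
pose rho := (Cmod w + 1) / 2; have w0 := Cmod_ge_0 w.
have [N0 HN0] := r_large rho ltac:(rewrite /rho; lra).
have A : analytic_on (disc 0 rho) (T n).
  apply: (uniform_limit_analytic (fun k => tau n (N0 + k)%nat)).
  - move=> k; apply: analytic_sub (tau_an n (N0 + k)%nat) => v /disc_0 Hv; apply/disc_0.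
    by have := HN0 (N0 + k)%nat ltac:(lia); lra.
  - move=> e He; have [N HN] := T_uniform rho e ltac:(rewrite /rho; lra) He.
    exists N => v /disc_0 Hv; apply: HN; [lia | lra].
exists (C_derive (T n) w); apply: analytic_deriv A _; apply/disc_0; rewrite /rho; lra.
Qed.

Lemma T_le n w : unit_disk w -> Cmod (T n w) <= Cmod w.
Proof.
move=> Dw; have Dw' : Cmod w < 1 by [].
apply: le_epsilon => e He; have w0 := Cmod_ge_0 w.
have [N1 H1] := T_spec n w Dw (e / 2) ltac:(lra).
have [N2 H2] := r_large (Cmod w) Dw'.
have [N3 H3] := r_large (1 - e / 8) ltac:(lra).
pose m := (N1 + N2 + N3)%nat.
have {}H1 := H1 m ltac:(rewrite /m; lia); have {}H2 := H2 m ltac:(rewrite /m; lia).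
have {}H3 := H3 m ltac:(rewrite /m; lia).
have := tau_schwarz n m w H2; have rm := r_pos m.
have : Cmod w / r m <= Cmod w + e / 2 by apply/Rle_div_l; [lra | nra].
have := Cmod_tri_sub (T n w) (tau n m w); rewrite (Cmod_sub_sym (T n w)); lra.
Qed.

Lemma g_T_limit n w : Cmod w < r n -> forall e, 0 < e ->
  exists N, forall m, (N <= m)%nat -> Cmod (g m w - g n (T n w)) < e.
Proof.
move=> Hw e He; have rn := r_pos n.
have Dw : unit_disk w by rewrite /unit_disk; lra.
have HT : Cmod (T n w) < r n by apply: Rle_lt_trans (T_le n w Dw) Hw.
have [d [Hd K]] := proj1 (cont_C_eps _ _) (has_deriv_cont _ _ _ (g_deriv n _ HT)) e He.
have [N1 H1] := T_spec n w Dw (d / 2) ltac:(lra).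
have [N2 H2] := r_large (Cmod w) Dw.
exists (N1 + N2)%nat => m Hm.
rewrite -(g_tau n m w); last by apply: H2; lia.
by apply: K; have := H1 m ltac:(lia); lra.
Qed.

Lemma g_T_consistent n m w : Cmod w < r n -> Cmod w < r m -> g n (T n w) = g m (T m w).
Proof.
move=> Hn Hm; apply/Cminus_0_eq/Cmod_eq_0/Rle_antisym; last exact: Cmod_ge_0.
apply: le_epsilon => e He; rewrite Rplus_0_l.
have [N1 H1] := g_T_limit n w Hn (e / 2) ltac:(lra).
have [N2 H2] := g_T_limit m w Hm (e / 2) ltac:(lra).
have {}H1 := H1 (N1 + N2)%nat ltac:(lia); have {}H2 := H2 (N1 + N2)%nat ltac:(lia).
have -> : (g n (T n w) - g m (T m w) =
  (g (N1 + N2)%nat w - g m (T m w)) - (g (N1 + N2)%nat w - g n (T n w)))%C by ring.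
apply: Rle_trans (Cmod_minus_le _ _) _; lra.
Qed.

Lemma index_exists w : unit_disk w -> exists n, Cmod w < r n.
Proof. by move=> Dw; have [N HN] := r_large (Cmod w) Dw; exists N; apply: HN. Qed.

(** The limit of [g m w]; written as [g n (T n w)], it visibly lies in [D] and
    depends analytically on [w]. *)
Let G w := let n := epsilon (inhabits 0%nat) (fun n => Cmod w < r n) in g n (T n w).

Lemma G_eq n w : Cmod w < r n -> G w = g n (T n w).
Proof.
move=> Hw; apply: g_T_consistent => //.
by apply: (epsilon_spec (inhabits 0%nat) (fun n => Cmod w < r n)); exists n.
Qed.

Lemma G_in w : unit_disk w -> D (G w).
Proof.
move=> Dw; have [n Hn] := index_exists w Dw; rewrite (G_eq n w Hn).
by apply: (proj1 (g_spec n _ _)); apply: Rle_lt_trans (T_le n w Dw) Hn.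
Qed.

Lemma G_0 : G 0 = z0.
Proof.
have D0 := unit_disk_0.
have Hn : Cmod 0 < r 0 by rewrite Cmod_0; have := r_pos 0; lra.
rewrite (G_eq 0 0 Hn); have -> : T 0%nat 0 = 0; last exact: g_0.
apply/Cmod_eq_0/Rle_antisym; last exact: Cmod_ge_0.
by have := T_le 0 0 D0; rewrite Cmod_0.
Qed.

Lemma G_an : analytic_on unit_disk G.
Proof.
apply: analytic_intro => w Dw; have [n Hn] := index_exists w Dw.
have HT := Rle_lt_trans _ _ _ (T_le n w Dw) Hn.
have Hd := has_deriv_comp (g n) (T n) w _ _ (g_deriv n _ HT) (analytic_deriv _ _ _ (T_an n) Dw).
eexists; apply: has_deriv_ext_loc Hd.
have [d [d0 Hd]] := disc_near 0 (r n) w (proj2 (disc_0 _ _) Hn).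
by exists d; split=> // v /Hd /disc_0 Hv; rewrite (G_eq n v Hv).
Qed.

Lemma phi_G n w : Cmod w < r n -> phi n (G w) = T n w.
Proof.
move=> Hw; have rn := r_pos n; have Dw : unit_disk w by rewrite /unit_disk; lra.
rewrite (G_eq n w Hw); apply: (proj2 (g_spec n _ _)).
exact: Rle_lt_trans (T_le n w Dw) Hw.
Qed.

Lemma T_near_id w e : unit_disk w -> 0 < e ->
  exists N, forall n, (N <= n)%nat -> Cmod w < r n /\ Cmod (T n w - w) <= e.
Proof.
move=> Dw He; have w0 := Cmod_ge_0 w.
have [N HN] := tau_near_id_eps (Cmod w) (e / 2) (conj w0 Dw) ltac:(lra).
exists N => n Hn; have [N' HN'] := T_spec n w Dw (e / 2) ltac:(lra).
have [H1 _] := HN n n w Hn Hn (Rle_refl _).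
split; first by have : Cmod w < 1 by []; lra.
have [_ H2] := HN n (N + N')%nat w Hn ltac:(lia) (Rle_refl _).
have H3 := HN' (N + N')%nat ltac:(lia).
have -> : (T n w - w = (tau n (N + N')%nat w - w) - (tau n (N + N')%nat w - T n w))%C by ring.
apply: Rle_trans (Cmod_minus_le _ _) _; lra.
Qed.

(** [T n w = phi n (G w)] is determined by [G w] and tends to [w]. *)
Lemma G_inj : injective_on unit_disk G.
Proof.
move=> w v Dw Dv E.
apply/Cminus_0_eq/Cmod_eq_0/Rle_antisym; last exact: Cmod_ge_0.
apply: le_epsilon => e He; rewrite Rplus_0_l.
have [N1 H1] := T_near_id w (e / 2) Dw ltac:(lra).
have [N2 H2] := T_near_id v (e / 2) Dv ltac:(lra).
have [R1 K1] := H1 (N1 + N2)%nat ltac:(lia).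
have [R2 K2] := H2 (N1 + N2)%nat ltac:(lia).
have ET : T (N1 + N2)%nat w = T (N1 + N2)%nat v by rewrite -!phi_G // E.
have -> : (w - v = (T (N1 + N2)%nat v - v) - (T (N1 + N2)%nat w - w))%C by rewrite ET; ring.
apply: Rle_trans (Cmod_minus_le _ _) _; lra.
Qed.

(** The extremal maps do not push any point of [D] to the unit circle: the set of
    points that stay inside is open, closed and contains [z0]. *)
Lemma phi_bounded z : D z -> exists rho, 0 <= rho < 1 /\ forall n, Cmod (phi n z) <= rho.
Proof.
pose good z := exists rho, 0 <= rho < 1 /\ forall n, Cmod (phi n z) <= rho.
have spread u v R0 : (forall w, disc u R0 w -> D w) -> good u -> disc u (R0 / 2) v -> good v.
  move=> HD [rho [Hrho Hu]] Hv.
  have [rho' [Hrho' K]] := disk_valued_growth u R0 rho Hrho.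
  exists rho'; split=> // n; apply: (K (phi n) v) => //.
  - exact: analytic_sub HD (proj1 (proj1 (phi_comp n))).
  - by move=> w Hw; case: (phi_comp n) => _ [H _]; apply/H/HD.
move=> Dz; apply: NNPP => bad.
have [u [_ [[_ Gu] [_ Bu]]]] : exists u, D u /\ (D u /\ good u) /\ (D u /\ ~ good u).
  apply: (proj2 D_region).
  - move=> u [Du Gu]; have [R0 [R0p HD]] := open_C_disc D u D_open Du.
    apply/locally_C_iff; exists (R0 / 2); split; first lra.
    move=> v Hv; split; first by apply: HD; rewrite /disc; lra.
    exact: (spread u v R0).
  - move=> u [Du Bu]; have [R0 [R0p HD]] := open_C_disc D u D_open Du.
    apply/locally_C_iff; exists (R0 / 4); split; first lra.
    move=> v Hv; split; first by apply: HD; rewrite /disc; lra.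
    move=> Gv; apply: Bu; apply: (spread v u (R0 / 2)) => //.
    + move=> w Hw; apply: HD; rewrite /disc in Hw *.
      have -> : (w - u = (w - v) + (v - u))%C by ring.
      by have := Cmod_triangle (w - v) (v - u); lra.
    + by rewrite /disc Cmod_sub_sym; lra.
  - by move=> u Du; case: (classic (good u)); [left | right].
  - exists z0; do 2 (split=> //); exists 0; split; first lra.
    by move=> n; rewrite phi_z0 Cmod_0; lra.
  - by exists z.
by [].
Qed.

(** For [z] in [D] the points [phi n z] form a Cauchy sequence, because
    [phi n z = tau n m (phi m z)]; its limit is the preimage of [z]. *)
Lemma G_onto z : D z -> exists w, unit_disk w /\ G w = z.
Proof.
move=> Dz; have [rho [Hrho Hz]] := phi_bounded z Dz.
have tau_phi n m : tau n m (phi m z) = phi n z by rewrite /tau g_phi.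
have [w Hw] : exists w, forall e, 0 < e -> exists N, forall n, (N <= n)%nat -> Cmod (phi n z - w) <= e.
  apply: C_complete => e He; have [N HN] := tau_near_id_eps rho e Hrho He.
  exists N => n m Hn Hm; rewrite -(tau_phi n m).
  by case: (HN n m (phi m z) Hn Hm (Hz m)).
have w_rho : Cmod w <= rho.
  apply: le_epsilon => e He; have [N HN] := Hw e He.
  have := HN N (le_n _); have := Hz N; have := Cmod_tri_sub w (phi N z).
  rewrite (Cmod_sub_sym w); lra.
have Dw : unit_disk w by rewrite /unit_disk; lra.
exists w; split=> //.
have [n Hn] := index_exists w Dw.
have ET : T n w = phi n z.
  apply/Cminus_0_eq/Cmod_eq_0/Rle_antisym; last exact: Cmod_ge_0.
  apply: le_epsilon => e He; rewrite Rplus_0_l.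
  pose d := Rmin ((1 - rho) / 4) (e * (1 - rho) / 8).
  have d0 : 0 < d by apply: Rmin_pos; nra.
  have d1 : d <= (1 - rho) / 4 by apply: Rmin_l.
  have d2 : d <= e * (1 - rho) / 8 by apply: Rmin_r.
  have [N1 H1] := T_spec n w Dw (e / 2) ltac:(lra).
  have [N2 H2] := Hw d d0.
  have [N3 H3] := r_large ((1 + rho) / 2) ltac:(lra).
  pose m := (N1 + N2 + N3)%nat.
  have {}H1 := H1 m ltac:(rewrite /m; lia); have {}H2 := H2 m ltac:(rewrite /m; lia).
  have {}H3 := H3 m ltac:(rewrite /m; lia).
  have L := tau_lipschitz n m rho w (phi m z) H3 w_rho ltac:(lra) ltac:(lra).
  rewrite tau_phi in L.
  have L2 : 4 / (1 - rho) * Cmod (phi m z - w) <= e / 2.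
    have -> : 4 / (1 - rho) * Cmod (phi m z - w) = 4 * Cmod (phi m z - w) / (1 - rho).
      by field; lra.
    apply/Rle_div_l; lra.
  have -> : (T n w - phi n z = - ((tau n m w - T n w) + (phi n z - tau n m w)))%C by ring.
  rewrite Cmod_opp; apply: Rle_trans (Cmod_triangle _ _) _; lra.
by rewrite (G_eq n w Hn) ET g_phi.
Qed.

Lemma riemann_limit : exists G, conformal_on unit_disk G /\
  (forall w, unit_disk w -> D (G w)) /\
  (forall z, D z -> exists w, unit_disk w /\ G w = z) /\ G 0 = z0.
Proof.
exists G; split; first by split; [apply: G_an | apply: G_inj].
by split; [apply: G_in | split; [apply: G_onto | apply: G_0]].
Qed.

End RiemannLimit.

(** The inverses of near-extremal competitors converge, because Schwarz's lemma
    controls their mutual comparisons. *)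
Theorem riemann_mapping (D : C -> Prop) (z0 : C) :
  simply_connected_region D -> (exists w, ~ D w) -> D z0 ->
  exists G, conformal_on unit_disk G /\
    (forall w, unit_disk w -> D (G w)) /\
    (forall z, D z -> exists w, unit_disk w /\ G w = z) /\ G 0 = z0.
Proof.
move=> Hsc Hw Dz0.
have [s [phi [p [s0 H]]]] := extremal_sequence D z0 Hsc Dz0 Hw.
apply: (riemann_limit D z0 s phi p) => //; try by move=> n; case: (H n) => ? [? [? [? ?]]].
exact: (proj1 Hsc).
Qed.

(** * The hyperbolic density *)

(** Disk automorphisms are isometries of the hyperbolic metric of the disk. *)
Lemma mob_invariance a z : Cmod a < 1 -> unit_disk z ->
  Cmod (C_derive (mob a) z) * (1 - Cmod z ^ 2) = 1 - Cmod (mob a z) ^ 2.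
Proof.
move=> Ha Hz; have Hz' : Cmod z <= 1 by apply/Rlt_le.
have den := mob_den a z Ha Hz'; have dp : 0 < Cmod (1 - Cconj a * z) by apply/Cmod_gt_0.
rewrite (C_derive_has _ _ _ (has_deriv_mob a z Ha Hz')).
rewrite Cmod_div; last exact: Cmult_neq_0.
have a0 := Cmod_ge_0 a; rewrite Cmod_mult Cmod_R Rabs_pos_eq; last nra.
have I := mob_identity a z Ha Hz'.
apply: (Rmult_eq_reg_r (Cmod (1 - Cconj a * z) ^ 2)); last by apply: pow_nonzero; lra.
by rewrite I; field; lra.
Qed.

Lemma one_minus_sq_pos z : unit_disk z -> 0 < 1 - Cmod z ^ 2.
Proof. by rewrite /unit_disk; have := Cmod_ge_0 z; nra. Qed.

(** If [|s'(0)| > 1], the hypothesis forces [|s'| < |s'(0)|] on small circles,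
    against the maximum principle. *)
Lemma local_ahlfors s e : 0 < e <= 1 -> analytic_on (disc 0 e) s -> s 0 = 0 ->
  (forall w, disc 0 e w -> Cmod (C_derive s w) * (1 - Cmod w ^ 2) <=
     Cmod (C_derive s 0) * (1 - Cmod (s w) ^ 2)) ->
  Cmod (C_derive s 0) <= 1.
Proof.
move=> He Hs s0 H; apply: Rnot_lt_le; set A := Cmod (C_derive s 0) in H * => A1.
pose B := (1 + A) / 2.
have D0 : disc 0 e 0 by apply: disc_center; lra.
have ch := analytic_cont _ _ _ (analytic_dquot _ s 0 (disc_open 0 e) Hs D0) D0.
have [d [Hd K]] := proj1 (cont_C_eps _ _) ch (A - B) ltac:(rewrite /B; lra).
pose r := Rmin d e / 2.
have Hm : 0 < Rmin d e by apply: Rmin_pos; lra.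
have rd : r < d by have := Rmin_l d e; rewrite /r; lra.
have re : r < e by have := Rmin_r d e; rewrite /r; lra.
have r0 : 0 < r by rewrite /r; lra.
pose M := A * (1 - (B * r) ^ 2) / (1 - r ^ 2).
have r2 : 0 < 1 - r ^ 2 by nra.
have MA : M < A.
  apply/Rlt_div_l => //; apply: Rmult_lt_compat_l; first lra.
  have B2 : 1 < B ^ 2 by rewrite /B; nra.
  have r3 : 0 < r ^ 2 by apply: pow_lt.
  rewrite Rpow_mult_distr; have := Rmult_lt_compat_r _ _ _ r3 B2; lra.
have := maximum_principle (C_derive s) 0 r e M 0 re
  (analytic_derivative _ _ (disc_open 0 e) Hs).
move=> G; have : A <= M; last lra.
apply: G; last exact: disc_center.
move=> t _; have Ec : (circ 0 r t - 0 = circ 0 r t)%C by ring.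
have mc : Cmod (circ 0 r t) = r by rewrite -Ec circ_dist; lra.
have Dc : disc 0 e (circ 0 r t) by rewrite /disc Ec mc.
have Hc := H _ Dc; rewrite mc in Hc.
apply/Rle_div_r => //; apply: Rle_trans Hc _.
apply: Rmult_le_compat_l; first lra.
have Sc : B * r <= Cmod (s (circ 0 r t)).
  have := dquot_spec s 0 (circ 0 r t); rewrite s0 Ec => E.
  have -> : s (circ 0 r t) = (dquot s 0 (circ 0 r t) * circ 0 r t)%C by rewrite -E; ring.
  rewrite Cmod_mult mc; apply: Rmult_le_compat_r; first lra.
  have := K (circ 0 r t) ltac:(by rewrite Ec mc); rewrite dquot_b.
  have := Cmod_tri_sub (C_derive s 0) (dquot s 0 (circ 0 r t)); rewrite -/A.
  rewrite (Cmod_sub_sym (C_derive s 0)); lra.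
have : (B * r) ^ 2 <= Cmod (s (circ 0 r t)) ^ 2.
  by apply: pow_incr; split=> //; apply: Rmult_le_pos; rewrite /B; lra.
lra.
Qed.

Definition disk_retraction (w : C) : C := (w / RtoC (Rmax 1 (Cmod w)))%C.

Lemma disk_retraction_le w : Cmod (disk_retraction w) <= 1.
Proof.
have m1 := Rmax_l 1 (Cmod w); have m2 := Rmax_r 1 (Cmod w).
rewrite /disk_retraction Cmod_div; last by move/RtoC_inj; lra.
by rewrite Cmod_R Rabs_pos_eq; [apply/Rle_div_l | ]; lra.
Qed.

Lemma disk_retraction_id w : Cmod w <= 1 -> disk_retraction w = w.
Proof. by move=> H; rewrite /disk_retraction Rmax_left //; field. Qed.

Lemma disk_retraction_cont w : cont (T := C_UniformSpace) disk_retraction w.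
Proof.
apply: cont_div; first exact: cont_id; last first.
  by move/RtoC_inj; have := Rmax_l 1 (Cmod w); lra.
apply: cont_RtoC.
apply: (continuous_ext (fun w : C_UniformSpace => (1 + Cmod w + Rabs (1 - Cmod w)) / 2)).
  by move=> v; rewrite /Rmax /Rabs; case: Rle_dec => ?; case: Rcase_abs => ? /=; lra.
have cm := cont_Cmod _ _ (cont_id w).
have c1 : continuous (fun w : C_UniformSpace => 1 + Cmod w) w.
  by apply: (continuous_plus (fun _ : C_UniformSpace => 1)) => //; apply: continuous_const.
have c2 : continuous (fun w : C_UniformSpace => Rabs (1 - Cmod w)) w.
  apply: (continuous_comp (fun w : C_UniformSpace => 1 - Cmod w) Rabs).
  - by apply: (continuous_minus (fun _ : C_UniformSpace => 1)) => //; apply: continuous_const.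
  - exact: (continuous_abs (1 - Cmod w)).
apply: (continuous_mult (fun w : C_UniformSpace => 1 + Cmod w + Rabs (1 - Cmod w)) (fun _ => / 2)).
- exact: (continuous_plus _ _ _ c1 c2).
- exact: continuous_const.
Qed.

(** If the supremum [M] were not attained, [1 / (M - u)] would be continuous, hence
    bounded. *)
Lemma closed_disk_max (u : C -> R) :
  (forall w, Cmod w <= 1 -> continuous (fun w : C_UniformSpace => u w) w) ->
  exists w0, Cmod w0 <= 1 /\ forall w, Cmod w <= 1 -> u w <= u w0.
Proof.
move=> cu.
pose h (p : R * R) := u (disk_retraction p).
have ch p : continuous h p.
  apply: (continuous_comp (fun p : C_UniformSpace => disk_retraction p) u).
  - exact: disk_retraction_cont.
  - by apply: cu; apply: disk_retraction_le.
have in_square w : Cmod w <= 1 -> -1 <= fst w <= 1 /\ -1 <= snd w <= 1.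
  move=> Hw; have := Rmax_Cmod w.
  have := Rmax_l (Rabs (fst w)) (Rabs (snd w)); have := Rmax_r (Rabs (fst w)) (Rabs (snd w)).
  move=> K1 K2 K3; have := proj1 (Rabs_le_between (fst w) 1) ltac:(lra).
  have := proj1 (Rabs_le_between (snd w) 1) ltac:(lra); lra.
have hE w : Cmod w <= 1 -> h (fst w, snd w) = u w.
  by move=> Hw; rewrite -surjective_pairing /h disk_retraction_id.
have [M0 HM0] := square_bounded h (-1) 1 (-1) 1 (fun x y _ _ => ch (x, y)).
pose E r := exists w, Cmod w <= 1 /\ r = u w.
have [M [ub lub]] : {M | is_lub E M}.
  apply: completeness; last by exists (u 0), 0; rewrite Cmod_0; split=> //; lra.
  exists M0 => _ [w [Hw ->]]; have [H1 H2] := in_square w Hw.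
  by rewrite -(hE w Hw); apply: HM0.
apply: NNPP => none.
have lt w : Cmod w <= 1 -> u w < M.
  move=> Hw; case: (ub (u w)) => [|//|E1]; first by exists w.
  case: none; exists w; split=> // v Hv; rewrite E1; apply: ub; by exists v.
have [K HK] : exists K, forall x y, -1 <= x <= 1 -> -1 <= y <= 1 -> / (M - h (x, y)) <= K.
  apply: (square_bounded (fun p => / (M - h p))) => x y _ _.
  apply: (continuous_comp (fun p : R * R => M - h p) Rinv).
  - by apply: (continuous_minus (fun _ : R * R => M)) => //; apply: continuous_const.
  - apply: continuous_Rinv; have := lt _ (disk_retraction_le (x, y)); rewrite -/(h (x, y)); lra.
have Kp : 0 < K.
  have := HK 0 0 ltac:(lra) ltac:(lra).
  have := lt _ (disk_retraction_le (0, 0)); rewrite -/(h (0, 0)) => H1 H2.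
  by apply: Rlt_le_trans H2; apply: Rinv_0_lt_compat; lra.
have : M <= M - / K.
  apply: lub => _ [w [Hw ->]]; have [H1 H2] := in_square w Hw.
  have := HK _ _ H1 H2; rewrite hE // => H3; have H4 := lt w Hw.
  have : / K <= M - u w; last lra.
  rewrite -(Rinv_inv (M - u w)); apply: Rinv_le_contravar => //.
  by apply: Rinv_0_lt_compat; lra.
have := Rinv_0_lt_compat _ Kp; lra.
Qed.

Section Density.

Variables (D : C -> Prop) (lam : C -> R) (pi : C -> C).
Hypothesis pi_cov : universal_covering pi D.
Hypothesis lam_pi : forall zeta, unit_disk zeta ->
  lam (pi zeta) * Cmod (C_derive pi zeta) = 1 / (1 - Cmod zeta ^ 2).

Let pi_an : analytic_on unit_disk pi := proj1 pi_cov.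

Lemma pi_onto z : D z -> exists zeta, unit_disk zeta /\ pi zeta = z.
Proof. by case: pi_cov => _ [_ [_ [H _]]]; apply: H. Qed.

Lemma pi_deriv_pos zeta : unit_disk zeta -> 0 < Cmod (C_derive pi zeta) /\ 0 < lam (pi zeta).
Proof.
move=> Hz; have P : 0 < lam (pi zeta) * Cmod (C_derive pi zeta).
  by rewrite lam_pi //; apply: Rdiv_lt_0_compat; [lra | apply: one_minus_sq_pos].
case: (Cmod_ge_0 (C_derive pi zeta)) => [yp | E]; last by move: P; rewrite -E; lra.
split=> //; nra.
Qed.

Lemma pi_local_inverse zeta : unit_disk zeta -> exists (Q : C -> C) (m : R), 0 < m /\
  Q (pi zeta) = zeta /\
  forall v, disc (pi zeta) m v -> unit_disk (Q v) /\ pi (Q v) = v /\ exists l, has_deriv Q v l.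
Proof.
move=> Hz; case: pi_cov => _ [lu _]; have [U [oU [Uz [UD inj]]]] := lu zeta Hz.
have [d [d0 Hd]] := open_C_disc U zeta oU Uz.
have cf : conformal_on (disc zeta d) pi.
  split; first by apply: analytic_sub pi_an => w /Hd /UD.
  by move=> w v Hw Hv; apply: inj; apply: Hd.
have [m [m0 Hm]] := conformal_open_map (disc zeta d) pi zeta d cf d0 (fun w Hw => Hw).
pose Q v := epsilon (inhabits zeta) (fun w => disc zeta d w /\ pi w = v).
have HQ w : disc zeta d w -> Q (pi w) = w.
  move=> Hw; have [H1 H2] : disc zeta d (Q (pi w)) /\ pi (Q (pi w)) = pi w.
    by apply: (epsilon_spec (inhabits zeta) (fun v => disc zeta d v /\ pi v = pi w)); exists w.
  by apply: (proj2 cf).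
exists Q, m; split=> //; split; first by apply/HQ/disc_center.
move=> v /Hm [w [Hw <-]]; rewrite HQ //; split; first by apply/UD/Hd.
split=> //; eexists; apply: (conformal_inverse_deriv (disc zeta d)) => //.
exact: disc_open.
Qed.

(** Near [pi zeta] the relation between [lam] and [pi] can be solved for [lam] by
    means of a local inverse of [pi]. *)
Lemma lam_cont z : D z -> continuous (fun w : C_UniformSpace => lam w) z.
Proof.
move=> /pi_onto [zeta [Hz <-]].
have [Q [m [m0 [Qz HQ]]]] := pi_local_inverse zeta Hz.
have [_ [_ [l Hl]]] := HQ _ (disc_center _ _ m0).
have cQ := has_deriv_cont _ _ _ Hl.
apply: (continuous_ext_loc (U := R_UniformSpace) (T := C_UniformSpace) _
  (fun v => / ((1 - Cmod (Q v) * Cmod (Q v)) * Cmod (C_derive pi (Q v))))).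
  apply/locally_C_iff; exists m; split=> // v Hv.
  have [H1 [H2 _]] := HQ v Hv.
  have [dp _] := pi_deriv_pos _ H1; have o := one_minus_sq_pos _ H1.
  have := lam_pi _ H1; rewrite H2 => E.
  apply: (Rmult_eq_reg_r (Cmod (C_derive pi (Q v)))); last lra.
  by rewrite E; field; lra.
have cm := cont_Cmod _ _ cQ.
have Hz' : unit_disk (Q (pi zeta)) by rewrite Qz.
have [dp _] := pi_deriv_pos _ Hz'; have o := one_minus_sq_pos _ Hz'.
apply: (continuous_comp (fun v : C_UniformSpace =>
   (1 - Cmod (Q v) * Cmod (Q v)) * Cmod (C_derive pi (Q v))) Rinv); last first.
  by apply: continuous_Rinv; nra.
apply: (continuous_mult (fun v : C_UniformSpace => 1 - Cmod (Q v) * Cmod (Q v))).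
- apply: (continuous_minus (fun _ : C_UniformSpace => 1)); first exact: continuous_const.
  exact: (continuous_mult _ _ _ cm cm).
- apply: cont_Cmod; apply: cont_comp => //.
  by apply: analytic_cont (analytic_derivative _ _ unit_disk_open pi_an) Hz'.
Qed.

Variables (G : C -> C) (z0 : C).
Hypothesis G_conf : conformal_on unit_disk G.
Hypothesis G_in : forall w, unit_disk w -> D (G w).
Hypothesis G_onto : forall z, D z -> exists w, unit_disk w /\ G w = z.
Hypothesis G_0 : G 0 = z0.

Let D0 := unit_disk_0.

(** The Schwarz-Pick inequality for the covering followed by the inverse of the
    Riemann map. *)
Lemma density_ge : 1 <= lam z0 * Cmod (C_derive G 0).
Proof.
have Dz0 : D z0 by rewrite -G_0; apply: G_in.
have [zeta [Hz Ez]] := pi_onto z0 Dz0; have Hz' : Cmod zeta < 1 by [].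
pose g v := epsilon (inhabits zeta) (fun w => unit_disk w /\ G w = v).
have Hg v : D v -> unit_disk (g v) /\ G (g v) = v.
  by move=> Dv; apply: (epsilon_spec (inhabits zeta) _ (G_onto v Dv)).
have gG w : unit_disk w -> g (G w) = w.
  by move=> Hw; have [H1 H2] := Hg _ (G_in w Hw); apply: (proj2 G_conf).
have pi_in w : unit_disk w -> D (pi w).
  by case: pi_cov => _ [_ [H _]]; apply: H.
have dg v : D v -> has_deriv g v (/ C_derive G (g v)).
  move=> Dv; have [H1 H2] := Hg v Dv; rewrite -{1}H2.
  exact: (conformal_inverse_deriv unit_disk G g (g v) unit_disk_open G_conf gG H1).
have Hmz : Cmod (- zeta) < 1 by rewrite Cmod_opp.
pose m w := mob (- zeta) w.
have m_in w : unit_disk w -> unit_disk (m w) by move=> Hw; apply: mob_lt.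
have H w : unit_disk w -> has_deriv (fun w => g (pi (m w))) w
    (/ C_derive G (g (pi (m w))) * (C_derive pi (m w) * C_derive m w)).
  move=> Hw; apply: (has_deriv_comp g (fun w => pi (m w))); first by apply/dg/pi_in/m_in.
  apply: (has_deriv_comp pi m); first by apply: analytic_deriv pi_an (m_in w Hw).
  by apply: analytic_deriv Hw; apply: analytic_mob.
have m0 : m 0 = zeta by rewrite /m mob_opp_a.
have g0 : g z0 = 0 by rewrite -G_0 gG.
have S : Cmod (C_derive (fun w => g (pi (m w))) 0) <= 1 / 1.
  apply: schwarz_deriv; first lra.
  - by apply: analytic_intro => w /unit_disk_of_disc Hw; eexists; apply: H.
  - by move=> w /unit_disk_of_disc Hw; apply/Rlt_le; case: (Hg _ (pi_in _ (m_in w Hw))).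
  - by rewrite m0 Ez g0.
rewrite (C_derive_has _ _ _ (H 0 D0)) m0 Ez g0 in S.
have nG : C_derive G 0 <> 0 by apply: conformal_deriv_neq unit_disk_open G_conf D0.
have pG : 0 < Cmod (C_derive G 0) by apply/Cmod_gt_0.
rewrite !Cmod_mult Cmod_inv // /m C_derive_mob_0 // Cmod_opp in S.
have o := one_minus_sq_pos zeta Hz.
rewrite Cmod_R Rabs_pos_eq in S; last lra.
have [dp lp] := pi_deriv_pos zeta Hz.
have := lam_pi zeta Hz; rewrite Ez in lp * => E.
set x := Cmod (C_derive pi zeta) in S dp E; set y := Cmod (C_derive G 0) in S pG *.
have S' : x * (1 - Cmod zeta ^ 2) <= y.
  have -> : x * (1 - Cmod zeta ^ 2) = y * (/ y * (x * (1 - Cmod zeta ^ 2))) by field; lra.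
  rewrite -[X in _ <= X]Rmult_1_r; apply: Rmult_le_compat_l; lra.
have E' : lam z0 * (x * (1 - Cmod zeta ^ 2)) = 1.
  by rewrite -Rmult_assoc E; field; lra.
by rewrite -E'; apply: Rmult_le_compat_l; lra.
Qed.

(** Ahlfors's argument: the density of the pulled-back metric relative to the
    hyperbolic metric of the disk has an interior maximum; moving the maximum
    point to the origin and lifting through the covering, one compares the two
    metrics there. *)
Lemma density_radius_le r : 0 < r < 1 -> r * (lam z0 * Cmod (C_derive G 0)) <= 1.
Proof.
move=> Hr; have Gan := proj1 G_conf.
have sc w : Cmod w <= 1 -> unit_disk (r * w)%C.
  rewrite /unit_disk => Hw; rewrite Cmod_mult Cmod_R Rabs_pos_eq; nra.
pose u w := lam (G (r * w)%C) * (r * Cmod (C_derive G (r * w)%C)) * (1 - Cmod w * Cmod w).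
have c_rw w : cont (T := C_UniformSpace) (fun w => r * w)%C w.
  by apply: cont_mult; [apply: cont_const | apply: cont_id].
have cu w : Cmod w <= 1 -> continuous (fun w : C_UniformSpace => u w) w.
  move=> Hw; have Dw := sc w Hw.
  apply: (continuous_mult (fun w : C_UniformSpace =>
     lam (G (r * w)%C) * (r * Cmod (C_derive G (r * w)%C)))).
  - apply: (continuous_mult (fun w : C_UniformSpace => lam (G (r * w)%C))).
    + apply: (continuous_comp (fun w : C_UniformSpace => G (r * w)%C) lam).
      * apply: (cont_comp G (fun w => r * w)%C) => //.
        exact: analytic_cont Gan Dw.
      * exact/lam_cont/G_in.
    + apply: (continuous_mult (fun _ : C_UniformSpace => r)); first exact: continuous_const.
      apply: cont_Cmod; apply: (cont_comp (C_derive G) (fun w => r * w)%C) => //.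
      exact: analytic_cont (analytic_derivative _ _ unit_disk_open Gan) Dw.
  - apply: (continuous_minus (fun _ : C_UniformSpace => 1)); first exact: continuous_const.
    have cm := cont_Cmod _ _ (cont_id w).
    exact: (continuous_mult _ _ _ cm cm).
(* [u] vanishes on the unit circle and is positive at the origin, so [w0] is an
   interior point. *)
have [w0 [Hw0 Hmax]] := closed_disk_max u cu.
have nG w : unit_disk w -> 0 < Cmod (C_derive G w).
  by move=> Hw; apply/Cmod_gt_0/(conformal_deriv_neq unit_disk G w unit_disk_open G_conf).
have lam_pos z : D z -> 0 < lam z.
  by move=> /pi_onto [zeta [Hz <-]]; case: (pi_deriv_pos zeta Hz).
have u0 : u 0 = r * (lam z0 * Cmod (C_derive G 0)).
  by rewrite /u Cmult_0_r G_0 Cmod_0; ring.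
have Dz0 : D z0 by rewrite -G_0; apply: G_in.
have u0p : 0 < u 0.
  rewrite u0; apply: Rmult_lt_0_compat; first lra.
  by apply: Rmult_lt_0_compat; [apply: lam_pos | apply: nG].
rewrite -u0; apply: Rle_trans (Hmax 0 ltac:(by rewrite Cmod_0; lra)) _.
have Dw0 : unit_disk w0.
  case: (Rle_lt_or_eq_dec _ _ Hw0) => // E.
  have := Hmax 0 ltac:(by rewrite Cmod_0; lra); rewrite {2}/u E; lra.
have Hmw : Cmod (- w0) < 1 by rewrite Cmod_opp.
pose T := mob (- w0).
have T_in w : unit_disk w -> unit_disk (T w) by move=> Hw; apply: mob_lt.
have T_le w : unit_disk w -> Cmod (T w) <= 1 by move=> /T_in /Rlt_le.
have T0 : T 0 = w0 by rewrite /T mob_opp_a.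
pose chi w := G (r * T w)%C.
have dchi w : unit_disk w -> has_deriv chi w (C_derive G (r * T w) * (0 * T w + r * C_derive T w)).
  move=> Hw; apply: (has_deriv_comp G (fun w => r * T w)%C).
    by apply: analytic_deriv Gan _; apply/sc/T_le.
  apply: has_deriv_mult; first exact: has_deriv_const.
  by apply: analytic_deriv Hw; apply: analytic_mob.
have chiE w : unit_disk w ->
    lam (chi w) * Cmod (C_derive chi w) * (1 - Cmod w ^ 2) = u (T w).
  move=> Hw; rewrite (C_derive_has _ _ _ (dchi w Hw)).
  have -> : (0 * T w + r * C_derive T w = r * C_derive T w)%C by ring.
  rewrite !Cmod_mult Cmod_R Rabs_pos_eq; last lra.
  have I := mob_invariance (- w0) w Hmw Hw; rewrite -/T in I.
  rewrite /u /chi; have -> : 1 - Cmod (T w) * Cmod (T w) = 1 - Cmod (T w) ^ 2 by ring.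
  rewrite -I; ring.
have [zeta [Hz Ez]] := pi_onto (chi 0) (G_in _ (sc _ (T_le 0 D0))).
have Hz' : Cmod zeta < 1 by [].
have [Q [m [m0 [Qz HQ]]]] := pi_local_inverse zeta Hz.
rewrite Ez in Qz HQ.
have [d [d0 Hd]] : exists d, 0 < d /\ forall w, Cmod (w - 0) < d -> disc (chi 0) m (chi w).
  exact: (proj1 (cont_C_eps _ _) (has_deriv_cont _ _ _ (dchi 0 D0)) m m0).
pose e := Rmin d 1.
have e0 : 0 < e <= 1 by split; [apply: Rmin_pos; lra | apply: Rmin_r].
have in_e w : disc 0 e w -> unit_disk w /\ disc (chi 0) m (chi w).
  rewrite /disc => Hw; split.
  - by apply: unit_disk_of_disc; apply: Rlt_le_trans Hw (Rmin_r _ _).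
  - by apply: Hd; apply: Rlt_le_trans Hw (Rmin_l _ _).
(* [q] is the lift of [chi] through the covering near the origin. *)
pose q w := Q (chi w).
have dq w : disc 0 e w -> has_deriv q w (C_derive q w).
  move=> /in_e [Hw Hc]; have [_ [_ [l Hl]]] := HQ _ Hc.
  by apply/has_C_derive/has_deriv_ex; eexists; apply: has_deriv_comp Hl (dchi w Hw).
pose s w := mob zeta (q w).
have q_in w : disc 0 e w -> unit_disk (q w) /\ pi (q w) = chi w.
  by move=> /in_e [_ /HQ [H1 [H2 _]]].
have ds w : disc 0 e w -> has_deriv s w (C_derive (mob zeta) (q w) * C_derive q w).
  move=> Hw; apply: (has_deriv_comp (mob zeta) q); last exact: dq.
  by apply: analytic_deriv (analytic_mob zeta Hz') (proj1 (q_in w Hw)).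
have q0 : q 0 = zeta by [].
have s0 : s 0 = 0 by rewrite /s q0; apply: mob_a.
have D0e : disc 0 e 0 by apply: disc_center; lra.
have sE w : disc 0 e w ->
    lam (chi w) * Cmod (C_derive chi w) * (1 - Cmod (s w) ^ 2) = Cmod (C_derive s w).
  move=> Hw; have [H1 H2] := q_in w Hw; have [Dw _] := in_e w Hw.
  have Ec : C_derive chi w = (C_derive pi (q w) * C_derive q w)%C.
    apply: (has_deriv_uniq chi w); first by apply/has_C_derive/has_deriv_ex; eexists; apply: dchi.
    have [d' [Hd' Hin]] := disc_near 0 e w Hw.
    apply: (has_deriv_ext_loc (fun w => pi (q w))).
      by exists d'; split=> // v Hv; case: (q_in v (Hin v Hv)).
    by apply: has_deriv_comp (analytic_deriv _ _ _ pi_an H1) (dq w Hw).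
  have I := mob_invariance zeta (q w) Hz' H1; rewrite -/(s w) in I.
  rewrite (C_derive_has _ _ _ (ds w Hw)) Ec -I (Cmod_mult (C_derive pi (q w))).
  rewrite (Cmod_mult (C_derive (mob zeta) (q w))).
  have E := lam_pi _ H1; rewrite H2 in E; have o := one_minus_sq_pos _ H1.
  have -> : lam (chi w) * (Cmod (C_derive pi (q w)) * Cmod (C_derive q w)) *
     (Cmod (C_derive (mob zeta) (q w)) * (1 - Cmod (q w) ^ 2)) =
     (lam (chi w) * Cmod (C_derive pi (q w))) * (1 - Cmod (q w) ^ 2) *
     (Cmod (C_derive (mob zeta) (q w)) * Cmod (C_derive q w)) by ring.
  by rewrite E; field; lra.
have uw0 : u w0 = Cmod (C_derive s 0).
  have := chiE 0 D0; rewrite T0 => <-.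
  by rewrite -sE // s0 !Cmod_0.
rewrite uw0; apply: (local_ahlfors s e e0) => //.
  by apply: analytic_intro => w Hw; eexists; apply: ds.
move=> w Hw; have [Dw _] := in_e w Hw; have [H1 _] := q_in w Hw.
rewrite -(sE w Hw) -uw0.
have o : 0 < 1 - Cmod (s w) ^ 2.
  by apply: one_minus_sq_pos; apply: mob_lt.
have := Hmax (T w) (T_le w Dw); rewrite -(chiE w Dw) => K.
have -> : lam (chi w) * Cmod (C_derive chi w) * (1 - Cmod (s w) ^ 2) * (1 - Cmod w ^ 2) =
  lam (chi w) * Cmod (C_derive chi w) * (1 - Cmod w ^ 2) * (1 - Cmod (s w) ^ 2) by ring.
by apply: Rmult_le_compat_r; lra.
Qed.

Lemma density_eq : lam z0 * Cmod (C_derive G 0) = 1.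
Proof.
apply: Rle_antisym; last exact: density_ge.
apply: Rnot_lt_le => H; set x := lam z0 * _ in H.
have x0 : 0 < / x < 1.
  split; first by apply: Rinv_0_lt_compat; lra.
  by rewrite -Rinv_1; apply: Rinv_lt_contravar; lra.
have := density_radius_le ((/ x + 1) / 2) ltac:(lra); rewrite -/x.
have : / x * x = 1 by apply: Rinv_l; lra.
nra.
Qed.

End Density.

(** A Riemann map is a universal covering with a single sheet. *)
Lemma hyperbolic_density_exists (D : C -> Prop) G : open (T := C_UniformSpace) D ->
  conformal_on unit_disk G -> (forall w, unit_disk w -> D (G w)) ->
  (forall z, D z -> exists w, unit_disk w /\ G w = z) ->
  exists lam, is_hyperbolic_density D lam.
Proof.
move=> oD cG G_in G_onto.
pose g v := epsilon (inhabits (RtoC 0)) (fun w => unit_disk w /\ G w = v).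
have Hg v : D v -> unit_disk (g v) /\ G (g v) = v.
  by move=> Dv; apply: (epsilon_spec (inhabits (RtoC 0)) _ (G_onto v Dv)).
have gG w : unit_disk w -> g (G w) = w.
  by move=> Hw; have [H1 H2] := Hg _ (G_in w Hw); apply: (proj2 cG).
exists (fun z => 1 / ((1 - Cmod (g z) ^ 2) * Cmod (C_derive G (g z)))); exists G; split.
- split; first by case: cG.
  split.
    move=> z Hz; exists unit_disk; split; first exact: unit_disk_open.
    by do 2 (split=> //); case: cG.
  split=> //; split; first exact: G_onto.
  move=> w Dw; exists D; do 3 (split=> //).
  exists unit, (fun _ => unit_disk); split; first by move=> _; apply: unit_disk_open.
  split; first by move=> [] [].
  split; first by move=> z; split=> [[Hz _] | [_ Hz]]; [exists tt | split=> //; apply: G_in].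
  move=> _; split.
    apply: continuous_on_forall => z Hz; exact: (analytic_cont _ _ _ (proj1 cG) Hz).
  split=> //; exists g; split.
    apply: continuous_on_forall => z Dz; have [H1 H2] := Hg z Dz; rewrite -H2.
    exact: (conformal_inverse_cont unit_disk G g (g z) unit_disk_open cG gG H1).
  by split; [move=> v /Hg [] | split=> // v /Hg []].
- move=> zeta Hz; rewrite gG //.
  have o := one_minus_sq_pos zeta Hz.
  have p : 0 < Cmod (C_derive G zeta).
    by apply/Cmod_gt_0/(conformal_deriv_neq unit_disk G zeta unit_disk_open cG).
  by field; lra.
Qed.

(** The chosen density may come from an unknown covering, so [density_eq] has to
    hold for all of them; the Riemann map guarantees that there is one. *)
Theorem hyperbolic_density_riemann (D : C -> Prop) G : open (T := C_UniformSpace) D ->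
  conformal_on unit_disk G -> (forall w, unit_disk w -> D (G w)) ->
  (forall z, D z -> exists w, unit_disk w /\ G w = z) ->
  hyperbolic_density D (G 0) * Cmod (C_derive G 0) = 1.
Proof.
move=> oD cG G_in G_onto.
have ex := hyperbolic_density_exists D G oD cG G_in G_onto.
have [pi [cov E]] : is_hyperbolic_density D (hyperbolic_density D).
  exact: (epsilon_spec (inhabits (fun _ : C => 0)) _ ex).
exact: (density_eq D (hyperbolic_density D) pi cov E G (G 0)).
Qed.

(** * The distance to the boundary of the image *)

(** A segment without boundary points would be covered by the interior and the
    exterior of [G], two disjoint open sets. *)
Lemma boundary_on_segment (G : C -> Prop) w v : open (T := C_UniformSpace) G ->
  G w -> ~ G v -> exists b, boundary G b /\ Cmod (w - b) <= Cmod (w - v).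
Proof.
move=> oG Gw Nv; apply: NNPP => none.
pose U z := locally (T := C_UniformSpace) z G.
pose V z := locally (T := C_UniformSpace) z (fun z => ~ G z).
have oU : open (T := C_UniformSpace) U by move=> z; apply: locally_locally.
have oV : open (T := C_UniformSpace) V by move=> z; apply: locally_locally.
have cover t : let b := (RtoC (1 - clamp t) * w + clamp t * v)%C in U b \/ V b.
  move=> b; apply: NNPP => N; apply: none; exists b; split.
    by split=> H; apply: N; [right | left].
  have -> : (w - b = clamp t * (w - v))%C by rewrite /b RtoC_minus; ring.
  have Ht := clamp_in t; rewrite Cmod_mult Cmod_R Rabs_pos_eq; last lra.
  by have := Cmod_ge_0 (w - v); nra.
have Vv : V v.
  apply: NNPP => N; apply: none; exists v; split; last exact: Rle_refl.
  by split=> // /locally_singleton.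
have [t [Ut Vt]] := segment_connected U V w v oU oV cover (oG w Gw) Vv.
by case: (locally_singleton _ _ Vt); apply: (locally_singleton _ _ Ut).
Qed.

Lemma boundary_not_in (G : C -> Prop) b : open (T := C_UniformSpace) G -> boundary G b -> ~ G b.
Proof. by move=> oG [_ H] Gb; apply: H; apply: oG. Qed.

Lemma dist_boundary_glb (G : C -> Prop) w b0 : boundary G b0 ->
  (forall b, boundary G b -> dist_boundary G w <= Cmod (w - b)) /\
  (forall m, (forall b, boundary G b -> m <= Cmod (w - b)) -> m <= dist_boundary G w).
Proof.
move=> H0; rewrite /dist_boundary.
set E := fun d : R => exists b, boundary G b /\ d = Cmod (w - b)%C.
have [lb glb] := Glb_Rbar_correct E.
have E0 : E (Cmod (w - b0)) by exists b0.
have L0 := lb _ E0.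
have G0 : Rbar_le 0 (Glb_Rbar E) by apply: glb => _ [b [_ ->]]; apply: Cmod_ge_0.
case: (Glb_Rbar E) lb glb L0 G0 => [d | |] // lb glb _ _; split.
- by move=> b Hb; apply: (lb (Cmod (w - b))); exists b.
- by move=> m Hm; apply: (glb (Finite m)) => _ [b [Hb ->]]; apply: Hm.
Qed.

Lemma dist_boundary_le (G : C -> Prop) w v : open (T := C_UniformSpace) G ->
  G w -> ~ G v -> dist_boundary G w <= Cmod (w - v).
Proof.
move=> oG Gw Nv; have [b [Hb Hle]] := boundary_on_segment G w v oG Gw Nv.
by apply: Rle_trans Hle; apply: (proj1 (dist_boundary_glb G w b Hb)).
Qed.

Lemma dist_boundary_ge (G : C -> Prop) w v m : open (T := C_UniformSpace) G ->
  G w -> ~ G v -> (forall b, ~ G b -> m <= Cmod (w - b)) -> m <= dist_boundary G w.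
Proof.
move=> oG Gw Nv Hm; have [b [Hb _]] := boundary_on_segment G w v oG Gw Nv.
apply: (proj2 (dist_boundary_glb G w b Hb)) => b' Hb'.
by apply: Hm; apply: boundary_not_in Hb'.
Qed.

(** Schwarz's lemma for the inverse map, on a disc contained in the image. *)
Lemma image_omits F R0 : conformal_on unit_disk F -> Cmod (C_derive F 0) < R0 ->
  exists v, ~ image F unit_disk v /\ Cmod (F 0 - v) < R0.
Proof.
move=> cF H; apply: NNPP => none.
have D0 := unit_disk_0.
have nF : C_derive F 0 <> 0 by apply: conformal_deriv_neq unit_disk_open cF D0.
have pF : 0 < Cmod (C_derive F 0) by apply/Cmod_gt_0.
pose g v := epsilon (inhabits (RtoC 0)) (fun w => unit_disk w /\ F w = v).
have Hg v : image F unit_disk v -> unit_disk (g v) /\ F (g v) = v.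
  by move=> Hv; apply: (epsilon_spec (inhabits (RtoC 0)) _ Hv).
have gF w : unit_disk w -> g (F w) = w.
  move=> Hw; have [H1 H2] := Hg (F w) ltac:(by exists w).
  exact: (proj2 cF).
have sub v : disc (F 0) R0 v -> image F unit_disk v.
  move=> Hv; apply: NNPP => N; apply: none; exists v; split=> //.
  by rewrite Cmod_sub_sym.
have dg v : disc (F 0) R0 v -> has_deriv g v (/ C_derive F (g v)).
  move=> /sub Hv; have [H1 H2] := Hg v Hv; rewrite -{1}H2.
  exact: (conformal_inverse_deriv unit_disk F g (g v) unit_disk_open cF gF H1).
have R0p : 0 < R0 by lra.
have S := schwarz_deriv g (F 0) R0 1 R0p
  ltac:(by apply: analytic_intro => v Hv; eexists; apply: dg)
  ltac:(by move=> v /sub Hv; apply/Rlt_le; case: (Hg v Hv)) (gF 0 D0).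
rewrite (C_derive_has _ _ _ (dg _ (disc_center _ _ R0p))) gF // Cmod_inv // in S.
have : / Cmod (C_derive F 0) <= / R0 by move: S; rewrite /Rdiv Rmult_1_l.
move=> K; have := Rinv_lt_contravar _ _ (Rmult_lt_0_compat _ _ pF R0p) H; lra.
Qed.

Theorem koebe_distance F : conformal_on unit_disk F ->
  Cmod (C_derive F 0) / 4 <= dist_boundary (image F unit_disk) (F 0) <= Cmod (C_derive F 0).
Proof.
move=> cF; have D0 := unit_disk_0.
have oI := conformal_image_open unit_disk F unit_disk_open cF.
have I0 : image F unit_disk (F 0) by exists 0.
split.
- have [v [Nv _]] := image_omits F (Cmod (C_derive F 0) + 1) cF ltac:(lra).
  apply: (dist_boundary_ge _ _ v) => // b Nb.
  by have := koebe_quarter F b cF Nb; lra.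
- apply: le_epsilon => e He.
  have [v [Nv Hv]] := image_omits F (Cmod (C_derive F 0) + e) cF ltac:(lra).
  by apply: Rle_trans (dist_boundary_le _ _ v oI I0 Nv) _; lra.
Qed.

Lemma unit_disk_proper : exists w, ~ unit_disk w.
Proof. by exists (RtoC 1); rewrite /unit_disk Cmod_1; lra. Qed.

Lemma conformal_id : conformal_on unit_disk (fun z => z).
Proof. by split=> //; apply: analytic_intro => z _; eexists; apply: has_deriv_id. Qed.

Lemma density_disk_0 : hyperbolic_density unit_disk 0 = 1.
Proof.
have := hyperbolic_density_riemann unit_disk _ unit_disk_open conformal_id
  (fun w Hw => Hw) (fun z Hz => ex_intro _ z (conj Hz (erefl z))).
by rewrite (C_derive_has _ _ _ (has_deriv_id 0)) Cmod_1 Rmult_1_r.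
Qed.

(** The extremal function for the upper bound: it maps the disk onto the plane slit
    along the real axis from [-1/4] to minus infinity. *)
Definition koebe_function (z : C) : C := (z / ((1 - z) * (1 - z)))%C.

Lemma one_minus_neq z : unit_disk z -> (1 - z)%C <> 0.
Proof.
by move=> Hz /Cminus_0_eq E; move: Hz; rewrite -E /unit_disk Cmod_1; lra.
Qed.

Lemma has_deriv_koebe z : unit_disk z -> has_deriv koebe_function z
  ((1 * ((1 - z) * (1 - z)) - z * ((0 - 1) * (1 - z) + (1 - z) * (0 - 1)))
     / (((1 - z) * (1 - z)) * ((1 - z) * (1 - z)))).
Proof.
move=> Hz; have n := one_minus_neq z Hz.
have d1 := has_deriv_minus _ _ _ _ _ (has_deriv_const 1 z) (has_deriv_id z).
exact: (has_deriv_div _ _ z _ _ (has_deriv_id z) (has_deriv_mult _ _ _ _ _ d1 d1)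
  (Cmult_neq_0 _ _ n n)).
Qed.

Lemma conformal_koebe : conformal_on unit_disk koebe_function.
Proof.
split; first by apply: analytic_intro => z Hz; eexists; apply: has_deriv_koebe.
move=> z w Hz Hw E.
have nz := one_minus_neq z Hz; have nw := one_minus_neq w Hw.
have K : ((z - w) * (1 - z * w) = 0)%C.
  have -> : ((z - w) * (1 - z * w) =
     (koebe_function z - koebe_function w) * (((1 - z) * (1 - z)) * ((1 - w) * (1 - w))))%C.
    by rewrite /koebe_function; field; split.
  by rewrite E; ring.
apply: Cminus_0_eq; apply: NNPP => N; move: K; apply: Cmult_neq_0 => // /Cminus_0_eq E1.
have : Cmod (z * w) = 1 by rewrite -E1 Cmod_1.
rewrite Cmod_mult; rewrite /unit_disk in Hz Hw.
have := Cmod_ge_0 z; have := Cmod_ge_0 w; nra.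
Qed.

Lemma koebe_omits : ~ image koebe_function unit_disk (- (1 / 4))%C.
Proof.
move=> [z [Hz E]]; have n := one_minus_neq z Hz.
have K : ((1 + z) * (1 + z) = 0)%C.
  have -> : ((1 + z) * (1 + z) = 4 * ((1 - z) * (1 - z)) * (koebe_function z - - (1 / 4)))%C.
    by rewrite /koebe_function; field.
  by rewrite E; ring.
have n1 : (1 + z)%C <> 0.
  move=> E1; have Ez : z = (- (1))%C by apply: Cminus_0_eq; rewrite -E1; ring.
  by move: Hz; rewrite Ez /unit_disk Cmod_opp Cmod_1; lra.
by case: (Cmult_neq_0 _ _ n1 n1).
Qed.

Lemma koebe_0 : koebe_function 0 = 0.
Proof. by rewrite /koebe_function /Cdiv Cmult_0_l. Qed.

Lemma koebe_deriv_0 : C_derive koebe_function 0 = 1.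
Proof.
rewrite (C_derive_has _ _ _ (has_deriv_koebe 0 unit_disk_0)).
have -> : (1 - 0 = 1)%C by ring.
field.
Qed.

Theorem theorem1 :
  (forall (D : C -> Prop) (f : C -> C),
     simply_connected_region D -> (exists w, ~ D w) -> conformal_on D f ->
     forall z, D z ->
       hyperbolic_density D z
         <= Cmod (C_derive f z) / dist_boundary (image f D) (f z)
         <= 4 * hyperbolic_density D z) /\
  (forall c : R,
     (forall (D : C -> Prop) (f : C -> C),
        simply_connected_region D -> (exists w, ~ D w) -> conformal_on D f ->
        forall z, D z ->
          c * hyperbolic_density D z
            <= Cmod (C_derive f z) / dist_boundary (image f D) (f z)) ->
     c <= 1) /\
  (forall c : R,
     (forall (D : C -> Prop) (f : C -> C),
        simply_connected_region D -> (exists w, ~ D w) -> conformal_on D f ->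
        forall z, D z ->
          Cmod (C_derive f z) / dist_boundary (image f D) (f z)
            <= c * hyperbolic_density D z) ->
     4 <= c).
Proof.
have bounds (D : C -> Prop) (f : C -> C) : simply_connected_region D -> (exists w, ~ D w) ->
    conformal_on D f -> forall z, D z ->
    hyperbolic_density D z <= Cmod (C_derive f z) / dist_boundary (image f D) (f z)
      <= 4 * hyperbolic_density D z.
  move=> Hsc Hw cf z Dz.
  have [G [cG [G_in [G_onto G0]]]] := riemann_mapping D z Hsc Hw Dz.
  have L := hyperbolic_density_riemann D G (proj1 (proj1 Hsc)) cG G_in G_onto.
  rewrite G0 in L.
  have cF := conformal_comp unit_disk D G f cG G_in cf.
  have := koebe_distance _ cF.
  rewrite (C_derive_comp unit_disk D G f 0 (proj1 cG) (proj1 cf) unit_disk_0 (G_in _ unit_disk_0)).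
  (* [f] composed with [G] has the same image as [f], and its derivative at the
     origin has modulus [|f' z| / lam z]. *)
  have -> : image (fun w => f (G w)) unit_disk = image f D.
    apply: functional_extensionality => v; apply: propositional_extensionality; split.
    - by move=> [w [Hw' <-]]; exists (G w); split=> //; apply: G_in.
    - by move=> [u [Du <-]]; have [w [Hw' <-]] := G_onto u Du; exists w.
  rewrite G0 Cmod_mult.
  have fp : 0 < Cmod (C_derive f z).
    by apply/Cmod_gt_0/(conformal_deriv_neq D) => //; case: Hsc => -[].
  have Gp : 0 < Cmod (C_derive G 0).
    by apply/Cmod_gt_0/(conformal_deriv_neq unit_disk) => //;
      [apply: unit_disk_open | apply: unit_disk_0].
  set a := Cmod (C_derive f z) in fp *; set b := Cmod (C_derive G 0) in Gp L *.
  set d := dist_boundary _ _; set l := hyperbolic_density D z in L * => Hd.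
  have ab : 0 < a * b by apply: Rmult_lt_0_compat.
  have El : l = / b by apply: (Rmult_eq_reg_r b); [rewrite L Rinv_l | ]; lra.
  split.
  - apply/Rle_div_r; first lra.
    rewrite El; apply: (Rmult_le_reg_l b) => //.
    by rewrite -Rmult_assoc Rinv_r; lra.
  - apply/Rle_div_l; first lra.
    have -> : a = 4 * l * (a * b / 4) by rewrite El; field; lra.
    apply: Rmult_le_compat_l; last lra.
    by rewrite El; have := Rinv_0_lt_compat _ Gp; lra.
split; first exact: bounds.
have oI f : conformal_on unit_disk f -> open (T := C_UniformSpace) (image f unit_disk).
  exact: conformal_image_open unit_disk_open.
(* The identity and the Koebe function attain the two bounds at the origin. *)
split=> c Hc.
- have := Hc unit_disk _ unit_disk_simply_connected unit_disk_proper conformal_id 0 unit_disk_0.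
  rewrite density_disk_0 (C_derive_has _ _ _ (has_deriv_id 0)) Cmod_1 Rmult_1_r.
  have I1 : ~ image (fun z => z) unit_disk 1.
    by move=> [z [Hz E]]; move: Hz; rewrite E /unit_disk Cmod_1; lra.
  have d1 : 1 <= dist_boundary (image (fun z => z) unit_disk) 0.
    apply: (dist_boundary_ge _ _ 1) => //; first by apply/oI/conformal_id.
      by exists 0; split=> //; apply: unit_disk_0.
    move=> b Nb; have -> : (0 - b = - b)%C by ring.
    by rewrite Cmod_opp; apply: Rnot_lt_le => Hb; apply: Nb; exists b.
  move=> H; apply: Rle_trans H _; apply/Rle_div_l; lra.
- have := Hc unit_disk _ unit_disk_simply_connected unit_disk_proper conformal_koebe 0 unit_disk_0.
  rewrite density_disk_0 koebe_deriv_0 Cmod_1 Rmult_1_r koebe_0.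
  have K := koebe_distance _ conformal_koebe.
  rewrite koebe_0 koebe_deriv_0 Cmod_1 in K.
  have d4 : dist_boundary (image koebe_function unit_disk) 0 <= 1 / 4.
    have := dist_boundary_le _ 0 _ (oI _ conformal_koebe) _ koebe_omits.
    have -> : Cmod (0 - - (1 / 4)) = 1 / 4.
      have -> : (0 - - (1 / 4) = RtoC (1 / 4))%C by rewrite RtoC_div; [ring | lra].
      by rewrite Cmod_R Rabs_pos_eq; lra.
    by apply; exists 0; split; [apply: unit_disk_0 | apply: koebe_0].
  set d := dist_boundary _ _ in K d4 * => H; apply: Rle_trans H.
  have dp : 0 < d by lra.
  by apply: (proj1 (Rle_div_r 4 1 d dp)); lra.
Qed.
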